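(* Let $\beta>0$. For every Riemannian metric $g$ on the Klein bottle $K$ conformal to $g_\beta$, $$l_\sigma(g)\,l_v(g)\,l_h(g)\le \frac{\sqrt{\pi}}{3\sqrt{3}}\cdot\frac{\left(b^4-4b\omega+\omega^2+\omega^4-2b^2(-2+\omega^2)\right)^{\frac14}(2b-\omega)}{(b-\omega)\sqrt{(b-\omega)b}}\;\mathrm{vol}(g)^{\frac32},$$ where $\omega\in\,]0,\frac{\pi}{2}[$ is given by $$\beta=2\ln\left(\tan\left(\tfrac{\pi}{4}+\tfrac{\omega}{2}\right)\right)+\frac{2}{\cos(\omega)}\left(\tan(\omega)-\omega+\sqrt{\tan^2(\omega)-\omega\tan(\omega)+\omega^2}\right)$$ and $$b=\tan(\omega)+\sqrt{\tan^2(\omega)-\omega\tan(\omega)+\omega^2}.$$ Moreover, equality is achieved by a flat-spherical metric.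
   Context: The Klein bottle $K$ is the quotient of $\mathbb{R}^2=\mathbb{C}$ by the group generated by $\sigma: z\mapsto \bar z+\pi$ and $t: z\mapsto z+2i\beta$, with $\beta>0$; $g_\beta$ is the flat metric induced on $K$ by the Euclidean metric. The group is identified with $\pi_1(K)$. A metric $g$ is conformal to $g_\beta$ if $g=\varphi^2 g_\beta$ for a positive function $\varphi$ on $K$; continuous metrics (continuous $\varphi$) are admitted. $\mathrm{vol}(g)$ is the total area. Lengths, measured with respect to $g$: - $l_\sigma(g)$: least length of a closed curve in the free homotopy class of the glide reflection $\sigma$; - $l_v(g)$: least length of a closed curve in the free homotopy class of the vertical translation $t$; - $l_h(g)$: least length of a closed curve in the free homotopy class of the horizontal translation $\sigma^2$. A metric is called flat-spherical if, outside a finite union of curves where it is only continuous, it is locally isometric, up to one global scaling constant, either to the round unit sphere or to the Euclidean plane, both types occurring.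
   Formalization: In the inequality, l_σ(g) is replaced by the least length over the free homotopy classes of both glide reflections σ and tσ, since with σ alone it fails (a metric round only near the axis of σ); the equality case keeps l_σ, with both lengths equal. *)

(* Defs.v *)
From HB Require Import structures.
From mathcomp Require Import all_boot all_order all_algebra generic_quotient.
From mathcomp Require Import all_classical all_reals all_analysis.

Set Implicit Arguments.
Unset Strict Implicit.
Unset Printing Implicit Defensive.

Import Order.TTheory GRing.Theory Num.Theory.
Import numFieldNormedType.Exports.

Local Open Scope classical_set_scope.
Local Open Scope ring_scope.
Local Open Scope quotient_scope.

(* The complex plane is the real plane R * R, the point (x, y) being x + iy. *)

Definition sigma (R : realType) (z : R * R) : R * R := (z.1 + pi, - z.2).

Definition vtrans (R : realType) (beta : R) (z : R * R) : R * R :=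
  (z.1, z.2 + 2 * beta).

(* Orbits of the group generated by sigma and vtrans beta (the t of the      *)
(* comments below): the least equivalence relation that identifies z with    *)
(* sigma z and with vtrans beta z.                                           *)
Inductive klein_orbit (R : realType) (beta : R) : R * R -> R * R -> Prop :=
| orbit_sigma z : klein_orbit beta z (sigma z)
| orbit_vtrans z : klein_orbit beta z (vtrans beta z)
| orbit_refl z : klein_orbit beta z z
| orbit_sym z w : klein_orbit beta z w -> klein_orbit beta w z
| orbit_comp u z w : klein_orbit beta z u -> klein_orbit beta u w -> klein_orbit beta z w.

Definition orbitb (R : realType) (beta : R) : rel (R * R) :=
  fun z w => `[< klein_orbit beta z w >].

Lemma orbitb_refl (R : realType) (beta : R) : reflexive (orbitb beta).
Proof. by move=> z; apply/asboolP; exact: orbit_refl. Qed.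

Lemma orbitb_sym (R : realType) (beta : R) : symmetric (orbitb beta).
Proof. by move=> z w; apply/asboolP/asboolP; exact: orbit_sym. Qed.

Lemma orbitb_trans (R : realType) (beta : R) : transitive (orbitb beta).
Proof.
by move=> u z w /asboolP zu /asboolP uw; apply/asboolP; exact: orbit_comp zu uw.
Qed.

Definition orbit_equiv (R : realType) (beta : R) : equiv_rel (R * R) :=
  EquivRel (orbitb beta)
    (@orbitb_refl R beta) (@orbitb_sym R beta) (@orbitb_trans R beta).

Definition klein (R : realType) (beta : R) : topologicalType :=
  quotient_topology {eq_quot (orbit_equiv beta)}.

Definition klein_proj (R : realType) (beta : R) (z : R * R) : klein beta :=
  \pi_(klein beta) z.

(* phi encodes the metric phi^2 g_beta. *)
Definition conformal_factor (R : realType) (beta : R)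
    (phi : klein beta -> R) : Prop :=
  continuous phi /\ (forall p, 0 < phi p).

(* Area, computed on the fundamental domain [0, pi] x [-beta, beta]. *)
Definition vol (R : realType) (beta : R) (phi : klein beta -> R) : R :=
  (\int[(@lebesgue_measure R \x @lebesgue_measure R)%E]_(z in
      `[0%R, pi] `*` `[- beta, beta]) (phi (klein_proj beta z) ^+ 2))%R.

Definition continuously_differentiable (R : realType) (f : R -> R) : Prop :=
  (forall s, derivable f s 1) /\ continuous (derive1 f).

Definition piecewise_C1 (R : realType) (f : R -> R) : Prop :=
  {within `[0, 1], continuous f} /\
  exists s : seq R, itv_partition 0 1 s /\
    forall i, (i < size s)%N ->
      exists2 h : R -> R, continuously_differentiable h &
        {in `[nth 0 (0 :: s) i, nth 0 s i], f =1 h}.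

(* Piecewise C^1 curves [0, 1] -> R * R; the values outside [0, 1] are junk.  *)
(* A piecewise C^1 curve of the Klein bottle is the projection of such a      *)
(* curve, since the plane is its universal cover.                             *)
Definition piecewise_C1_curve (R : realType) (c : R -> R * R) : Prop :=
  piecewise_C1 (fun s => (c s).1) /\ piecewise_C1 (fun s => (c s).2).

(* Length, for phi^2 g_beta, of the projection of c to the Klein bottle. *)
Definition curve_length (R : realType) (beta : R) (phi : klein beta -> R)
    (c : R -> R * R) : R :=
  (\int[@lebesgue_measure R]_(s in `[0%R, 1%R])
    (phi (klein_proj beta (c s)) *
     Num.sqrt (derive1 (fun u => (c u).1) s ^+ 2 + derive1 (fun u => (c u).2) s ^+ 2)))%R.

(* Free homotopy of two closed curves [0, 1] -> T. *)
Definition freely_homotopic (R : realType) (T : topologicalType)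
    (c0 c1 : R -> T) : Prop :=
  exists H : R * R -> T,
    [/\ {within `[0, 1] `*` `[0, 1], continuous H},
        forall s, s \in `[0, 1] -> H (0, s) = c0 s,
        forall s, s \in `[0, 1] -> H (1, s) = c1 s
      & forall u, u \in `[0, 1] -> H (u, 0) = H (u, 1)].

(* The closed curve attached to an element gamma of the group by its          *)
(* identification with the fundamental group: the projection of the segment   *)
(* from 0 to gamma 0.                                                         *)
Definition deck_loop (R : realType) (beta : R) (gamma : R * R -> R * R)
    (s : R) : klein beta := klein_proj beta (s *: gamma (0, 0)).

Definition least_length (R : realType) (beta : R)
    (gamma : R * R -> R * R) (phi : klein beta -> R) : R :=
  inf [set L | exists c : R -> R * R,
    [/\ piecewise_C1_curve c,
        klein_proj beta (c 0) = klein_proj beta (c 1),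
        freely_homotopic (klein_proj beta \o c) (deck_loop beta gamma)
      & L = curve_length phi c]].

Definition l_sigma (R : realType) (beta : R) (phi : klein beta -> R) : R :=
  least_length (@sigma R) phi.

(* The glide reflections of translation length pi fall into two conjugacy     *)
(* classes, those of sigma (axis y = 0) and of t sigma (axis y = beta), which *)
(* the isometry z |-> z + i beta of g_beta exchanges. The minimum of l_sigma  *)
(* and l_tsigma is the least length over both; l_sigma alone does not satisfy *)
(* the product inequality, as a metric that is round only near y = 0 shows.   *)
Definition l_tsigma (R : realType) (beta : R) (phi : klein beta -> R) : R :=
  least_length (vtrans beta \o @sigma R) phi.

Definition l_v (R : realType) (beta : R) (phi : klein beta -> R) : R :=
  least_length (vtrans beta) phi.

Definition l_h (R : realType) (beta : R) (phi : klein beta -> R) : R :=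
  least_length (@sigma R \o @sigma R) phi.

Definition dx (R : realType) (f : R * R -> R) : R * R -> R :=
  fun z => 'D_((1, 0) : R * R) f z.

Definition dy (R : realType) (f : R * R -> R) : R * R -> R :=
  fun z => 'D_((0, 1) : R * R) f z.

Fixpoint Ck_on (R : realType) (U : set (R * R)) (k : nat) (f : R * R -> R)
    : Prop :=
  (forall z, U z -> {for z, continuous f}) /\
  (if k is k'.+1 then
     [/\ forall z, U z -> derivable f z ((1, 0) : R * R),
         forall z, U z -> derivable f z ((0, 1) : R * R),
         Ck_on U k' (dx f) & Ck_on U k' (dy f)]
   else True).

Definition smooth_on (R : realType) (U : set (R * R)) (f : R * R -> R) : Prop :=
  forall k, Ck_on U k f.

(* F : U -> R^n is smooth and pulls the Euclidean metric back to              *)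
(* rho^2 (dx^2 + dy^2).                                                        *)
Definition isometric_on (R : realType) (n : nat) (U : set (R * R))
    (rho : R * R -> R) (F : 'I_n -> R * R -> R) : Prop :=
  (forall i, smooth_on U (F i)) /\
  (forall z, U z ->
    [/\ \sum_(i < n) dx (F i) z ^+ 2 = rho z ^+ 2,
        \sum_(i < n) dy (F i) z ^+ 2 = rho z ^+ 2
      & \sum_(i < n) dx (F i) z * dy (F i) z = 0]).

(* Near z, the metric rho^2 (dx^2 + dy^2) is isometric to the Euclidean plane *)
(* (resp. the unit sphere of R^3): by the inverse function theorem a map      *)
(* which is isometric in the above sense is a local diffeomorphism.           *)
Definition locally_flat (R : realType) (rho : R * R -> R) (z : R * R) : Prop :=
  exists U : set (R * R), [/\ open U, U z &
    exists F : 'I_2 -> R * R -> R, isometric_on U rho F].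

Definition locally_spherical (R : realType) (rho : R * R -> R) (z : R * R)
    : Prop :=
  exists U : set (R * R), [/\ open U, U z &
    exists F : 'I_3 -> R * R -> R, isometric_on U rho F /\
      (forall w, U w -> \sum_(i < 3) F i w ^+ 2 = 1)].

(* The finite union of curves is the union of the projections of the c i.     *)
Definition flat_spherical (R : realType) (beta : R) (phi : klein beta -> R)
    : Prop :=
  exists (lambda : R) (m : nat) (c : 'I_m -> R -> R * R),
    let rho := fun z : R * R => lambda * phi (klein_proj beta z) in
    let off_curves := fun z : R * R =>
      forall i s, s \in `[0, 1] -> klein_proj beta z <> klein_proj beta (c i s) in
    [/\ 0 < lambda,
        forall i, piecewise_C1_curve (c i),
        forall z, off_curves z -> locally_spherical rho z \/ locally_flat rho z,
        exists2 z, off_curves z & locally_spherical rho z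
      & exists2 z, off_curves z & locally_flat rho z].

Definition b_of (R : realType) (w : R) : R :=
  tan w + Num.sqrt (tan w ^+ 2 - w * tan w + w ^+ 2).

Definition beta_of (R : realType) (w : R) : R :=
  2 * ln (tan (pi / 4 + w / 2)) +
  2 / cos w *
    (tan w - w + Num.sqrt (tan w ^+ 2 - w * tan w + w ^+ 2)).

Definition bound_constant (R : realType) (b w : R) : R :=
  Num.sqrt pi / (3 * Num.sqrt 3) *
  ((b ^+ 4 - 4 * b * w + w ^+ 2 + w ^+ 4 - 2 * b ^+ 2 * (- 2 + w ^+ 2))
     `^ (1 / 4) * (2 * b - w) /
   ((b - w) * Num.sqrt ((b - w) * b))).

(* Main.v *)
From HB Require Import structures.
Require Import Defs.
From mathcomp Require Import all_boot all_order all_algebra.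
From mathcomp Require Import all_classical all_reals all_analysis.
From mathcomp Require Import ring lra zify.

Set Implicit Arguments.
Unset Strict Implicit.
Unset Printing Implicit Defensive.

Import Order.TTheory GRing.Theory Num.Theory.
Import numFieldNormedType.Exports.

Local Open Scope classical_set_scope.
Local Open Scope ring_scope.

(* The upper bound. Write a conformal factor phi as a function on the plane and let u(y) be
   its integral over x in [0, 2 pi]. Horizontal lines give l_h <= u(y) and vertical lines
   give 2 pi l_v <= 2 (integral of u over [0, beta]). In Mercator coordinates, sech y is the
   conformal factor of the round sphere; averaging the lengths of half great circles over
   rotations, then over their inclinations by Archimedes' hat-box theorem, gives
   2 l_sigma tanh Y <= (integral of u(y) sech y over [0, Y]), and likewise at the axis
   y = beta for the other class of glide reflections.
   With the extremal profile f(y) = max (sech (dist (y, beta Z)), cos w), a suitable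
   combination of these inequalities bounds (integral of u f over [0, beta]) from below by a
   linear form in l_v, l_h and the lengths of the glide reflections; Cauchy-Schwarz and the
   inequality between arithmetic and geometric means conclude.

   Equality. The metric of conformal factor f(y) consists of two spherical caps and flat
   strips. Its lengths are bounded from below by calibrations: cos w * x for l_h, a primitive
   of f for l_v, and the spherical distance to a suitable point for the glide reflections.
   Lifting of homotopies through circle-valued maps determines the endpoints of a lift of a
   closed curve from its free homotopy class. *)

(** * Integrals and derivatives on the line *)

(** The constants come from demanding equality in every step. The profile f is split into a constant
    [cos w * ratio w], paid for by vertical lines, and the excess over it, paid for by half great
    circles on the caps and by horizontal lines on the strip. The inequality of means is sharp only
    if the three resulting terms agree. The extremal metric has l_v = 4 b, l_sigma = pi and l_h = 2
    pi cos w, where 2 b is the integral of f over [0, beta]; as the caps contribute 2 w to it, the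
    strip has width 2 (b - w) / cos w. Equality of the three terms then reads, with r for [ratio w],
    tan w - r w = r b on the caps and (1 - r) (b - w) = r b on the strip. Eliminating r leaves a
    quadratic equation for b, whose larger root is the b of the statement. Adding the widths of the
    caps and of the strip gives the equation between beta and w. *)

(* Not a class, so that applying lemmas about it does not trigger instance
   resolution, which [is_derive] would. *)
Definition has_deriv (R : realType) (f : R -> R) (x l : R) : Prop :=
  is_derive x (1 : R) f l.

Definition rint (R : realType) (a b : R) (f : R -> R) : R :=
  (\int[@lebesgue_measure R]_(x in `[a, b]) f x)%R.

Lemma eq_ler (R : realType) (x y : R) : x = y -> x <= y.
Proof. by move->. Qed.

Section Integral.
Context {R : realType}.
Implicit Types (a b c d k r x y T : R) (f g h F G : R -> R).
Local Notation mu := (@lebesgue_measure R).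

Lemma rint_integrable a b f : continuous f ->
  mu.-integrable `[a, b] (EFin \o f).
Proof.
move=> cf; apply: continuous_compact_integrable; first exact: segment_compact.
exact: continuous_subspaceT.
Qed.

Lemma eq_rint a b f g : (forall x, a <= x <= b -> f x = g x) ->
  rint a b f = rint a b g.
Proof.
move=> fg; apply: eq_Rintegral => x; rewrite inE/= in_itv/=; exact: fg.
Qed.

Lemma le_rint a b f g : continuous f -> continuous g ->
  (forall x, a <= x <= b -> f x <= g x) -> rint a b f <= rint a b g.
Proof.
move=> cf cg fg; apply: le_Rintegral; [by []|exact: rint_integrable..|].
by move=> x /=; rewrite in_itv/=; exact: fg.
Qed.

Lemma has_deriv_continuous F x l : has_deriv F x l -> {for x, continuous F}.
Proof. by case=> dF _; apply/differentiable_continuous/derivable1_diffP. Qed.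

Lemma rint_ftc a b F f : a <= b -> continuous f ->
  (forall x, has_deriv F x (f x)) -> rint a b f = F b - F a.
Proof.
move=> ab cf dF; have cF : continuous F.
  by move=> x; exact: has_deriv_continuous (dF x).
move: ab; rewrite le_eqVlt => /predU1P[->|ab].
  by rewrite /rint set_itv1 Rintegral_set1 subrr.
rewrite /rint /Rintegral (@continuous_FTC2 _ f F)//.
- exact: continuous_subspaceT.
- split => [x _||].
  + by have [] := dF x.
  + exact/cvg_at_right_filter/cF.
  + exact/cvg_at_left_filter/cF.
- by move=> x _; rewrite derive1E; have [_ ->] := dF x.
Qed.

(** Primitives on the whole line reduce most rules below to identities between differences
    [F b - F a]. *)
Lemma rint_prim f : continuous f -> exists F, forall x, has_deriv F x (f x).
Proof.
move=> cf.
pose J a x := rint a x f.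
have Jcat a b x : a <= b -> b <= x -> J a x = J a b + rint b x f.
  move=> ab bx.
  have := @Rintegral_itvB R f (BLeft a) (BRight x) b.
  rewrite !bnd_simp ab bx => /(_ (rint_integrable _ _ cf) isT isT).
  rewrite [in X in _ = X]Rintegral_itv_obnd_cbnd; last first.
    apply: integrableS (rint_integrable b x cf) => //.
    by apply: subset_itvr; rewrite bnd_simp.
  by rewrite /J /rint => <-; rewrite addrC subrK.
(* The base point moves with [x] so as to lie to the left of both [x] and 0; subtracting the value
   at 0 cancels its choice. Near each point, [F] therefore coincides with a primitive based at a
   fixed [- N]. *)
pose F x := J (- (`|x| + 1)) x - J (- (`|x| + 1)) 0.
exists F => x.
pose N := `|x| + 2.
have FE y : `|y| < N -> F y = J (- N) y - J (- N) 0.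
  move=> yN; have [y1 [y2 y3]] : - (`|y| + 1) <= y /\ - (`|y| + 1) <= 0 /\ 0 <= `|y|.
    by have := ler_norm (- y); have := normr_ge0 y; rewrite normrN; lra.
  rewrite /F.
  have [H|H] := leP (`|y| + 1) N.
    rewrite (@Jcat (- N) (- (`|y| + 1)) y) ?lerN2// (@Jcat (- N) (- (`|y| + 1)) 0) ?lerN2//.
    by rewrite /J; ring.
  have yN' : - N <= y by have := ler_norm (- y); rewrite normrN; lra.
  have N0 : - N <= 0 by rewrite oppr_le0 addr_ge0.
  rewrite (@Jcat (- (`|y| + 1)) (- N) y) ?(@Jcat (- (`|y| + 1)) (- N) 0)//; last 2 first.
  - by rewrite lerN2 ltW.
  - by rewrite lerN2 ltW.
  by rewrite /J; ring.
have xN : `|x| < N by rewrite /N; lra.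
have dG : is_derive x 1 (fun y => J (- N) y - J (- N) 0) (f x).
  have [] := @continuous_FTC1_closed R f (- N) x N.
  - by have := ler_norm x; rewrite /N; lra.
  - exact: rint_integrable.
  - by have := ler_norm (- x); rewrite normrN /N; lra.
  - exact: cf.
  move=> dJ eJ; rewrite -[f x]subr0 -eJ derive1E.
  apply: is_deriveB; exact: derivableP.
apply: (@near_eq_is_derive _ _ _ (fun y => J (- N) y - J (- N) 0) F) => //.
near=> y; apply/esym/FE; near: y.
apply: (@cvgr_norm_lt _ _ _ _ _ _ x) => //. 
Unshelve. all: by end_near. Qed.

Lemma rint_cat a b c f : continuous f -> a <= b -> b <= c ->
  rint a c f = rint a b f + rint b c f.
Proof.
move=> cf ab bc; have [F dF] := rint_prim cf.
rewrite !(rint_ftc _ cf dF)//; first by ring.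
exact: le_trans bc.
Qed.

Lemma rintD a b f g : continuous f -> continuous g ->
  rint a b (fun x => f x + g x) = rint a b f + rint a b g.
Proof. by move=> cf cg; apply: RintegralD => //; exact: rint_integrable. Qed.

Lemma rintB a b f g : continuous f -> continuous g ->
  rint a b (fun x => f x - g x) = rint a b f - rint a b g.
Proof. by move=> cf cg; apply: RintegralB => //; exact: rint_integrable. Qed.

Lemma rintZ a b r f : continuous f ->
  rint a b (fun x => r * f x) = r * rint a b f.
Proof. by move=> cf; apply: RintegralZl => //; exact: rint_integrable. Qed.

Lemma rint_cst a b r : a <= b -> rint a b (fun=> r) = (b - a) * r.
Proof.
move=> ab; have d x : is_derive x 1 (fun x => x * r) r.
  by apply: is_derive_eq; rewrite /= scaler0 add0r /GRing.scale/= mulr1.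
by rewrite (rint_ftc ab _ d) ?mulrBl//; exact: cst_continuous.
Qed.

Lemma rint_subst a b g h h' : a <= b -> h a <= h b ->
  continuous g -> continuous h' -> (forall x, has_deriv h x (h' x)) ->
  rint a b (fun x => g (h x) * h' x) = rint (h a) (h b) g.
Proof.
move=> ab hab cg ch' dh; have [G dG] := rint_prim cg.
have ch : continuous h by move=> x; exact: has_deriv_continuous (dh x).
rewrite (rint_ftc hab cg dG).
have d x : is_derive x 1 (G \o h) (g (h x) * h' x).
  exact: (@is_derive1_comp R G h x _ _ (dG _) (dh x)).
rewrite (rint_ftc ab _ d)//.
move=> x; apply: continuousM; last exact: ch'.
by apply: continuous_comp; [exact: ch|exact: cg].
Qed.

Lemma rint_shift a b k f : continuous f ->
  rint a b (fun x => f (x + k)) = rint (a + k) (b + k) f.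
Proof.
move=> cf; have [ab|ba] := leP a b; last first.
  by rewrite /rint !set_itv_ge ?Rintegral_set0// bnd_simp -ltNge ?ltrD2r.
have d x : is_derive x 1 (fun x => x + k) 1.
  by apply: is_derive_eq; rewrite addr0.
have kab : a + k <= b + k by rewrite lerD2r.
rewrite -(rint_subst ab kab cf _ d); last exact: cst_continuous.
by apply: eq_rint => x _; rewrite mulr1.
Qed.

Lemma rint_opp a b f : continuous f ->
  rint a b (fun x => f (- x)) = rint (- b) (- a) f.
Proof.
move=> cf; have [ab|ba] := leP a b; last first.
  by rewrite /rint !set_itv_ge ?Rintegral_set0// bnd_simp -ltNge ?ltrN2.
have [F dF] := rint_prim cf.
have d x : is_derive x 1 (fun x => - F (- x)) (f (- x)).
  have := @is_derive1_comp R F -%R x (f (- x)) (-1) (dF _) (is_deriveNid _ _).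
  by rewrite mulrN1 => /is_deriveN; rewrite opprK.
rewrite (rint_ftc _ cf dF) ?lerN2// (rint_ftc ab _ d).
  by ring.
by move=> x; apply: continuous_comp; [exact: opp_continuous|exact: cf].
Qed.

Lemma rint_scale a b k f : 0 < k -> a <= b -> continuous f ->
  rint a b (fun x => f (k * x)) * k = rint (k * a) (k * b) f.
Proof.
move=> k0 ab cf; have ck : continuous (fun x : R => k * x) by exact: mulrl_continuous.
rewrite mulrC -rintZ; last first.
  by move=> x; apply: continuous_comp; [exact: ck|exact: cf].
have d x : is_derive x 1 (fun x => k * x) k.
  rewrite -[X in is_derive _ _ _ X](mulr1 k); exact: is_deriveZ.
have kab : k * a <= k * b by rewrite ler_pM2l.
rewrite -(rint_subst ab kab cf _ d); last exact: cst_continuous.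
by apply: eq_rint => x _; rewrite mulrC.
Qed.

(** The increment of a primitive over one period, as a function of the starting point, has
    derivative zero. *)
Lemma rint_periodic T a f : continuous f -> 0 <= T ->
  (forall x, f (x + T) = f x) -> rint a (a + T) f = rint 0 T f.
Proof.
move=> cf T0 fT; have [F dF] := rint_prim cf.
have le_T x : x <= x + T by rewrite lerDl.
pose D x := F (x + T) - F x.
have dT x : is_derive x 1 (fun x => x + T) 1.
  by apply: is_derive_eq; rewrite addr0.
have dD x : is_derive x 1 D 0.
  rewrite -(subrr (f x)) -[X in X - _]mulr1 -{1}fT; apply: is_deriveB.
    exact: (@is_derive1_comp R F (fun x => x + T) x _ _ (dF _) (dT x)).
  exact: dF.
rewrite -[T in RHS]add0r !(rint_ftc _ cf dF)//.
by have := is_derive_0_is_cst a 0 dD; rewrite /D add0r.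
Qed.

End Integral.

Section Derivation.
Context {R : realType}.
Implicit Types (f g : R -> R) (x df dg k l : R).

Lemma der_eq f x l df : has_deriv f x df -> df = l -> has_deriv f x l.
Proof. by move=> d <-. Qed.

Lemma der_const (k x : R) : has_deriv (fun _ : R => k) x 0.
Proof. exact: is_derive_cst. Qed.

Lemma der_id x : has_deriv (fun x : R => x) x 1.
Proof. exact: is_derive_id. Qed.

Lemma der_oppid x : has_deriv -%R x (-1).
Proof. exact: is_deriveNid. Qed.

Lemma der_add f g x df dg : has_deriv f x df -> has_deriv g x dg ->
  has_deriv (fun x => f x + g x) x (df + dg).
Proof. exact: is_deriveD. Qed.

Lemma der_opp f x df : has_deriv f x df -> has_deriv (fun x => - f x) x (- df).
Proof. exact: is_deriveN. Qed.

Lemma der_mul f g x df dg : has_deriv f x df -> has_deriv g x dg ->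
  has_deriv (fun x => f x * g x) x (f x * dg + g x * df).
Proof. exact: is_deriveM. Qed.

Lemma der_addl k x : has_deriv (+%R k) x 1.
Proof.
by apply: der_eq; [apply: der_add; [exact: der_const|exact: der_id]|exact: add0r].
Qed.

Lemma der_mull k x : has_deriv ( *%R k) x k.
Proof.
apply: der_eq; first by apply: der_mul; [exact: der_const|exact: der_id].
by rewrite /= mulr1 mulr0 addr0.
Qed.

Lemma der_comp g f x dg df : has_deriv g (f x) dg -> has_deriv f x df ->
  has_deriv (fun x => g (f x)) x (dg * df).
Proof. exact: is_derive1_comp. Qed.

Lemma der_pow f n x df : has_deriv f x df ->
  has_deriv (fun x => f x ^+ n) x (n%:R * f x ^+ n.-1 * df).
Proof.
move=> d; elim: n => [|n IH].
  by rewrite !mul0r; under eq_fun do rewrite expr0; exact: der_const.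
under eq_fun do rewrite exprS.
apply: der_eq; first exact: der_mul d IH.
case: n {IH} => [|n] /=; first by rewrite expr0; ring.
by rewrite -[n.+2%:R]natr1 exprS; ring.
Qed.

Lemma der_inv f x df : f x != 0 -> has_deriv f x df ->
  has_deriv (fun x => (f x)^-1) x (- df / f x ^+ 2).
Proof.
move=> f0 d; apply: der_eq; first exact: (@is_deriveV R f x df 1 f0 d).
by rewrite /GRing.scale/= mulrC mulrN mulNr.
Qed.

Lemma der_sin f x df : has_deriv f x df ->
  has_deriv (fun x => sin (f x)) x (cos (f x) * df).
Proof. by move=> d; apply: der_comp d; exact: is_derive_sin. Qed.

Lemma der_cos f x df : has_deriv f x df ->
  has_deriv (fun x => cos (f x)) x (- sin (f x) * df).
Proof. by move=> d; apply: der_comp d; exact: is_derive_cos. Qed.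

Lemma der_expR f x df : has_deriv f x df ->
  has_deriv (fun x => expR (f x)) x (expR (f x) * df).
Proof. by move=> d; apply: der_comp d; exact: is_derive_expR. Qed.

Lemma der_atan f x df : has_deriv f x df ->
  has_deriv (fun x => atan (f x)) x ((1 + f x ^+ 2)^-1 * df).
Proof. by move=> d; apply: der_comp d; exact: is_derive1_atan. Qed.

Lemma der_ln f x df : 0 < f x -> has_deriv f x df ->
  has_deriv (fun x => ln (f x)) x ((f x)^-1 * df).
Proof. by move=> f0 d; apply: der_comp d; exact: is_derive1_ln. Qed.

Lemma der_asin f x df : -1 < f x < 1 -> has_deriv f x df ->
  has_deriv (fun x => asin (f x)) x ((Num.sqrt (1 - f x ^+ 2))^-1 * df).
Proof. by move=> f0 d; apply: der_comp d; exact: is_derive1_asin. Qed.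

End Derivation.

Ltac deriv := lazymatch goal with
| |- has_deriv (fun _ => ?c) _ _ => apply: der_const
| |- has_deriv (fun x => x) _ _ => apply: der_id
| |- has_deriv (fun x => _ + _) _ _ => apply: der_add; deriv
| |- has_deriv (fun x => - _) _ _ => apply: der_opp; deriv
| |- has_deriv (fun x => _ * _) _ _ => apply: der_mul; deriv
| |- has_deriv (fun x => _ ^+ _) _ _ => apply: der_pow; deriv
| |- has_deriv (fun x => _ ^-1) _ _ => apply: der_inv; [|deriv]
| |- has_deriv (fun x => sin _) _ _ => apply: der_sin; deriv
| |- has_deriv (fun x => cos _) _ _ => apply: der_cos; deriv
| |- has_deriv (fun x => expR _) _ _ => apply: der_expR; deriv
| |- has_deriv (fun x => atan _) _ _ => apply: der_atan; deriv
| |- has_deriv (fun x => ln _) _ _ => apply: der_ln; [|deriv]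
| |- has_deriv (fun x => asin _) _ _ => apply: der_asin; [|deriv]
| |- has_deriv -%R _ _ => apply: der_oppid
| |- has_deriv (+%R _) _ _ => apply: der_addl
| |- has_deriv ( *%R _) _ _ => apply: der_mull
| |- has_deriv sin _ _ => exact: is_derive_sin
| |- has_deriv cos _ _ => exact: is_derive_cos
| |- has_deriv expR _ _ => exact: is_derive_expR
| |- has_deriv atan _ _ => exact: is_derive1_atan
| d : forall x, has_deriv ?F x _ |- has_deriv ?F _ _ => apply: d
| d : forall x, has_deriv ?F x _ |- has_deriv (fun x => ?F _) _ _ =>
    apply: der_comp; [apply: d|deriv]
| _ => idtac
end.

Section Continuity.
Context {R : realType} {T : topologicalType}.
Implicit Types f g : T -> R.

Lemma continuous_mul f g : continuous f -> continuous g ->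
  continuous (fun x => f x * g x).
Proof. by move=> cf cg x; apply: continuousM; [exact: cf|exact: cg]. Qed.

Lemma continuous_add f g : continuous f -> continuous g ->
  continuous (fun x => f x + g x).
Proof. by move=> cf cg x; apply: continuousD; [exact: cf|exact: cg]. Qed.

Lemma continuous_sub f g : continuous f -> continuous g ->
  continuous (fun x => f x - g x).
Proof. by move=> cf cg x; apply: continuousB; [exact: cf|exact: cg]. Qed.

Lemma continuous_const (k : R) : continuous (fun _ : T => k).
Proof. by move=> x; exact: cst_continuous. Qed.

Lemma continuous_compose (U V : topologicalType) (g : U -> V) (f : T -> U) :
  continuous g -> continuous f -> continuous (fun x => g (f x)).
Proof. by move=> cg cf x; apply: continuous_comp; [exact: cf|exact: cg]. Qed.

Lemma continuous_pow f n : continuous f -> continuous (fun x => f x ^+ n).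
Proof. by move=> cf; apply: (continuous_compose (g := fun x : R => x ^+ n)) => // x; exact: exprn_continuous. Qed.

Lemma continuous_inv f : (forall x, f x != 0) -> continuous f ->
  continuous (fun x => (f x)^-1).
Proof. by move=> f0 cf x; apply: continuousV; [exact: f0|exact: cf]. Qed.

End Continuity.

(** * Continuous functions of two variables and Fubini's theorem *)

Section ProductIntegral.
Context {R : realType}.
Local Notation mu := (@lebesgue_measure R).

(** Measurability refers to the product sigma-algebra, which is generated by boxes; an open set is a
    countable union of boxes with rational corners. *)
Lemma open_measurable2 (U : set (R * R)) : open U ->
  measurable (U : set (measurableTypeR R * measurableTypeR R)).
Proof.
move=> oU.
pose box (p : (rat * rat) * (rat * rat)) : set (R * R) :=
  `](ratr p.1.1 : R), ratr p.1.2[ `*` `](ratr p.2.1 : R), ratr p.2.2[.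
have -> : U = \bigcup_p (if `[< box p `<=` U >] then box p else set0).
  apply/seteqP; split => [[x y] Uxy|z [p _]]; last first.
    by case: asboolP => // pU pz; exact: pU.
  have /= := oU _ Uxy.
  rewrite -nbhs_ballE => -[e /= e0 eU].
  have [a] := @rat_in_itvoo R (x - e) x ltac:(rewrite ltrBlDr ltrDl//).
  rewrite in_itv/= => /andP[a1 a2].
  have [b] := @rat_in_itvoo R x (x + e) ltac:(rewrite ltrDl//).
  rewrite in_itv/= => /andP[b1 b2].
  have [c] := @rat_in_itvoo R (y - e) y ltac:(rewrite ltrBlDr ltrDl//).
  rewrite in_itv/= => /andP[c1 c2].
  have [d] := @rat_in_itvoo R y (y + e) ltac:(rewrite ltrDl//).
  rewrite in_itv/= => /andP[d1 d2].
  exists ((a, b), (c, d)) => //.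
  case: asboolP => [_|[]]; first by rewrite /box /= !in_itv/= a2 b1 c2 d1.
  move=> [x' y'] /=; rewrite /box/= !in_itv/= => -[/andP[? ?] /andP[? ?]].
  apply: eU; split; rewrite -ball_normE /ball_/= ltr_norml; lra.
apply: countable_bigcupT_measurable; first exact: countableP.
by move=> p; case: asboolP => // _; apply: measurableX.
Qed.

Lemma measurable_fun_continuous2 (F : R * R -> R) : continuous F ->
  measurable_fun [set: measurableTypeR R * measurableTypeR R] F.
Proof.
move=> /continuousP cF.
apply: (measurability _ (measurable_realfun.RGenOpens.measurableE R)).
move=> _ [_ [a [b ->] <-]]; rewrite setTI; apply: open_measurable2.
exact/cF/interval_open.
Qed.

Lemma continuous_pair (T U V : topologicalType) (f : T -> U) (g : T -> V) :
  continuous f -> continuous g -> continuous (fun x => (f x, g x)).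
Proof. by move=> cf cg x; exact: (cvg_pair (cf x) (cg x)). Qed.

Lemma continuous_comp2 (T U V W : topologicalType) (F : U * V -> W)
    (f : T -> U) (g : T -> V) : continuous F ->
  continuous f -> continuous g -> continuous (fun x => F (f x, g x)).
Proof.
move=> cF cf cg x.
apply: (@continuous_comp _ _ _ (fun x => (f x, g x)) F).
  exact: continuous_pair.
exact: cF.
Qed.

Lemma continuous_fst (F : R * R -> R) y : continuous F ->
  continuous (fun x => F (x, y)).
Proof.
by move=> cF; apply: continuous_comp2 => // x; [exact: cvg_id|exact: cvg_cst].
Qed.

Lemma continuous_snd (F : R * R -> R) x : continuous F ->
  continuous (fun y => F (x, y)).
Proof.
by move=> cF; apply: continuous_comp2 => // y; [exact: cvg_cst|exact: cvg_id].
Qed.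

Lemma continuous_swap (F : R * R -> R) : continuous F ->
  continuous (fun p => F (p.2, p.1)).
Proof.
by move=> cF; apply: continuous_comp2 => // p; [exact: cvg_snd|exact: cvg_fst].
Qed.

(** By compactness of [a, b], the values at height y' are close to those at height y for all
    abscissae at once. *)
Lemma rint_continuous (a b : R) (F : R * R -> R) : continuous F ->
  continuous (fun y => rint a b (fun x => F (x, y))).
Proof.
move=> cF y; apply/cvgrPdist_le => e e0.
pose e' := e / (`|b - a| + 1).
have e'0 : 0 < e' by rewrite divr_gt0// ltr_pwDr.
have e2 : 0 < e' / 2 by rewrite divr_gt0.
have : \forall y' \near y, `[a, b] `<=` [set x | `|F (x, y) - F (x, y')| < e'].
  have /compact_near_coveringP/(_ _ (nbhs y)) := @segment_compact R a b.
  move=> /(_ (fun y' x => `|F (x, y) - F (x, y')| < e') _); apply => x _; near=> p => /=; rewrite -(subrK (F (x, y)) (F (p.1, y))) -addrA.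
  rewrite (le_lt_trans (ler_normD _ _))// [e']splitr ltrD//.
    rewrite distrC; near: p.
    have cF1 : continuous (fun p : R * R => F (p.1, y)).
      apply: continuous_comp2 => // q; [exact: cvg_fst|exact: cvg_cst].
    have /cvgrPdist_lt := cF1 (x, y); apply; exact: divr_gt0.
  near: p.
  have /cvgrPdist_lt/(_ (e' / 2)) := cF (x, y).
  by move=> /(_ e2)/=; apply: filterS => -[].
apply: filterS => y' H.
have cF1 z : continuous (fun x => F (x, z)) by exact: continuous_fst.
have [ab|ba] := leP a b; last first.
  rewrite /rint !set_itv_ge ?Rintegral_set0 ?subrr ?normr0 ?ltW//; by rewrite bnd_simp -ltNge.
rewrite -rintB//.
have cB : continuous (fun x => F (x, y) - F (x, y')) by move=> x; apply: continuousB; exact: cF1.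
have key : `|rint a b (fun x => F (x, y) - F (x, y'))| <= (b - a) * e'.
  rewrite ler_norml; apply/andP; split.
    rewrite -mulrN -rint_cst//; apply: le_rint => //; first exact: cst_continuous.
    move=> x abx; have := H x; rewrite /= in_itv/= abx => /(_ isT).
    by rewrite ltr_norml => /andP[/ltW].
  rewrite -rint_cst//; apply: le_rint => //; first exact: cst_continuous.
  move=> x abx; have := H x; rewrite /= in_itv/= abx => /(_ isT).
  by rewrite ltr_norml => /andP[_ /ltW].
apply: (le_trans key); rewrite /e' mulrCA ger_pMr// ler_pdivrMr ?mul1r ?ltr_pwDr//.
by rewrite (le_trans (ler_norm _))// lerDl.
Unshelve. all: by end_near. Qed.

Lemma rint_fin_num (a b : R) (f : R -> R) : continuous f ->
  (\int[mu]_(x in `[a, b]) (f x)%:E)%E \is a fin_num.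
Proof. by move=> cf; apply: integrable_fin_num => //; exact: rint_integrable. Qed.

Lemma rect_integrable (a b c d : R) (F : R * R -> R) : continuous F ->
  (mu \x mu)%E.-integrable (`[a, b] `*` `[c, d]) (EFin \o F).
Proof.
move=> cF; apply: measurable_bounded_integrable.
- exact: measurableX.
- rewrite [ltLHS]product_measure1E//= !lebesgue_measure_itv/=.
  by do 2! case: ifP => _; rewrite ?mule0 ?mul0e// -?EFinM ltry.
- exact: measurable_funS (measurable_fun_continuous2 cF).
- have /compact_bounded[M [_ Mr]] := continuous_compact (continuous_subspaceT cF)
    (compact_setX (@segment_compact R a b) (@segment_compact R c d)).
  exists M; split; rewrite ?num_real// => x Mx p abp; exact: Mr.
Qed.

Lemma rint_prod_xy (a b c d : R) (F : R * R -> R) : continuous F ->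
  rint a b (fun x => rint c d (fun y => F (x, y))) =
  (\int[(mu \x mu)%E]_(z in `[a, b] `*` `[c, d]) F z)%R.
Proof.
move=> cF; pose D : set (R * R) := `[a, b] `*` `[c, d].
have iF := rect_integrable a b c d cF.
have mD : measurable (D : set (measurableTypeR R * measurableTypeR R)).
  exact: measurableX.
have iFD : (mu \x mu)%E.-integrable setT ((EFin \o F) \_ D).
  exact/(integrable_mkcond _ mD).
rewrite [RHS]/Rintegral integral_mkcond -(integral12_prod_meas1 iFD).
rewrite /rint [LHS]/Rintegral integral_mkcond; congr fine; apply: eq_integral => x _.
rewrite patchE /fubini_F; case: ifPn => [|/negP] xab; last first.
  rewrite integral0_eq// => y _; rewrite patchE; case: ifPn => //.
  by rewrite inE => -[/= ? ?]; exfalso; apply: xab; rewrite inE.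
have fin := rint_fin_num c d (continuous_snd (x := x) cF).
rewrite /= /Rintegral fineK// [LHS]integral_mkcond; apply: eq_integral => y _.
rewrite !patchE; case: ifPn => [|/negP] ycd.
  by rewrite ifT//; rewrite !inE in xab ycd *.
by rewrite ifF//; apply/negP => H; apply: ycd; rewrite !inE in H *; case: H.
Qed.

Lemma rint_prod_yx (a b c d : R) (F : R * R -> R) : continuous F ->
  rint c d (fun y => rint a b (fun x => F (x, y))) =
  (\int[(mu \x mu)%E]_(z in `[a, b] `*` `[c, d]) F z)%R.
Proof.
move=> cF; pose D : set (R * R) := `[a, b] `*` `[c, d].
have iF := rect_integrable a b c d cF.
have mD : measurable (D : set (measurableTypeR R * measurableTypeR R)).
  exact: measurableX.
have iFD : (mu \x mu)%E.-integrable setT ((EFin \o F) \_ D).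
  exact/(integrable_mkcond _ mD).
rewrite [RHS]/Rintegral integral_mkcond -(integral21_prod_meas1 iFD).
rewrite /rint [LHS]/Rintegral integral_mkcond; congr fine; apply: eq_integral => y _.
rewrite patchE /fubini_G; case: ifPn => [|/negP] ycd; last first.
  rewrite integral0_eq// => x _; rewrite patchE; case: ifPn => //.
  by rewrite inE => -[/= ? ?]; exfalso; apply: ycd; rewrite inE.
have fin := rint_fin_num a b (continuous_fst (y := y) cF).
rewrite /= /Rintegral fineK// [LHS]integral_mkcond; apply: eq_integral => x _.
rewrite !patchE; case: ifPn => [|/negP] xab.
  by rewrite ifT//; rewrite !inE in xab ycd *.
by rewrite ifF//; apply/negP => H; apply: xab; rewrite !inE in H *; case: H.
Qed.

Lemma rint_fubini (a b c d : R) (F : R * R -> R) : continuous F ->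
  rint a b (fun x => rint c d (fun y => F (x, y))) =
  rint c d (fun y => rint a b (fun x => F (x, y))).
Proof. by move=> cF; rewrite rint_prod_xy// rint_prod_yx. Qed.

End ProductIntegral.

(** * The hat-box inequality *)

Section Approximation.
Context {R : realType}.

(** Heine's theorem: the covering form of compactness yields one radius [d] valid at all points of
    [K]. *)
Lemma compact_uniform_continuous (T : pseudoMetricType R) (K : set T)
    (f : T -> R) (e : R) : compact K -> {within K, continuous f} -> 0 < e ->
  exists2 d : R, 0 < d &
    forall x y, K x -> K y -> ball x d y -> `|f x - f y| < e.
Proof.
move=> cK cf e0.
have [d [d0 Hd]] : exists d : R, 0 < d /\
    K `<=` [set x | forall y, K y -> ball x d y -> `|f x - f y| < e].
  have /compact_near_coveringP/near_covering_withinP := cK.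
  move=> /(_ _ (0 : R)^'+ (fun d x => forall y, K y -> ball x d y -> `|f x - f y| < e) _).
  move=> H; have {}H : \forall d \near (0 : R)^'+, K `<=` [set x | forall y, K y -> ball x d y -> `|f x - f y| < e].
    apply: H => x Kx.
    have /cvgrPdist_lt /(_ (e / 2) (divr_gt0 e0 (ltr0n _ 2))) := (subspace_continuousP _ _).1 cf x Kx.
    rewrite /within/= => /nbhs_ballP[r /= r0 xr].
    have r20 : 0 < r / 2 by exact: divr_gt0.
    near=> x' d => Kx' y Ky x'y.
    have dr : d <= r / 2 by near: d; exact: nbhs_right_le.
    have xx' : ball x (r / 2) x' by near: x'; exact: nbhsx_ballx.
    have xy : ball x r y.
      apply: (@ball_splitr _ _ x'); first exact: ball_sym.
      exact: le_ball x'y.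
    have xx'r : ball x r x'.
      by apply: le_ball xx'; rewrite ler_pdivrMr// ler_pMr// ler1n.
    rewrite -(subrK (f x) (f x')) -addrA (le_lt_trans (ler_normD _ _))//.
    rewrite [e]splitr ltrD//; first by rewrite distrC; exact: xr.
    exact: xr.
  by have [d [d0 Hd]] := filter_ex (filterI (nbhs_right_gt 0) H); exists d.
by exists d => // x y Kx; exact: Hd.
Unshelve. all: by end_near. Qed.

(* [bernstein n f] is the Bernstein polynomial of degree [n] with node values
   [f 0], ..., [f n]; the recursion conditions on the first of the [n] coin
   tosses of its probabilistic interpretation. *)
Fixpoint bernstein (n : nat) (f : nat -> R) : {poly R} :=
  if n is n'.+1 then
    (1 - 'X) * bernstein n' f + 'X * bernstein n' (fun k => f k.+1)
  else (f 0%N)%:P.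

Lemma bernsteinS n f x : (bernstein n.+1 f).[x] =
  (1 - x) * (bernstein n f).[x] + x * (bernstein n (fun k => f k.+1)).[x].
Proof. by rewrite /= !hornerE. Qed.

Lemma bernstein_le n f g x : 0 <= x <= 1 ->
  (forall k, (k <= n)%N -> f k <= g k) ->
  (bernstein n f).[x] <= (bernstein n g).[x].
Proof.
move=> /andP[x0 x1]; elim: n f g => [|n IH] f g fg; first by rewrite /= !hornerE fg.
rewrite !bernsteinS lerD// ler_wpM2l ?subr_ge0//; apply: IH => k kn; apply: fg => //.
exact: leqW.
Qed.

Lemma bernstein_affine n a b f x :
  (bernstein n (fun k => a + b * f k)).[x] = a + b * (bernstein n f).[x].
Proof.
elim: n f => [|n IH] f; first by rewrite /= !hornerE.
by rewrite !bernsteinS !IH; ring.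
Qed.

(** The mean square deviation from [c] of a binomial variable with parameters [n] and [x]: the
    squared deviation of its mean plus its variance. *)
Lemma bernstein_variance n c x :
  (bernstein n (fun k => (k%:R - c) ^+ 2)).[x] =
  (n%:R * x - c) ^+ 2 + n%:R * (x * (1 - x)).
Proof.
elim: n c => [|n IH] c; first by rewrite /= !hornerE; ring.
rewrite bernsteinS IH.
have -> : (fun k => (k.+1%:R - c) ^+ 2) = (fun k => (k%:R - (c - 1)) ^+ 2) :> (nat -> R).
  by apply/funext => k; rewrite -natr1; ring.
by rewrite IH -natr1; ring.
Qed.

(** Bernstein's proof of the Weierstrass theorem, by Chebyshev's argument. *)
Lemma weierstrass (f : R -> R) (e : R) : continuous f -> 0 < e ->
  exists p : {poly R}, forall x, 0 <= x <= 1 -> `|p.[x] - f x| <= e.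
Proof.
move=> cf e0; have e20 : 0 < e / 2 by exact: divr_gt0.
have cK := @segment_compact R 0 1.
have cfK : {within `[0, 1], continuous f} by exact: continuous_subspaceT.
have [d d0 fd] := compact_uniform_continuous cK cfK e20.
have [M [_ fM]] := compact_bounded (continuous_compact cfK cK).
pose B := `|M| + 1.
have fB x : 0 <= x <= 1 -> `|f x| <= B.
  move=> x01; apply: (fM B); first by rewrite (le_lt_trans (ler_norm _))// ltrDl.
  by exists x => //=; rewrite in_itv.
have B0 : 0 < B by rewrite ltr_wpDl.
pose n := (Num.truncn (2 * B / d ^+ 2 / (e / 2))).+1.
have n0 : 0 < n%:R :> R by rewrite ltr0n.
have d20 : 0 < d ^+ 2 by rewrite exprn_gt0.
have nbig : 2 * B / d ^+ 2 / n%:R <= e / 2.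
  rewrite ler_pdivrMr// [leRHS]mulrC -ler_pdivrMr//.
  by apply: ltW; exact: truncnS_gt.
exists (bernstein n (fun k => f (k%:R / n%:R))) => x x01.
pose C := 2 * B / d ^+ 2 / n%:R ^+ 2.
have C0 : 0 <= C by rewrite !divr_ge0 ?mulr_ge0 ?ltW// exprn_gt0.
(* Nodes within [d] of [x] are handled by uniform continuity. For the others the oscillation is at
   most [2 * B], which a quadratic dominates; averaged, that quadratic becomes a multiple of the
   variance, small for large [n]. *)
have key k : (k <= n)%N ->
    `|f (k%:R / n%:R) - f x| <= e / 2 + C * (k%:R - n%:R * x) ^+ 2.
  move=> kn.
  have k01 : 0 <= (k%:R / n%:R : R) <= 1.
    by rewrite divr_ge0//= ler_pdivrMr// mul1r ler_nat.
  have [lt|ge] := ltP `|k%:R / n%:R - x| d.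
    rewrite -[leLHS]addr0; apply: lerD; last by rewrite mulr_ge0// sqr_ge0.
    by apply/ltW/fd; rewrite /= ?in_itv// -ball_normE /=.
  have -> : C * (k%:R - n%:R * x) ^+ 2 = 2 * B * ((k%:R / n%:R - x) ^+ 2 / d ^+ 2).
    by rewrite /C; field; rewrite ?gt_eqF.
  have : 1 <= (k%:R / n%:R - x) ^+ 2 / d ^+ 2.
    rewrite ler_pdivlMr// mul1r -[leRHS]real_normK ?num_real//.
    by rewrite lerXn2r// nnegrE ltW.
  rewrite -(ler_pM2l (mulr_gt0 (ltr0n _ 2) B0)) mulr1 => h.
  apply: le_trans (ler_normB _ _) _.
  have := fB _ k01; have := fB _ x01; lra.
have var : (bernstein n (fun k => (k%:R - n%:R * x) ^+ 2)).[x] <= n%:R.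
  rewrite bernstein_variance subrr expr0n add0r ler_piMr ?ltW//; nra.
have up : (bernstein n (fun k => f (k%:R / n%:R))).[x] <=
    (f x + e / 2) + C * (bernstein n (fun k => (k%:R - n%:R * x) ^+ 2)).[x].
  rewrite -bernstein_affine; apply: bernstein_le => // k kn.
  by have := key k kn; rewrite ler_norml => /andP[_]; lra.
have lo : (f x - e / 2) + (- C) * (bernstein n (fun k => (k%:R - n%:R * x) ^+ 2)).[x] <=
    (bernstein n (fun k => f (k%:R / n%:R))).[x].
  rewrite -bernstein_affine; apply: bernstein_le => // k kn.
  by have := key k kn; rewrite ler_norml => /andP[+ _]; lra.
have Cn : C * (bernstein n (fun k => (k%:R - n%:R * x) ^+ 2)).[x] <= e / 2.
  apply: le_trans (ler_wpM2l C0 var) _; apply: le_trans nbig.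
  have -> // : C * n%:R = 2 * B / d ^+ 2 / n%:R.
  by rewrite /C; field; rewrite !gt_eqF.
rewrite ler_norml; lra.
Qed.

End Approximation.

(** * Wallis integrals and Archimedes' hat-box theorem *)

Section HatBox.
Context {R : realType}.

Definition wallis (n : nat) : R := rint 0 pi (fun s => sin s ^+ n).

Lemma continuous_sinX n : continuous (fun s : R => sin s ^+ n).
Proof.
move=> s; apply: (@continuous_comp _ _ _ sin (fun x : R => x ^+ n)).
  exact: continuous_sin.
exact: exprn_continuous.
Qed.

Lemma wallis0 : wallis 0 = pi.
Proof.
transitivity (rint 0 pi (fun=> 1 : R)); first by apply: eq_rint => x _; rewrite expr0.
by rewrite rint_cst ?pi_ge0// subr0 mulr1.
Qed.

Lemma wallis1 : wallis 1 = 2.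
Proof.
have d x : has_deriv (fun s : R => - cos s) x (sin x ^+ 1).
  apply: der_eq; first by deriv.
  by rewrite expr1; ring.
rewrite /wallis (rint_ftc (pi_ge0 R) _ d); last exact: continuous_sinX.
by rewrite cospi cos0; ring.
Qed.

(** Integration by parts: [cos s * sin s ^+ n.+1] vanishes at both 0 and pi. *)
Lemma wallisSS n : n.+2%:R * wallis n.+2 = n.+1%:R * wallis n.
Proof.
have d x : has_deriv (fun s : R => - (cos s * sin s ^+ n.+1)) x
    (n.+2%:R * sin x ^+ n.+2 - n.+1%:R * sin x ^+ n).
  apply: der_eq; first by deriv.
  have : cos x * cos x = 1 - sin x ^+ 2 by rewrite -expr2 cos2sin2.
  by move=> cc; rewrite /= !exprS -[n.+2%:R]natr1; ring: cc.
have c k : continuous (fun s : R => k * sin s ^+ n).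
  by apply: continuous_mul; [exact: continuous_const|exact: continuous_sinX].
have c2 k : continuous (fun s : R => k * sin s ^+ n.+2).
  by apply: continuous_mul; [exact: continuous_const|exact: continuous_sinX].
apply/eqP; rewrite -subr_eq0 -!rintZ; try exact: continuous_sinX.
rewrite -rintB// (rint_ftc (pi_ge0 R) _ d); last first.
  by apply: continuous_sub; [exact: c2|exact: c].
by rewrite sinpi sin0 expr0n !mulr0 subrr.
Qed.

(** The recursion makes the left side independent of [n]. Such products of consecutive Wallis
    integrals are all that the hat-box identity for monomials requires. *)
Lemma wallisM n : n.+1%:R * (wallis n * wallis n.+1) = 2 * pi.
Proof.
elim: n => [|n IH]; first by rewrite mul1r wallis0 wallis1 mulrC.
by rewrite mulrCA wallisSS -IH; ring.
Qed.

Lemma continuous_horner (p : {poly R}) : continuous (horner p).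
Proof. by move=> x; apply: (@has_deriv_continuous _ _ _ p^`().[x]); exact: is_derive_poly. Qed.

Lemma continuous_mulr_sin (q : R) : continuous (fun s : R => q * sin s).
Proof.
by move=> s; apply: continuousM; [exact: cst_continuous|exact: continuous_sin].
Qed.

Lemma continuous_hat (g : R -> R) (r : R) : continuous g ->
  continuous (fun a => rint 0 pi (fun s => g (r * sin a * sin s)) * (r * sin a)).
Proof.
move=> cg; apply: continuous_mul; last exact: continuous_mulr_sin.
apply: (@rint_continuous R 0 pi (fun z => g (r * sin z.2 * sin z.1))).
apply: (continuous_compose (g := g)) => //; apply: continuous_mul.
  apply: (continuous_compose (g := fun a => r * sin a)); first exact: continuous_mulr_sin.
  by move=> z; exact: cvg_snd.
apply: (continuous_compose (g := sin)); first exact: continuous_sin.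
by move=> z; exact: cvg_fst.
Qed.

(** Both sides are linear in [p]. For a monomial of degree n, the inner and the outer integral
    produce the Wallis integrals of orders n and n + 1, whose product is known. *)
Lemma hat_box_poly (p : {poly R}) (r : R) : 0 <= r ->
  rint 0 pi (fun a => rint 0 pi (fun s => p.[r * sin a * sin s]) * (r * sin a))
  = 2 * pi * rint 0 r (horner p).
Proof.
move=> r0.
have c1 (q : {poly R}) a : continuous (fun s : R => q.[r * sin a * sin s]).
  move=> s; apply: (@continuous_comp _ _ _ (fun s : R => r * sin a * sin s) (horner q)).
    exact: continuous_mulr_sin.
  exact: continuous_horner.
have c2 (q : {poly R}) := continuous_hat (r := r) (continuous_horner (p := q)).
pose P (q : {poly R}) := rint 0 pi (fun a =>
  rint 0 pi (fun s => q.[r * sin a * sin s]) * (r * sin a))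
  = 2 * pi * rint 0 r (horner q).
have PD q1 q2 : P q1 -> P q2 -> P (q1 + q2).
  rewrite /P => h1 h2.
  rewrite (@eq_rint _ 0 r _ (fun x => q1.[x] + q2.[x])); last by move=> x _; rewrite hornerD.
  rewrite rintD; [|exact: continuous_horner|exact: continuous_horner].
  rewrite mulrDr -h1 -h2 -rintD//; apply: eq_rint => a _; rewrite -mulrDl -rintD//.
  by congr (_ * _); apply: eq_rint => s _; rewrite hornerD.
have PM c n : P (c *: 'X^n).
  rewrite /P.
  have -> : rint 0 r (horner (c *: 'X^n)) = c * (r ^+ n.+1 / n.+1%:R).
    have d x : has_deriv (fun x : R => c * (x ^+ n.+1 / n.+1%:R)) x (c *: 'X^n).[x].
      rewrite hornerZ hornerXn; apply: der_eq; first by deriv.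
      by rewrite /=; field; rewrite gt_eqF//; have := ler0n R n; lra.
    rewrite (rint_ftc r0 _ d); last exact: continuous_horner.
    by rewrite expr0n /= mul0r mulr0 subr0.
  transitivity (rint 0 pi (fun a => (c * r ^+ n.+1 * wallis n) * sin a ^+ n.+1)).
    apply: eq_rint => a _.
    rewrite (@eq_rint _ 0 pi _ (fun s => c * r ^+ n * sin a ^+ n * sin s ^+ n)); last first.
      by move=> s _; rewrite hornerZ hornerXn !exprMn !mulrA.
    rewrite rintZ; last exact: continuous_sinX.
    by rewrite /wallis !exprS; ring.
  rewrite rintZ; last exact: continuous_sinX.
  rewrite -(wallisM n) -/(wallis n.+1).
  by field; rewrite addrC natr1 pnatr_eq0.
rewrite -/(P p) -[p]coefK poly_def.
apply: (big_ind P); [|exact: PD|by move=> i _; exact: PM].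
by rewrite -(scale0r ('X^0)); exact: PM.
Qed.

(* Averaging the hypothesis over [q = r sin a] with weight [r sin a] gives an
   integral over a hemisphere of radius [r] of a function of the coordinate
   [r sin a sin s] only, which Archimedes' hat-box theorem evaluates. *)
Lemma hat_box (g : R -> R) (r K : R) : continuous g -> 0 <= r <= 1 ->
  (forall q, 0 <= q <= r -> K <= rint 0 pi (fun s => g (q * sin s))) ->
  K * r <= pi * rint 0 r g.
Proof.
move=> cg /andP[r0 r1] HK; apply/ler_addgt0Pl => e e0.
have pi0 := pi_gt0 R.
pose e' := e / (2 * pi).
have e'0 : 0 < e' by rewrite divr_gt0// mulr_gt0.
have [p Hp] := weierstrass cg e'0.
have sin01 s : 0 <= s <= pi -> 0 <= sin s <= 1.
  by move=> s0; rewrite sin_ge0_pi//= sin_le1.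
have cgq q : continuous (fun s : R => g (q * sin s)).
  move=> s; apply: (@continuous_comp _ _ _ (fun s : R => q * sin s) g).
    exact: continuous_mulr_sin.
  exact: cg.
have cpq q : continuous (fun s : R => p.[q * sin s]).
  move=> s; apply: (@continuous_comp _ _ _ (fun s : R => q * sin s) (horner p)).
    exact: continuous_mulr_sin.
  exact: continuous_horner.
have cpqe q : continuous (fun s : R => p.[q * sin s] + e').
  by apply: continuous_add; [exact: cpq|exact: continuous_const].
have step q : 0 <= q <= r -> K - e' * pi <= rint 0 pi (fun s => p.[q * sin s]).
  move=> /andP[q0 qr]; rewrite lerBlDr (le_trans (HK q _)) ?q0//.
  have -> : e' * pi = rint 0 pi (fun=> e') by rewrite rint_cst ?pi_ge0// subr0 mulrC.
  rewrite -rintD//; last exact: cst_continuous.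
  apply: le_rint => // s /sin01/andP[s0 s1].
  have : 0 <= q * sin s <= 1 by nra.
  by move=> /Hp; rewrite ler_norml; lra.
(* The weight [r * sin a] has total mass [2 * r] over [0, pi]; this 2 cancels against the one on the
   right. *)
have : rint 0 pi (fun a => (K - e' * pi) * r * sin a ^+ 1) <= 2 * pi * rint 0 r (horner p).
  rewrite -hat_box_poly//; apply: le_rint.
  - by apply: continuous_mul; [exact: continuous_const|exact: continuous_sinX].
  - exact: continuous_hat (continuous_horner (p := p)).
  move=> a /sin01/andP[s0 s1]; rewrite expr1 -mulrA ler_wpM2r ?mulr_ge0//.
  by apply: step; nra.
rewrite rintZ; last exact: continuous_sinX.
rewrite -/(wallis 1) wallis1.
have : rint 0 r (horner p) <= rint 0 r g + r * e'.
  rewrite -[r in r * e']subr0 -rint_cst// -rintD//; last exact: cst_continuous.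
  apply: le_rint; [exact: continuous_horner| |].
    by apply: continuous_add; [exact: cg|exact: continuous_const].
  move=> x /andP[x0 xr]; have /Hp : 0 <= x <= 1 by rewrite x0 (le_trans xr).
  by rewrite ler_norml; lra.
have ee : e' * pi = e / 2 by rewrite /e' invfM mulrA divfK// gt_eqF.
move=> h1 h2.
have h3 : pi * rint 0 r (horner p) <= pi * (rint 0 r g + r * e') by rewrite ler_pM2l.
have h4 : pi * (r * e') = r * (e / 2) by rewrite -ee; ring.
have h5 : e * r <= e by rewrite ger_pMr.
rewrite ee in h2; lra.
Qed.

End HatBox.

(** * Deck transformations and curves of the Klein bottle *)

Section KleinBottle.
Context {R : realType}.
Implicit Types (beta x y u s : R) (z w p : R * R).

Lemma klein_proj_continuous beta : continuous (@klein_proj R beta).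
Proof. exact: pi_continuous. Qed.

Lemma klein_projP beta z w :
  klein_proj beta z = klein_proj beta w <-> klein_orbit beta z w.
Proof.
split=> [|zw].
  by move=> /(@eqmodP _ (orbit_equiv beta)); rewrite /= => /asboolP.
by apply/(@eqmodP _ (orbit_equiv beta)); apply/asboolP.
Qed.

(** The normal form t^n sigma^k of the elements of the group, t being [vtrans beta]. For k = 1 it is
    the glide reflection with axis y = n beta. *)
Definition deck beta (k n : int) z : R * R :=
  (z.1 + k%:~R * pi, (-1) ^ k * z.2 + n%:~R * (2 * beta)).

Lemma sign_sqr (k : int) : ((-1) ^ k * (-1) ^ k : R) = 1.
Proof. by rewrite -expfzMl mulrNN mulr1 exp1rz. Qed.

Lemma sign_cases (k : int) : ((-1) ^ k : R) = 1 \/ ((-1) ^ k : R) = -1.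
Proof.
have := sign_sqr k; rewrite -expr2 => /eqP; rewrite sqrf_eq1.
by case/orP => /eqP ->; [left|right].
Qed.

(** Conjugation by [sigma] inverts the vertical translation, so every word in the generators reduces
    to the normal form; the parity of the exponent of [sigma] decides the sign with which vertical
    translations recombine. *)
Lemma klein_orbitP beta z w :
  klein_orbit beta z w <-> exists k n : int, w = deck beta k n z.
Proof.
split.
- elim=> {z w} [[x y]|[x y]|[x y]|[x y] [x' y'] _ [k [n [-> ->]]]|_ [x y] _ _ [k [n ->]] _ [k' [n' ->]]].
  + by exists 1, 0; rewrite /deck /sigma /= expr1z; congr pair; ring.
  + by exists 0, 1; rewrite /deck /vtrans /= expr0z; congr pair; ring.
  + by exists 0, 0; rewrite /deck /= expr0z; congr pair; ring.
  + have [e|e] := sign_cases k; have e' : (-1) ^ (- k) = (-1) ^ k :> R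
      by rewrite -invr_expz e ?invr1// invrN invr1.
    * by exists (- k), (- n); rewrite /deck /= e' e !mulrNz; congr pair; ring.
    * by exists (- k), n; rewrite /deck /= e' e !mulrNz; congr pair; ring.
  + have e : (-1) ^ (k + k') = (-1) ^ k * (-1) ^ k' :> R.
      by rewrite expfzDr ?oppr_eq0 ?oner_eq0.
    have [e'|e'] := sign_cases k'.
      by exists (k + k'), (n + n'); rewrite /deck /= e e' !intrD; congr pair; ring.
    by exists (k + k'), (n' - n); rewrite /deck /= e e' intrD intrB; congr pair; ring.
- move=> [k [n ->]].
  (* The converse is proved for natural exponents first; a negative power is the inverse of a
     positive one and follows from the symmetry of the orbit relation. *)
  have tn (m : nat) p : klein_orbit beta p (p.1, p.2 + m%:R * (2 * beta)).
    elim: m => [|m IH]; first by rewrite mul0r addr0 -surjective_pairing; exact: orbit_refl.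
    apply: orbit_comp IH _; rewrite -[m.+1%:R]natr1.
    have := orbit_vtrans beta (p.1, p.2 + m%:R * (2 * beta)).
    by rewrite /vtrans /= -addrA [(m%:R + 1) * _]mulrDl mul1r.
  have tz (m : int) p : klein_orbit beta p (p.1, p.2 + m%:~R * (2 * beta)).
    case: m => m; first exact: tn.
    apply: orbit_sym; have := tn m.+1 (p.1, p.2 + (Negz m)%:~R * (2 * beta)).
    by rewrite /= NegzE -addrA -mulrDl mulrNz addNr mul0r addr0 -surjective_pairing.
  have sn (m : nat) p : klein_orbit beta p (p.1 + m%:R * pi, (-1) ^+ m * p.2).
    elim: m => [|m IH]; first by rewrite mul0r addr0 expr0 mul1r -surjective_pairing; exact: orbit_refl.
    apply: orbit_comp IH _; rewrite -[m.+1%:R]natr1.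
    have := orbit_sigma beta (p.1 + m%:R * pi, (-1) ^+ m * p.2).
    by rewrite /sigma /= -addrA [(m%:R + 1) * _]mulrDl mul1r exprS mulN1r mulNr.
  have sz (m : int) p : klein_orbit beta p (p.1 + m%:~R * pi, (-1) ^ m * p.2).
    case: m => m; first exact: sn.
    apply: orbit_sym; have := sn m.+1 (p.1 + (Negz m)%:~R * pi, (-1) ^ (Negz m) * p.2).
    have -> : (-1) ^ Negz m = ((-1) ^+ m.+1)^-1 :> R by [].
    rewrite /= NegzE -addrA -mulrDl mulrNz addNr mul0r addr0 mulrA.
    by rewrite mulfV ?mul1r -?surjective_pairing// expf_neq0 ?oppr_eq0 ?oner_eq0.
  exact: orbit_comp (sz k z) (tz n _).
Qed.

Lemma klein_proj_deck beta k n z : klein_proj beta (deck beta k n z) = klein_proj beta z.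
Proof. by apply/klein_projP/orbit_sym/klein_orbitP; exists k, n. Qed.

Lemma deck_affine beta k n u z w :
  deck beta k n ((1 - u) * z.1 + u * w.1, (1 - u) * z.2 + u * w.2) =
  ((1 - u) * (deck beta k n z).1 + u * (deck beta k n w).1,
   (1 - u) * (deck beta k n z).2 + u * (deck beta k n w).2).
Proof. by rewrite /deck /=; congr pair; ring. Qed.

Lemma sigma_deck beta : @sigma R = deck beta 1 0.
Proof. by apply/funext => z; rewrite /deck /sigma expr1z; congr pair; ring. Qed.

Lemma vtrans_deck beta : vtrans beta = deck beta 0 1.
Proof. by apply/funext => z; rewrite /deck /vtrans expr0z; congr pair; ring. Qed.

Lemma tsigma_deck beta : vtrans beta \o @sigma R = deck beta 1 1.
Proof. by apply/funext => z; rewrite /deck /vtrans /= expr1z; congr pair; ring. Qed.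

Lemma sigma2_deck beta : @sigma R \o @sigma R = deck beta 2 0.
Proof.
apply/funext => z; rewrite /deck /sigma /= (_ : (-1) ^ 2 = 1); last by rewrite -exprnP sqrrN expr1n.
by congr pair; ring.
Qed.

Definition C1 (f f' : R -> R) := continuous f' /\ forall x, has_deriv f x (f' x).

Lemma C1_continuous f f' : C1 f f' -> continuous f.
Proof. by move=> [_ d] x; exact: has_deriv_continuous (d x). Qed.

Lemma C1_derive1 f f' : C1 f f' -> derive1 f = f'.
Proof. by move=> [_ d]; apply/funext => x; rewrite derive1E; have [_ ->] := d x. Qed.

Lemma C1_continuously_differentiable f f' : C1 f f' -> continuously_differentiable f.
Proof.
move=> C; split=> [s|]; first by have [+ _] := C.2 s.
by rewrite (C1_derive1 C); exact: C.1.
Qed.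

Lemma C1_piecewise f f' : C1 f f' -> piecewise_C1 f.
Proof.
move=> C; split; first exact/continuous_subspaceT/(C1_continuous C).
exists [:: 1]; split; first exact: itv_partition1.
by move=> [|//] _ /=; exists f => //; exact: C1_continuously_differentiable C.
Qed.

Lemma curve_length_ge0 beta (phi : klein beta -> R) c :
  conformal_factor phi -> 0 <= curve_length phi c.
Proof.
move=> [_ p0]; apply: Rintegral_ge0 => s _.
by rewrite mulr_ge0 ?sqrtr_ge0 ?ltW.
Qed.

(** The straight-line homotopy to the segment from 0 stays closed in the quotient: deck
    transformations are affine, so the one joining the ends of both curves also joins the ends of
    each intermediate curve. *)
Lemma freely_homotopic_deck beta k n (c : R -> R * R) :
  continuous c -> c 1 = deck beta k n (c 0) ->
  freely_homotopic (klein_proj beta \o c) (deck_loop beta (deck beta k n)).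
Proof.
move=> cc c1; set g := deck beta k n (0, 0).
pose H p : R * R := ((1 - p.1) * (c p.2).1 + p.1 * (p.2 * g.1),
                     (1 - p.1) * (c p.2).2 + p.1 * (p.2 * g.2)).
exists (klein_proj beta \o H); split.
- apply: continuous_subspaceT; apply: continuous_compose.
    exact: klein_proj_continuous.
  have f1 : continuous (fun p : R * R => p.1) by move=> q; exact: cvg_fst.
  have f2 : continuous (fun p : R * R => p.2) by move=> q; exact: cvg_snd.
  have c1' : continuous (fun p : R * R => (c p.2).1).
    by apply: (continuous_compose (g := fun z : R * R => z.1)) => //; exact: continuous_compose.
  have c2' : continuous (fun p : R * R => (c p.2).2).
    by apply: (continuous_compose (g := fun z : R * R => z.2)) => //; exact: continuous_compose.
  have a1 : continuous (fun p : R * R => 1 - p.1).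
    by apply: continuous_sub => //; exact: continuous_const.
  have a2 k' : continuous (fun p : R * R => p.1 * (p.2 * k')).
    by apply: continuous_mul => //; apply: continuous_mul => //; exact: continuous_const.
  by apply: continuous_pair; apply: continuous_add => //; exact: continuous_mul.
- by move=> s _; rewrite /H /= subr0 !mul1r !mul0r !addr0 -surjective_pairing.
- move=> s _; rewrite /deck_loop -/g.
  have -> : s *: g = (s * g.1, s * g.2) by case: (g).
  by rewrite /H /= subrr !mul0r !mul1r !add0r.
- move=> u _; rewrite /H /= c1 !mul0r -(klein_proj_deck beta k n).
  have := deck_affine beta k n u (c 0) (0, 0).
  by rewrite -/g /= => ->; rewrite !mul1r.
Qed.

Lemma least_length_le beta k n (phi : klein beta -> R) (X X' Y Y' : R -> R) :
  conformal_factor phi -> C1 X X' -> C1 Y Y' ->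
  (X 1, Y 1) = deck beta k n (X 0, Y 0) ->
  least_length (deck beta k n) phi <=
  rint 0 1 (fun s => phi (klein_proj beta (X s, Y s)) * Num.sqrt (X' s ^+ 2 + Y' s ^+ 2)).
Proof.
move=> cphi CX CY e; pose c s := (X s, Y s).
have -> : rint 0 1 (fun s => phi (klein_proj beta (X s, Y s)) *
    Num.sqrt (X' s ^+ 2 + Y' s ^+ 2)) = curve_length phi c.
  by rewrite /curve_length (_ : (fun u => (c u).1) = X)// (_ : (fun u => (c u).2) = Y)//
    (C1_derive1 CX) (C1_derive1 CY).
apply: ge_inf; first by exists 0 => _ [c' [_ _ _ ->]]; exact: curve_length_ge0.
have cc : continuous c.
  by apply: continuous_pair; [exact: C1_continuous CX|exact: C1_continuous CY].
exists c; split => //.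
- by split; [exact: C1_piecewise CX|exact: C1_piecewise CY].
- by rewrite /c e klein_proj_deck.
- exact: freely_homotopic_deck.
Qed.

End KleinBottle.

(** * Lower bounds for integrals of piecewise continuous functions *)

Section PiecewiseIntegral.
Context {R : realType}.
Implicit Types (a b c s v M : R) (f g h : R -> R).
Local Notation mu := (@lebesgue_measure R).

(** Measurability and boundedness are carried along because they are what allows the bounds over
    adjacent intervals to be added. *)
Definition integral_ge f a b v := [/\ a <= b, measurable_fun `[a, b] f,
  exists M, forall s, a <= s <= b -> `|f s| <= M & v <= (\int[mu]_(s in `[a, b]) f s)%R].

Lemma bounded_integrable f a b M : measurable_fun `[a, b] f ->
  (forall s, a <= s <= b -> `|f s| <= M) -> mu.-integrable `[a, b] (EFin \o f).
Proof.
move=> mf fM; apply: measurable_bounded_integrable => //.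
  by rewrite /= lebesgue_measure_itv/=; case: ifP => // _; rewrite -EFinD ltry.
exists M; split => [|y My s /=]; first exact: num_real.
by rewrite in_itv/= => sab; apply: le_trans (ltW My); exact: fM.
Qed.

Lemma integral_ge_cat f a b c v v' :
  integral_ge f a b v -> integral_ge f b c v' -> integral_ge f a c (v + v').
Proof.
move=> [ab mf [M fM] vf] [bc mf' [M' fM'] vf'].
have ac := le_trans ab bc.
have U : `[a, c]%classic = `[a, b]%classic `|` `[b, c]%classic :> set R.
  apply/seteqP; split => [s|s [|]] /=; rewrite !in_itv/= => /andP[s1 s2].
  - by have [sb|sb] := leP s b; [left|right]; rewrite ?s1 ?s2 ?(ltW sb).
  - by rewrite s1 (le_trans s2).
  - by rewrite s2 (le_trans ab).
have mfac : measurable_fun `[a, c] f by rewrite U; apply/measurable_funU.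
have fMac s : a <= s <= c -> `|f s| <= Num.max M M'.
  move=> /andP[s1 s2]; rewrite le_max; have [sb|sb] := leP s b.
    by rewrite fM ?s1.
  by rewrite fM' ?orbT// s2 ltW.
have ifac := bounded_integrable mfac fMac.
split => //; first by exists (Num.max M M').
have := @Rintegral_itvB R f (BLeft a) (BRight c) b ifac.
rewrite !bnd_simp => /(_ ab bc).
rewrite [in X in _ = X]Rintegral_itv_obnd_cbnd; last first.
  apply: integrableS ifac => //.
  by move=> s /=; rewrite !in_itv/= => /andP[s1 ->]; rewrite (le_trans ab)// ltW.
by move=> e; apply: le_trans (lerD vf vf') _; rewrite -e addrC subrK.
Qed.

(** The two functions are compared on the open interval only: at a break point of a curve, [derive1]
    has an uncontrolled value, which enters the bound but not the integral. *)
Lemma integral_ge_piece f g a b v : a < b -> continuous g ->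
  (forall s, a < s < b -> f s = g s) -> v <= rint a b g -> integral_ge f a b v.
Proof.
move=> ab cg fg vg; have [M [_ gM]] := compact_bounded
  (continuous_compact (continuous_subspaceT cg) (@segment_compact R a b)).
have {}gM s : a <= s <= b -> `|g s| <= M + 1.
  move=> sab; apply: (gM (M + 1)); first by rewrite ltrDl.
  by exists s => //=; rewrite in_itv.
have mg : measurable_fun `]a, b[ g.
  by apply: measurable_funTS; exact: measurable_realfun.continuous_measurable_fun.
have eI : {in `]a, b[%classic, g =1 f}.
  by move=> s; rewrite inE/= in_itv/= => /fg.
have mfo : measurable_fun `]a, b[ f by apply: eq_measurable_fun mg.
have mf : measurable_fun `[a, b] f.
  by apply/measurable_realfun.measurable_fun_itv_bndo_bndcP/measurable_realfun.measurable_fun_itv_obnd_cbndP.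
have fM s : a <= s <= b -> `|f s| <= Num.max (M + 1) (Num.max `|f a| `|f b|).
  move=> /andP[]; rewrite !le_max le_eqVlt => /predU1P[<-|sa]; first by rewrite lexx orbT.
  rewrite le_eqVlt => /predU1P[->|sb]; first by rewrite lexx !orbT.
  by rewrite fg ?sa// gM// !ltW.
split => //; [exact: ltW|by eexists; exact: fM|].
apply: le_trans vg _; apply: eq_ler; rewrite /rint.
have oc h : mu.-integrable `[a, b] (EFin \o h) ->
    (\int[mu]_(s in `[a, b]) h s = \int[mu]_(s in `]a, b[) h s)%R.
  move=> ih; rewrite -Rintegral_itv_bndo_bndc; last first.
    by apply: integrableS ih => // s /=; rewrite !in_itv/= => /andP[-> /ltW].
  rewrite -Rintegral_itv_obnd_cbnd//.
  by apply: integrableS ih => // s /=; rewrite !in_itv/= => /andP[/ltW-> /ltW].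
rewrite !oc; [|exact: bounded_integrable mf fM|exact: rint_integrable].
exact: eq_Rintegral.
Qed.

End PiecewiseIntegral.

Opaque rint.

(** * Mercator coordinates *)

Section Hyperbolic.
Context {R : realType}.
Implicit Types x y p : R.

Definition cosh y : R := (expR y + expR (- y)) / 2.
Definition sinh y : R := (expR y - expR (- y)) / 2.
Definition sech y : R := (cosh y)^-1.
Definition tanh y : R := sinh y / cosh y.
Definition artanh p : R := (ln (1 + p) - ln (1 - p)) / 2.
(** The Gudermannian function: the latitude of the point at height [y] on the Mercator map. Its sine
    is [tanh y] and its cosine [sech y]. *)
Definition gd y : R := atan (sinh y).

Lemma cosh_gt0 y : 0 < cosh y.
Proof. by rewrite divr_gt0// addr_gt0 ?expR_gt0. Qed.

Lemma cosh_neq0 y : cosh y != 0. Proof. by rewrite gt_eqF// cosh_gt0. Qed.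

Lemma sech_gt0 y : 0 < sech y. Proof. by rewrite invr_gt0 cosh_gt0. Qed.

Lemma expRNM y : expR y * expR (- y) = 1.
Proof. by rewrite -expRD subrr expR0. Qed.

Lemma cosh2_sinh2 y : cosh y ^+ 2 = 1 + sinh y ^+ 2.
Proof. by rewrite /cosh /sinh; have := expRNM y; nra. Qed.

Lemma coshN y : cosh (- y) = cosh y.
Proof. by rewrite /cosh opprK addrC. Qed.

Lemma sinhN y : sinh (- y) = - sinh y.
Proof. by rewrite /sinh opprK; ring. Qed.

Lemma sechN y : sech (- y) = sech y. Proof. by rewrite /sech coshN. Qed.

Lemma tanhN y : tanh (- y) = - tanh y.
Proof. by rewrite /tanh coshN sinhN mulNr. Qed.

Lemma cosh0 : cosh 0 = 1.
Proof. by rewrite /cosh oppr0 expR0 divff. Qed.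

Lemma sinh0 : sinh 0 = 0.
Proof. by rewrite /sinh oppr0 subrr mul0r. Qed.

Lemma tanh0 : tanh 0 = 0. Proof. by rewrite /tanh sinh0 mul0r. Qed.

Lemma gd0 : gd 0 = 0. Proof. by rewrite /gd sinh0 atan0. Qed.

Lemma sech2_tanh2 y : sech y ^+ 2 = 1 - tanh y ^+ 2.
Proof.
rewrite /sech /tanh expr_div_n -[1](@divff _ (cosh y ^+ 2)) ?sqrf_eq0 ?cosh_neq0//.
by rewrite -mulrBl cosh2_sinh2 addrK div1r exprVn cosh2_sinh2.
Qed.

Lemma der_cosh y : has_deriv cosh y (sinh y).
Proof. by rewrite /cosh; apply: der_eq; first deriv; rewrite /sinh /=; ring. Qed.

Lemma der_sinh y : has_deriv sinh y (cosh y).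
Proof. by rewrite /sinh; apply: der_eq; first deriv; rewrite /cosh /=; ring. Qed.

Lemma der_sech y : has_deriv sech y (- (sech y * tanh y)).
Proof.
apply: der_eq; first by apply: der_inv; [exact: cosh_neq0|exact: der_cosh].
by rewrite /sech /tanh; field; rewrite cosh_neq0.
Qed.

Lemma der_tanh y : has_deriv tanh y (sech y ^+ 2).
Proof.
apply: der_eq.
  by apply: der_mul; [exact: der_sinh|apply: der_inv; [exact: cosh_neq0|exact: der_cosh]].
have e : sinh y ^+ 2 = cosh y ^+ 2 - 1 by rewrite cosh2_sinh2 addrC addKr.
rewrite /sech /=; transitivity ((cosh y ^+ 2 - sinh y ^+ 2) / cosh y ^+ 2).
  by field; rewrite cosh_neq0.
by rewrite e; field; rewrite cosh_neq0.
Qed.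

Lemma der_gd y : has_deriv gd y (sech y).
Proof.
rewrite /gd; apply: der_eq; first by apply: der_atan; exact: der_sinh.
by rewrite -cosh2_sinh2 /sech; field; rewrite cosh_neq0.
Qed.

Lemma cosh_continuous : continuous cosh.
Proof. by move=> y; exact: has_deriv_continuous (der_cosh y). Qed.

Lemma sinh_continuous : continuous sinh.
Proof. by move=> y; exact: has_deriv_continuous (der_sinh y). Qed.

Lemma sech_continuous : continuous sech.
Proof. by move=> y; exact: has_deriv_continuous (der_sech y). Qed.

Lemma tanh_continuous : continuous tanh.
Proof. by move=> y; exact: has_deriv_continuous (der_tanh y). Qed.

Lemma sinh_ge0 y : 0 <= y -> 0 <= sinh y.
Proof. by move=> y0; rewrite /sinh divr_ge0// subr_ge0 ler_expR; lra. Qed.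

Lemma tanh_ge0 y : 0 <= y -> 0 <= tanh y.
Proof. by move=> y0; rewrite divr_ge0 ?sinh_ge0// ltW// cosh_gt0. Qed.

Lemma tanh_lt1 y : tanh y < 1.
Proof.
by rewrite ltr_pdivrMr ?cosh_gt0// mul1r /sinh /cosh ltr_pM2r// ltrD2l; have := expR_gt0 (- y); lra.
Qed.

Lemma le_cosh x y : `|x| <= `|y| -> cosh x <= cosh y.
Proof.
have coshn z : cosh z = cosh `|z|.
  by have [z0|/ltW z0] := leP 0 z; rewrite ?(ger0_norm z0)// (ler0_norm z0) coshN.
rewrite (coshn x) (coshn y); set a := `|x|; set b := `|y| => ab.
have a0 : 0 <= a by rewrite normr_ge0.
rewrite -subr_ge0.
have ca : {within `[a, b], continuous cosh} by apply: continuous_subspaceT; exact: cosh_continuous.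
have dc z : z \in `]a, b[ -> is_derive z 1 cosh (sinh z) by move=> _; exact: der_cosh.
have [z zab ->] := MVT_segment ab dc ca.
by rewrite mulr_ge0 ?subr_ge0// sinh_ge0//; move: zab; rewrite in_itv/= => /andP[/(le_trans a0)].
Qed.

Lemma le_sech x y : `|x| <= `|y| -> sech y <= sech x.
Proof. by move=> xy; rewrite lef_pV2 ?posrE ?cosh_gt0//; exact: le_cosh. Qed.

Lemma tanhK y : artanh (tanh y) = y.
Proof.
have c := cosh_gt0 y; have e := expR_gt0 y; have e' := expR_gt0 (- y).
have h' : 1 + tanh y = expR y / cosh y.
  by rewrite /tanh; apply: (mulIf (cosh_neq0 y)); rewrite mulrDl !divfK ?cosh_neq0// /cosh /sinh; field.
have h : 1 - tanh y = expR (- y) / cosh y.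
  by rewrite /tanh; apply: (mulIf (cosh_neq0 y)); rewrite mulrBl !divfK ?cosh_neq0// /cosh /sinh; field.
have ln_exp z : ln (expR z / cosh y) = z - ln (cosh y).
  by rewrite ln_div ?posrE ?expR_gt0// expRK.
by rewrite /artanh h h' !ln_exp; field.
Qed.

Lemma der_artanh p : -1 < p < 1 -> has_deriv artanh p (1 - p ^+ 2)^-1.
Proof.
move=> /andP[p1 p2]; rewrite /artanh; apply: der_eq; first by deriv => /=; lra.
rewrite /=; have a : 1 + p != 0 by rewrite gt_eqF//; lra.
have b : 1 - p != 0 by rewrite gt_eqF//; lra.
have c : 1 - p ^+ 2 != 0 by rewrite (_ : 1 - p ^+ 2 = (1 + p) * (1 - p)) ?mulf_neq0//; ring.
by field; rewrite a b c.
Qed.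

End Hyperbolic.

(** * Half great circles on the Mercator map *)

Section GreatCircle.
Context {R : realType}.
Variable q : R.
Hypothesis q01 : 0 <= q < 1.
Let c := Num.sqrt (1 - q ^+ 2).

(* The great half circle whose highest point has latitude [asin q], in Mercator
   coordinates and parametrized by arc length; the arctangent is the difference
   between arc length and longitude. *)
Definition circle_x (s : R) : R :=
  s - atan ((1 - c) * (sin s * cos s) / (cos s ^+ 2 + c * sin s ^+ 2)).
Definition circle_y (s : R) : R := artanh (q * sin s).
Definition circle_x' (s : R) : R := c / (1 - q ^+ 2 * sin s ^+ 2).
Definition circle_y' (s : R) : R := q * cos s / (1 - q ^+ 2 * sin s ^+ 2).

Let q2 : q ^+ 2 < 1.
Proof. by have /andP[? ?] := q01; nra. Qed.

Let c_gt0 : 0 < c. Proof. by rewrite sqrtr_gt0 subr_gt0. Qed.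

Let c2 : c ^+ 2 = 1 - q ^+ 2. Proof. by rewrite sqr_sqrtr// subr_ge0 ltW. Qed.

Lemma qsin_bound s : -1 < q * sin s < 1.
Proof. by have /andP[? ?] := q01; have := sin_le1 s; have := sin_geN1 s; nra. Qed.

Lemma qsin2_gt0 s : 0 < 1 - q ^+ 2 * sin s ^+ 2.
Proof.
have /andP[? ?] := qsin_bound s.
by rewrite (_ : _ - _ = (1 - q * sin s) * (1 + q * sin s)) ?mulr_gt0//; [lra|lra|ring].
Qed.

Lemma der_circle_y s : has_deriv circle_y s (circle_y' s).
Proof.
apply: der_eq.
  apply: der_comp; first exact: der_artanh (qsin_bound s).
  by deriv.
rewrite /= /circle_y' exprMn; have := qsin2_gt0 s; set M := 1 - _ => M0.
by field; rewrite gt_eqF.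
Qed.

(** The longitude x satisfies tan x = c tan s, and the addition formula gives tan (s - x) = N / D
    with a denominator that never vanishes. The derivative simplifies because D^2 + N^2 = cos^2 s +
    c^2 sin^2 s. *)
Lemma der_circle_x s : has_deriv circle_x s (circle_x' s).
Proof.
have c1 : c <= 1 by rewrite -sqrtr1 ler_wsqrtr// lerBlDr lerDl sqr_ge0.
have D0 : cos s ^+ 2 + c * sin s ^+ 2 != 0.
  have := cos2Dsin2 s; have := sqr_ge0 (cos s); have := sqr_ge0 (sin s).
  set A := cos s ^+ 2; set B := sin s ^+ 2 => A0 B0 AB.
  have A1 : 0 <= A * (1 - c) by rewrite mulr_ge0// subr_ge0.
  have -> : A + c * B = c + A * (1 - c) by rewrite -[B](addKr A) AB; ring.
  by rewrite gt_eqF// ltr_wpDr.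
rewrite /circle_x; apply: der_eq; first by deriv.
rewrite /= /circle_x'.
have M0 := qsin2_gt0 s; move: (cos2sin2 s) D0 M0; set S := sin s; set C := cos s => C2 D0 M0.
set D := C ^+ 2 + c * S ^+ 2 in D0 *; set N := (1 - c) * (S * C).
have DN : D ^+ 2 + N ^+ 2 = 1 - q ^+ 2 * S ^+ 2.
  transitivity ((C ^+ 2 + S ^+ 2) * (C ^+ 2 + c ^+ 2 * S ^+ 2)); first by rewrite /D /N; ring.
  by rewrite c2 C2; ring.
have DN0 : D ^+ 2 + N ^+ 2 != 0 by rewrite DN gt_eqF.
have e : (1 + (N / D) ^+ 2)^-1 = D ^+ 2 / (D ^+ 2 + N ^+ 2).
  have -> : 1 + (N / D) ^+ 2 = (D ^+ 2 + N ^+ 2) / D ^+ 2 by field; rewrite D0.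
  by rewrite invf_div.
rewrite e.
transitivity (1 - ((1 - c) * (C ^+ 2 - S ^+ 2) * D + 2 * (1 - c) * (S * C) * N) / (D ^+ 2 + N ^+ 2)).
  by field; rewrite D0 DN0.
have -> : (1 - c) * (C ^+ 2 - S ^+ 2) * D + 2 * (1 - c) * (S * C) * N = (1 - c) * (C ^+ 2 - c * S ^+ 2).
  transitivity ((1 - c) * ((C ^+ 2 + S ^+ 2) * (C ^+ 2 - c * S ^+ 2))); first by rewrite /D /N; ring.
  by rewrite C2; ring.
rewrite -DN; apply: (mulIf DN0); rewrite mulrBl !divfK// DN -[LHS]subr0 mul1r C2.
have : q ^+ 2 = 1 - c ^+ 2 by rewrite c2; ring.
by move=> ->; ring.
Qed.

(** Unit speed on the sphere: [tanh] of the height [circle_y s] is [q * sin s], so the squared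
    conformal factor is the inverse of the right side. *)
Lemma circle_speed s :
  circle_x' s ^+ 2 + circle_y' s ^+ 2 = (1 - q ^+ 2 * sin s ^+ 2)^-1.
Proof.
have M0 := qsin2_gt0 s; rewrite /circle_x' /circle_y'.
transitivity ((c ^+ 2 + q ^+ 2 * cos s ^+ 2) / (1 - q ^+ 2 * sin s ^+ 2) ^+ 2).
  by move: M0; set M := 1 - q ^+ 2 * sin s ^+ 2 => M0; field; rewrite gt_eqF.
have -> : c ^+ 2 + q ^+ 2 * cos s ^+ 2 = 1 - q ^+ 2 * sin s ^+ 2.
  by rewrite c2 cos2sin2; ring.
by move: M0; set M := 1 - _ => M0; field; rewrite gt_eqF.
Qed.

Lemma circle_x0 : circle_x 0 = 0.
Proof. by rewrite /circle_x sin0 mul0r mulr0 mul0r atan0 subrr. Qed.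

Lemma circle_xpi : circle_x pi = pi.
Proof. by rewrite /circle_x sinpi mul0r mulr0 mul0r atan0 subr0. Qed.

Lemma circle_y0 : circle_y 0 = 0.
Proof. by rewrite /circle_y sin0 mulr0 /artanh addr0 subr0 subrr mul0r. Qed.

Lemma circle_ypi : circle_y pi = 0.
Proof. by rewrite /circle_y sinpi mulr0 /artanh addr0 subr0 subrr mul0r. Qed.

Lemma circle_x'_continuous : continuous circle_x'.
Proof.
apply: continuous_mul; first exact: continuous_const.
apply: continuous_inv; first by move=> s; rewrite gt_eqF// qsin2_gt0.
apply: continuous_sub; first exact: continuous_const.
apply: continuous_mul; [exact: continuous_const|exact: continuous_sinX].
Qed.

Lemma circle_y'_continuous : continuous circle_y'.
Proof.
apply: continuous_mul.
  by apply: continuous_mul; [exact: continuous_const|exact: continuous_cos].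
apply: continuous_inv; first by move=> s; rewrite gt_eqF// qsin2_gt0.
apply: continuous_sub; first exact: continuous_const.
apply: continuous_mul; [exact: continuous_const|exact: continuous_sinX].
Qed.

End GreatCircle.

(** * The product inequality *)

Section UpperBound.
Context {R : realType}.
Variables (beta : R) (phi : klein beta -> R).
Hypothesis beta_gt0 : 0 < beta.
Hypothesis cphi : conformal_factor phi.

Let f (z : R * R) : R := phi (klein_proj beta z).

Lemma lift_continuous : continuous f.
Proof. by apply: continuous_compose; [exact: cphi.1|exact: klein_proj_continuous]. Qed.

Let f_deck k n z : f (deck beta k n z) = f z.
Proof. by rewrite /f klein_proj_deck. Qed.

Definition ubar (y : R) : R := rint 0 (2 * pi) (fun x => f (x, y)).

Let pi2_gt0 : 0 < 2 * pi :> R. Proof. by rewrite mulr_gt0// pi_gt0. Qed.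

Let fx y : continuous (fun x => f (x, y)).
Proof. exact: continuous_fst lift_continuous. Qed.

Let fy x : continuous (fun y => f (x, y)).
Proof. exact: continuous_snd lift_continuous. Qed.

Let f_period x y : f (x + 2 * pi, y) = f (x, y).
Proof.
rewrite -[RHS](f_deck 2 0); congr f; rewrite /deck /= -exprnP sqrrN expr1n.
by congr pair; ring.
Qed.

Lemma ubar_continuous : continuous ubar.
Proof. exact: rint_continuous lift_continuous. Qed.

Lemma ubar_shift a y : rint 0 (2 * pi) (fun x => f (x + a, y)) = ubar y.
Proof.
rewrite (rint_shift _ _ _ (@fx y)) add0r addrC.
by apply: rint_periodic => //; exact: ltW.
Qed.

(** [sigma] reverses y and shifts x by pi; the shift does not affect an integral over a full
    period. *)
Lemma ubar_opp y : ubar (- y) = ubar y.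
Proof.
rewrite -(ubar_shift pi (- y)); apply: eq_rint => x _.
rewrite -[RHS](f_deck 1 0); congr f; rewrite /deck /= expr1z.
by congr pair; ring.
Qed.

Lemma ubar_period (n : int) y : ubar (y + n%:~R * (2 * beta)) = ubar y.
Proof.
apply: eq_rint => x _; rewrite -[RHS](f_deck 0 n); congr f; rewrite /deck /= expr0z.
by congr pair; ring.
Qed.

Lemma ubar_reflect y : ubar (beta - y) = ubar (beta + y).
Proof.
rewrite -ubar_opp opprB -(ubar_period 1); congr ubar; ring.
Qed.

Lemma l_h_le y : l_h phi <= ubar y.
Proof.
have CX : C1 (fun s : R => 2 * pi * s) (fun=> 2 * pi).
  split; first exact: continuous_const.
  by move=> s; exact: der_mull.
have CY : C1 (fun _ : R => y) (fun=> 0).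
  by split; [exact: continuous_const|move=> s; exact: der_const].
rewrite /l_h (sigma2_deck beta).
apply: (le_trans (least_length_le cphi CX CY _)).
  rewrite /deck -exprnP sqrrN expr1n /=; congr pair; ring.
rewrite expr0n /= addr0 sqrtr_sqr gtr0_norm// (@eq_rint _ 0 1 _ (fun s => 2 * pi * f (2 * pi * s, y))).
  rewrite /ubar; have := rint_scale pi2_gt0 ler01 (@fx y); rewrite mulr0 mulr1 => <-.
  rewrite rintZ; first by rewrite [leRHS]mulrC.
  apply: (continuous_compose (g := fun x => f (x, y))); first exact: fx.
  exact: mulrl_continuous.
by move=> s _; rewrite mulrC.
Qed.

Lemma l_v_le x : l_v phi <= rint (- beta) beta (fun y => f (x, y)).
Proof.
have b2 : 0 < 2 * beta by rewrite mulr_gt0.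
have CX : C1 (fun _ : R => x) (fun=> 0).
  by split; [exact: continuous_const|move=> s; exact: der_const].
have CY : C1 (fun s : R => 2 * beta * s - beta) (fun=> 2 * beta).
  split; first exact: continuous_const.
  by move=> s; apply: der_eq; first deriv; rewrite /=; ring.
rewrite /l_v (vtrans_deck beta).
apply: (le_trans (least_length_le cphi CX CY _)).
  rewrite /deck expr0z /=; congr pair; ring.
rewrite expr0n /= add0r sqrtr_sqr gtr0_norm//.
have e0 : 2 * beta * 0 - beta = - beta by ring.
have e1 : 2 * beta * 1 - beta = beta by ring.
have m : - beta <= beta by apply: (@le_trans _ _ 0); rewrite ?oppr_le0 ltW.
have := @rint_subst _ 0 1 (fun y => f (x, y)) _ _ ler01 _ (@fy x) CY.1 CY.2.
by rewrite /= e0 e1 => /(_ m) <-.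
Qed.

Lemma l_v_mean : 2 * pi * l_v phi <= 2 * rint 0 beta ubar.
Proof.
have b0 : - beta <= 0 by rewrite oppr_le0 ltW.
have -> : 2 * rint 0 beta ubar = rint (- beta) beta ubar.
  rewrite (rint_cat ubar_continuous b0 (ltW beta_gt0)).
  rewrite -(@eq_rint _ (- beta) 0 (fun y => ubar (- y))); last by move=> y _; rewrite ubar_opp.
  by rewrite (rint_opp _ _ ubar_continuous) oppr0 opprK; ring.
have -> : rint (- beta) beta ubar =
    rint 0 (2 * pi) (fun x => rint (- beta) beta (fun y => f (x, y))).
  by rewrite (rint_fubini _ _ _ _ lift_continuous).
have -> : 2 * pi * l_v phi = rint 0 (2 * pi) (fun=> l_v phi).
  by rewrite rint_cst ?subr0// ltW.
apply: le_rint; first exact: continuous_const.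
  exact: (rint_continuous (F := fun z : R * R => f (z.2, z.1)) (continuous_swap lift_continuous)).
by move=> x _; exact: l_v_le.
Qed.

Section Sigma.
Variable n : int.
Let a : R := n%:~R * beta.
Let l := least_length (deck beta 1 n) phi.

(** With its ends on the axis of the glide reflection, at longitudes pi apart, a half great circle
    closes up in the Klein bottle and belongs to the class of that glide reflection. *)
Lemma l_circle_le q t : 0 <= q < 1 ->
  l <= rint 0 pi (fun s => f (t + circle_x q s, a + circle_y q s) *
                           (Num.sqrt (1 - q ^+ 2 * sin s ^+ 2))^-1).
Proof.
move=> q01.
have cX : continuous (circle_x q) by move=> s; exact: has_deriv_continuous (der_circle_x q01 s).
have cY : continuous (circle_y q) by move=> s; exact: has_deriv_continuous (der_circle_y q01 s).
have cpi : continuous (fun s : R => pi * s) by exact: mulrl_continuous.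
have C g g' : continuous g' -> (forall s, has_deriv g s (g' s)) -> forall k : R,
    C1 (fun s : R => k + g (pi * s)) (fun s => g' (pi * s) * pi).
  move=> cg' dg k; split.
    apply: continuous_mul; last exact: continuous_const.
    exact: (continuous_compose (g := g')).
  move=> s; apply: der_eq; first by apply: der_add; [exact: der_const|apply: der_comp; [exact: dg|exact: der_mull]].
  by rewrite add0r.
have CX := C _ _ (circle_x'_continuous q01) (der_circle_x q01) t.
have CY := C _ _ (circle_y'_continuous q01) (der_circle_y q01) a.
apply: (le_trans (least_length_le cphi CX CY _)).
  rewrite /deck expr1z !mulr0 !mulr1 circle_xpi circle_x0 circle_ypi circle_y0 /= /a.
  by congr pair; ring.
set h := fun s => _ * _^-1.
have cw : continuous (fun s : R => (Num.sqrt (1 - q ^+ 2 * sin s ^+ 2))^-1).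
  apply: continuous_inv; first by move=> s; rewrite gt_eqF// sqrtr_gt0 qsin2_gt0.
  apply: (continuous_compose (g := Num.sqrt)); first exact: sqrt_continuous.
  apply: continuous_sub; first exact: continuous_const.
  by apply: continuous_mul; [exact: continuous_const|exact: continuous_sinX].
have ch : continuous h.
  apply: continuous_mul => //.
  apply: continuous_comp2; first exact: lift_continuous.
    by apply: continuous_add => //; exact: continuous_const.
  by apply: continuous_add => //; exact: continuous_const.
have := rint_scale (pi_gt0 R) ler01 ch; rewrite mulr0 mulr1 => <-.
rewrite mulrC -rintZ; last exact: (continuous_compose (g := h)).
apply: eq_ler; apply: eq_rint => s _.
have -> (u v w : R) : (u * w) ^+ 2 + (v * w) ^+ 2 = (u ^+ 2 + v ^+ 2) * w ^+ 2 by ring.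
rewrite /h circle_speed// sqrtrM ?invr_ge0 ?ltW ?qsin2_gt0//.
by rewrite sqrtr_sqr ger0_norm ?pi_ge0// sqrtrV ?ltW ?qsin2_gt0//; rewrite /f; ring.
Qed.

Lemma l_circle_mean q : 0 <= q < 1 ->
  2 * pi * l <= rint 0 pi (fun s => ubar (a + circle_y q s) *
                           (Num.sqrt (1 - q ^+ 2 * sin s ^+ 2))^-1).
Proof.
move=> q01.
have cX : continuous (circle_x q) by move=> s; exact: has_deriv_continuous (der_circle_x q01 s).
have cY : continuous (circle_y q) by move=> s; exact: has_deriv_continuous (der_circle_y q01 s).
have cw : continuous (fun s : R => (Num.sqrt (1 - q ^+ 2 * sin s ^+ 2))^-1).
  apply: continuous_inv; first by move=> s; rewrite gt_eqF// sqrtr_gt0 qsin2_gt0.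
  apply: (continuous_compose (g := Num.sqrt)); first exact: sqrt_continuous.
  apply: continuous_sub; first exact: continuous_const.
  by apply: continuous_mul; [exact: continuous_const|exact: continuous_sinX].
pose F (z : R * R) := f (z.1 + circle_x q z.2, a + circle_y q z.2) *
  (Num.sqrt (1 - q ^+ 2 * sin z.2 ^+ 2))^-1.
have f1 : continuous (fun p : R * R => p.1) by move=> z; exact: cvg_fst.
have f2 : continuous (fun p : R * R => p.2) by move=> z; exact: cvg_snd.
have cF : continuous F.
  apply: continuous_mul; last exact: (continuous_compose cw f2).
  apply: continuous_comp2; first exact: lift_continuous.
    by apply: continuous_add => //; exact: continuous_compose.
  by apply: continuous_add; [exact: continuous_const|exact: continuous_compose].
have -> : 2 * pi * l = rint 0 (2 * pi) (fun=> l) by rewrite rint_cst ?subr0// ltW.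
have -> : rint 0 pi (fun s => ubar (a + circle_y q s) *
    (Num.sqrt (1 - q ^+ 2 * sin s ^+ 2))^-1) =
    rint 0 pi (fun s => rint 0 (2 * pi) (fun t => F (t, s))).
  apply: eq_rint => s _; rewrite -(ubar_shift (circle_x q s)) mulrC -rintZ.
    by apply: eq_rint => t _; rewrite /F /= mulrC.
  apply: (continuous_compose (g := fun x => f (x, a + circle_y q s))) => //.
  by apply: continuous_add => [x|]; [exact: cvg_id|exact: continuous_const].
rewrite -(rint_fubini _ _ _ _ cF); apply: le_rint; first exact: continuous_const.
  exact: (rint_continuous (F := fun z : R * R => F (z.2, z.1)) (continuous_swap cF)).
by move=> t _; exact: l_circle_le.
Qed.

Lemma l_sigma_tanh Y : 0 <= Y ->
  2 * l * tanh Y <= rint 0 Y (fun y => ubar (a + y) * sech y).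
Proof.
move=> Y0; set r := tanh Y.
have r0 : 0 <= r by exact: tanh_ge0.
have r1 : r < 1 by exact: tanh_lt1.
(* Clamping to [0, r] with r < 1 keeps the integrand continuous on the whole line, away from the
   singularity of [artanh] at 1. *)
pose cl (p : R) := Num.max 0 (Num.min r p).
have cl01 p : 0 <= cl p <= r by rewrite /cl le_max lexx ge_max r0 ge_min lexx.
have clE p : 0 <= p <= r -> cl p = p by move=> /andP[p0 pr]; rewrite /cl min_r// max_r.
have ccl : continuous cl.
  move=> p; apply: continuous_max; first exact: cst_continuous.
  by apply: continuous_min; [exact: cst_continuous|exact: cvg_id].
pose g p := ubar (a + artanh (cl p)) * (Num.sqrt (1 - cl p ^+ 2))^-1.
have cl1 p : -1 < cl p < 1 by have /andP[] := cl01 p; lra.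
have s0 p : 0 < 1 - cl p ^+ 2 by have /andP[] := cl01 p; nra.
have cg : continuous g.
  apply: continuous_mul.
    apply: (continuous_compose ubar_continuous); apply: continuous_add; first exact: continuous_const.
    move=> p; apply: (@continuous_comp _ _ _ cl artanh); first exact: ccl.
    exact: has_deriv_continuous (der_artanh (cl1 p)).
  apply: continuous_inv; first by move=> p; rewrite gt_eqF// sqrtr_gt0.
  apply: (continuous_compose (g := Num.sqrt)); first exact: sqrt_continuous.
  by apply: continuous_sub; [exact: continuous_const|exact: continuous_pow].
have r01 : 0 <= r <= 1 by rewrite r0 ltW.
have hb : 2 * pi * l * r <= pi * rint 0 r g.
  apply: hat_box => // q /andP[q0 qr].
  have q01 : 0 <= q < 1 by rewrite q0 (le_lt_trans qr).
  apply: le_trans (l_circle_mean q01) _.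
  apply: eq_ler; apply: eq_rint => s s0pi.
  have sin0 : 0 <= sin s by exact: sin_ge0_pi.
  have sin1 := sin_le1 s.
  by rewrite /g clE ?exprMn//; apply/andP; split; nra.
(* Under the substitution p = tanh y, the factor 1 / sqrt (1 - p^2) becomes cosh y and dp becomes
   sech^2 y dy. *)
have -> : rint 0 Y (fun y => ubar (a + y) * sech y) = rint 0 r g.
  have t0 : tanh 0 <= tanh Y by rewrite tanh0.
  have c2 : continuous (fun y : R => sech y ^+ 2) by apply: continuous_pow; exact: sech_continuous.
  have := rint_subst Y0 t0 cg c2 (der_tanh (R := R)); rewrite tanh0 => <-.
  apply: eq_rint => y /andP[y0 yY].
  have dtanh : tanh y <= tanh Y.
    rewrite -subr_ge0.
    have ct : {within `[y, Y], continuous tanh} by apply: continuous_subspaceT; exact: tanh_continuous.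
    have dt z : z \in `]y, Y[ -> is_derive z (1 : R) tanh (sech z ^+ 2) by move=> _; exact: der_tanh.
    have [z _ ->] := MVT_segment yY dt ct.
    by rewrite mulr_ge0 ?sqr_ge0 ?subr_ge0.
  rewrite /g clE ?tanh_ge0//.
  rewrite tanhK -sech2_tanh2 sqrtr_sqr gtr0_norm ?sech_gt0//.
  by field; rewrite gt_eqF ?sech_gt0.
rewrite -(ler_pM2l (pi_gt0 R)); apply: le_trans hb.
by apply: eq_ler; ring.
Qed.

(* Integration by parts against the decreasing weight [1 - B cosh y]. *)
Lemma l_sigma_weighted Y B : 0 <= Y -> 0 <= B <= sech Y ->
  2 * l * (tanh Y - B * gd Y) <= rint 0 Y (fun y => ubar (a + y) * (sech y - B)).
Proof.
move=> Y0 /andP[B0 BY].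
have cu : continuous (fun y => ubar (a + y)).
  apply: (continuous_compose ubar_continuous).
  by apply: continuous_add => [|x]; [exact: continuous_const|exact: cvg_id].
have cv : continuous (fun y => ubar (a + y) * sech y).
  by apply: continuous_mul => //; exact: sech_continuous.
have [V dV] := rint_prim cv.
have cB : continuous (fun y => ubar (a + y) * (sech y - B)).
  apply: continuous_mul => //; apply: continuous_sub; first exact: sech_continuous.
  exact: continuous_const.
(* The defect in [l_sigma_tanh], nonnegative at every height; the integration by parts transfers
   this sign to the weighted inequality. *)
pose W y := V y - V 0 - 2 * l * tanh y.
have W0 y : 0 <= y -> 0 <= W y.
  move=> y0; rewrite /W subr_ge0 -(rint_ftc y0 cv dV); exact: l_sigma_tanh.
have dW y : has_deriv W y (ubar (a + y) * sech y - 2 * l * sech y ^+ 2).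
  apply: der_eq.
    apply: der_add; first by apply: der_add; [exact: dV|exact: der_const].
    by apply: der_opp; apply: der_mul; [exact: der_const|exact: der_tanh].
  by rewrite /=; ring.
have cW : continuous W by move=> y; exact: has_deriv_continuous (dW y).
have cWs : continuous (fun y => W y * (B * sinh y)).
  apply: continuous_mul => //.
  by apply: continuous_mul; [exact: continuous_const|exact: sinh_continuous].
have cg : continuous (fun y : R => sech y ^+ 2 - B * sech y).
  apply: continuous_sub; first by apply: continuous_pow; exact: sech_continuous.
  by apply: continuous_mul; [exact: continuous_const|exact: sech_continuous].
have cl : continuous (fun y : R => 2 * l * (sech y ^+ 2 - B * sech y)).
  by apply: continuous_mul => //; exact: continuous_const.
have dE y : has_deriv (fun y => W y * (1 - B * cosh y)) y
    (ubar (a + y) * (sech y - B) - 2 * l * (sech y ^+ 2 - B * sech y) - W y * (B * sinh y)).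
  apply: der_eq.
    apply: der_mul; first exact: dW.
    apply: der_add; first exact: der_const.
    by apply: der_opp; apply: der_mul; [exact: der_const|exact: der_cosh].
  rewrite /= /sech; set U := ubar _; have := cosh_neq0 y; set c := cosh y => c0.
  by field; rewrite c0.
have dG y : has_deriv (fun y : R => 2 * l * (tanh y - B * gd y)) y
    (2 * l * (sech y ^+ 2 - B * sech y)).
  apply: der_eq.
    apply: der_mul; first exact: der_const.
    apply: der_add; first exact: der_tanh.
    by apply: der_opp; apply: der_mul; [exact: der_const|exact: der_gd].
  by rewrite /=; ring.
have cD : continuous (fun y => ubar (a + y) * (sech y - B) - 2 * l * (sech y ^+ 2 - B * sech y)).
  exact: continuous_sub.
have cE : continuous (fun y => ubar (a + y) * (sech y - B) - 2 * l * (sech y ^+ 2 - B * sech y) - W y * (B * sinh y)).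
  exact: continuous_sub.
have := rint_ftc Y0 cE dE; rewrite (rintB _ _ cD cWs) (rintB _ _ cB cl) (rint_ftc Y0 cl dG).
have W00 : W 0 = 0 by rewrite /W tanh0; ring.
have h1 : 0 <= rint 0 Y (fun y => W y * (B * sinh y)).
  apply: (@le_trans _ _ (rint 0 Y (fun=> 0))); first by rewrite rint_cst// mulr0.
  apply: le_rint => //; first exact: continuous_const.
  by move=> y /andP[y0 _]; rewrite mulr_ge0 ?W0// mulr_ge0// sinh_ge0.
(* The bound [B <= sech Y] is what makes the boundary term at [Y] nonnegative. *)
have h2 : 0 <= W Y * (1 - B * cosh Y).
  by rewrite mulr_ge0 ?W0// subr_ge0 -ler_pdivlMr ?cosh_gt0// mul1r.
rewrite W00 mul0r subr0 tanh0 gd0 !mulr0 subrr mulr0 subr0 => h; lra.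
Qed.

End Sigma.

End UpperBound.

(** * The angle w and the constants attached to it *)

Section Angle.
Context {R : realType}.
Implicit Types (x y w b : R).

Lemma atan_lipschitz x y : x <= y -> atan y - atan x <= y - x.
Proof.
move=> xy.
have ca : {within `[x, y], continuous (@atan R)}.
  by apply: continuous_subspaceT => z; exact: continuous_atan.
have da z : z \in `]x, y[ -> is_derive z 1 (@atan R) (1 + z ^+ 2)^-1.
  by move=> _; exact: is_derive1_atan.
have [z _ ->] := MVT_segment xy da ca.
by rewrite ler_piMl ?subr_ge0// invf_le1 ?ltr_wpDr ?sqr_ge0// lerDl sqr_ge0.
Qed.

(** The inverse function [atan] has slope at most 1. *)
Lemma tan_expands x y : 0 <= x < pi / 2 -> 0 <= y < pi / 2 -> x <= y ->
  y - x <= tan y - tan x.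
Proof.
move=> /andP[x0 x1] /andP[y0 y1] xy.
have pi0 := pi_gt0 R.
have lx : x \in `]-(pi / 2), pi / 2[ by rewrite in_itv/= x1 andbT (lt_le_trans _ x0)// oppr_lt0 divr_gt0.
have ly : y \in `]-(pi / 2), pi / 2[ by rewrite in_itv/= y1 andbT (lt_le_trans _ y0)// oppr_lt0 divr_gt0.
have txy : tan x <= tan y by rewrite leNgt ltr_tan// -leNgt.
by have := atan_lipschitz txy; rewrite !tanK.
Qed.

Lemma tan_ge w : 0 <= w < pi / 2 -> w <= tan w.
Proof.
move=> w0; have pi0 := pi_gt0 R; have /andP[w1 _] := w0.
have z : ((0 : R) <= 0) && ((0 : R) < pi / 2) by rewrite lexx /= divr_gt0.
by have := tan_expands z w0 w1; rewrite tan0 !subr0.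
Qed.

Lemma b_ofE w : b_of w = tan w + Num.sqrt (tan w ^+ 2 - w * tan w + w ^+ 2).
Proof. by []. Qed.

(** The height of the latitude [w] on the Mercator map, that is, the inverse Gudermannian
    function. *)
Definition y_of w : R := ln (tan (pi / 4 + w / 2)).

Variable w : R.
Hypothesis w_range : 0 < w < pi / 2.

Let w0 : 0 < w. Proof. by have /andP[] := w_range. Qed.

Lemma cosw_gt0 : 0 < cos w.
Proof.
have /andP[_ w1] := w_range.
by apply: cos_gt0_pihalf; rewrite w1 andbT (lt_trans _ w0)// oppr_lt0 divr_gt0 ?pi_gt0.
Qed.

Lemma sinw_gt0 : 0 < sin w. Proof. exact: sin_gt0_pihalf. Qed.

Lemma tanw_gt0 : 0 < tan w. Proof. by rewrite divr_gt0 ?sinw_gt0 ?cosw_gt0. Qed.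

Lemma tanw_ge : w <= tan w.
Proof. by apply: tan_ge; have /andP[/ltW -> ->] := w_range. Qed.

Lemma tanw2 : (cos w ^+ 2)^-1 = 1 + tan w ^+ 2.
Proof. by rewrite -cos2_tan2// gt_eqF// cosw_gt0. Qed.

Let u := pi / 4 + w / 2.

Let u_range : 0 < u < pi / 2.
Proof. by have /andP[? ?] := w_range; have := pi_gt0 R; rewrite /u; lra. Qed.

Let su : 0 < sin u. Proof. exact: sin_gt0_pihalf. Qed.

Let cu : 0 < cos u.
Proof.
have /andP[u0 u1] := u_range.
by apply: cos_gt0_pihalf; rewrite u1 andbT (lt_trans _ u0)// oppr_lt0 divr_gt0 ?pi_gt0.
Qed.

Let u2 : u *+ 2 = w + pi / 2.
Proof. by rewrite /u; field. Qed.

Let cos2u : sin u ^+ 2 - cos u ^+ 2 = sin w.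
Proof.
have := cos_mulr2n u; rewrite u2 cosDpihalf => e.
have := cos2Dsin2 u; have : cos u ^+ 2 *+ 2 = 2 * cos u ^+ 2 by rewrite mulr_natl.
lra.
Qed.

Let sin2u : 2 * (cos u * sin u) = cos w.
Proof. by rewrite mulr_natl -sin_mulr2n u2 sinDpihalf. Qed.

Let tu : 0 < tan u. Proof. exact: divr_gt0. Qed.

Let exp_y : expR (y_of w) = tan u. Proof. by rewrite lnK. Qed.

Let exp_Ny : expR (- y_of w) = (tan u)^-1. Proof. by rewrite expRN exp_y. Qed.

Lemma sinh_y_of : sinh (y_of w) = tan w.
Proof.
rewrite /sinh exp_y exp_Ny [in RHS]/tan -cos2u -sin2u /tan.
by field; rewrite !gt_eqF.
Qed.

Lemma cosh_y_of : cosh (y_of w) = (cos w)^-1.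
Proof.
rewrite /cosh exp_y exp_Ny -sin2u /tan.
transitivity ((cos u ^+ 2 + sin u ^+ 2) / (2 * (cos u * sin u))).
  by field; rewrite !gt_eqF.
by rewrite cos2Dsin2 div1r.
Qed.

Lemma sech_y_of : sech (y_of w) = cos w.
Proof. by rewrite /sech cosh_y_of invrK. Qed.

Lemma tanh_y_of : tanh (y_of w) = sin w.
Proof.
by rewrite /tanh sinh_y_of cosh_y_of invrK /tan divfK// gt_eqF// cosw_gt0.
Qed.

Lemma gd_y_of : gd (y_of w) = w.
Proof.
rewrite /gd sinh_y_of tanK// in_itv/=; have /andP[_ ->] := w_range.
by rewrite andbT (lt_trans _ w0)// oppr_lt0 divr_gt0 ?pi_gt0.
Qed.

Lemma y_of_gt0 : 0 < y_of w.
Proof.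
rewrite ltNge; apply/negP => y0.
have := @sinh_ge0 R (- y_of w); rewrite oppr_ge0 sinhN sinh_y_of => /(_ y0).
by rewrite oppr_ge0 leNgt tanw_gt0.
Qed.

Let disc_gt0 : 0 < tan w ^+ 2 - w * tan w + w ^+ 2.
Proof. by have := tanw_ge; have := w0; nra. Qed.

Lemma b_of_gt : w < b_of w.
Proof.
apply: le_lt_trans tanw_ge _; rewrite /b_of ltrDl sqrtr_gt0; exact: disc_gt0.
Qed.

Lemma b_of_gt0 : 0 < b_of w. Proof. exact: lt_trans b_of_gt. Qed.

Lemma two_b_gt : 0 < 2 * b_of w - w.
Proof. by have := b_of_gt; have := w0; lra. Qed.

(** The quadratic equation (b - t)^2 = t^2 - w t + w^2 satisfied by [b_of w], with t = tan w, is
    linear in t once t^2 cancels. *)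
Lemma tan_b_of : tan w = (b_of w ^+ 2 - w ^+ 2) / (2 * b_of w - w).
Proof.
apply: (mulIf (lt0r_neq0 two_b_gt)); rewrite divfK; last exact: lt0r_neq0 two_b_gt.
have : (b_of w - tan w) ^+ 2 = tan w ^+ 2 - w * tan w + w ^+ 2.
  by rewrite /b_of addrAC subrr add0r sqr_sqrtr// ltW.
move: (b_of w) (tan w) => b t e; lra.
Qed.

(** Between two neighbouring axes lie two half caps, each of height [y_of w], and a flat strip. *)
Lemma beta_ofE : beta_of w = 2 * y_of w + 2 * (b_of w - w) / cos w.
Proof. by rewrite /beta_of /b_of /y_of; field; rewrite gt_eqF// cosw_gt0. Qed.

(** The fraction of the flat value [cos w] that is charged to vertical lines; the remaining fraction
    is charged to horizontal lines. *)
Definition ratio := (b_of w - w) / (2 * b_of w - w).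

Lemma ratio_gt0 : 0 < ratio.
Proof. by apply: divr_gt0; [rewrite subr_gt0 b_of_gt|exact: two_b_gt]. Qed.

Lemma ratio_lt1 : ratio < 1.
Proof. by rewrite ltr_pdivrMr ?two_b_gt// mul1r; have := b_of_gt0; lra. Qed.

Lemma ratioE : ratio = (b_of w - w) / (2 * b_of w - w). Proof. by []. Qed.

Lemma sin_ratio : sin w - cos w * ratio * w = cos w * b_of w * ratio.
Proof.
have -> : sin w = cos w * tan w by rewrite /tan mulrC divfK// gt_eqF// cosw_gt0.
by rewrite tan_b_of /ratio; field; rewrite gt_eqF// two_b_gt.
Qed.

(** The left side is half the integral of the squared profile over [0, beta]. The factor 3 counts
    the three classes of curves, which contribute equally at the extremal metric. *)
Lemma area_ratio : sin w + (b_of w - w) * cos w = 3 * (cos w * b_of w * ratio).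
Proof.
have -> : sin w = cos w * tan w by rewrite /tan mulrC divfK// gt_eqF// cosw_gt0.
by rewrite tan_b_of /ratio; field; rewrite gt_eqF// two_b_gt.
Qed.

(** The polynomial under the fourth root is (2 b - w)^2 + (b^2 - w^2)^2, which is (2 b - w)^2 (1 +
    tan^2 w) by [tan_b_of], hence a perfect square. *)
Lemma bound_constantE : bound_constant (b_of w) w =
  Num.sqrt pi / (3 * Num.sqrt 3 * ratio * Num.sqrt (cos w * b_of w * ratio)).
Proof.
have c0 := cosw_gt0; have b0 := b_of_gt0; have r0 := ratio_gt0.
have bw : 0 < b_of w - w by rewrite subr_gt0 b_of_gt.
set b := b_of w in b0 bw *.
have Q : b ^+ 4 - 4 * b * w + w ^+ 2 + w ^+ 4 - 2 * b ^+ 2 * (- 2 + w ^+ 2) =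
    ((2 * b - w) / cos w) ^+ 2.
  rewrite expr_div_n tanw2 tan_b_of -/b; field; rewrite gt_eqF//; exact: two_b_gt.
have u0 : 0 < (2 * b - w) / cos w by rewrite divr_gt0//; exact: two_b_gt.
have P : (((2 * b - w) / cos w) ^+ 2) `^ (1 / 4) = Num.sqrt ((2 * b - w) / cos w).
  by rewrite -powR_mulrn ?ltW// -powRrM -powR12_sqrt ?ltW//; congr (_ `^ _); field.
have -> : bound_constant b w = Num.sqrt pi / (3 * Num.sqrt 3) *
    (Num.sqrt ((2 * b - w) / cos w) * (2 * b - w) / ((b - w) * Num.sqrt ((b - w) * b))).
  by rewrite -P -Q.
have e1 : Num.sqrt ((2 * b - w) / cos w) = Num.sqrt ((b - w) * b) / Num.sqrt (cos w * b * ratio).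
  have s2p : 0 < Num.sqrt (cos w * b * ratio).
    by rewrite sqrtr_gt0; apply: mulr_gt0 => //; exact: mulr_gt0.
  apply: (mulIf (lt0r_neq0 s2p)); rewrite divfK ?gt_eqF// -sqrtrM; last exact: ltW.
  by congr Num.sqrt; rewrite /ratio -/b; field; rewrite !gt_eqF//; exact: two_b_gt.
rewrite e1 -/b.
have s1 : Num.sqrt ((b - w) * b) != 0 by rewrite gt_eqF// sqrtr_gt0 mulr_gt0.
have s2 : Num.sqrt (cos w * b * ratio) != 0.
  by rewrite gt_eqF// sqrtr_gt0; apply: mulr_gt0 => //; exact: mulr_gt0.
have s3 : Num.sqrt 3 != 0 :> R by rewrite gt_eqF// sqrtr_gt0.
have rE : ratio = (b - w) / (2 * b - w) by [].
move: s2; set s := Num.sqrt (cos w * b * ratio) => s2; rewrite rE.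
by field; rewrite s1 s2 s3 !gt_eqF//; exact: two_b_gt.
Qed.

(** On the left is the area of the extremal metric to the power 3/2; on the right,
    [8 * pi * b_of w ^+ 2 * cos w ^+ 2] is the product of the coefficients pi cos w, 4 b cos w and 2
    b of the three lengths. The identity converts the inequality of means into the stated
    constant. *)
Lemma bound_constant_cube : Num.sqrt (12 * pi * (cos w * b_of w * ratio)) ^+ 3 =
  27 * ratio ^+ 3 * (8 * pi * b_of w ^+ 2 * cos w ^+ 2) * bound_constant (b_of w) w.
Proof.
have C0 := cosw_gt0; have b0 := b_of_gt0; have D0 := ratio_gt0; have pi0 := pi_gt0 R.
rewrite bound_constantE.
move: C0 b0 D0; set C := cos w; set b := b_of w; set D := ratio => C0 b0 D0.
have CbD : 0 < C * b * D by apply: mulr_gt0 => //; exact: mulr_gt0.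
set s := Num.sqrt (C * b * D).
have s0 : 0 < s by rewrite sqrtr_gt0.
have s2 : C * b * D = s ^+ 2 by rewrite sqr_sqrtr// ltW.
have sp2 : Num.sqrt pi ^+ 2 = pi :> R by rewrite sqr_sqrtr// ltW.
have s32 : Num.sqrt 3 ^+ 2 = 3 :> R by rewrite sqr_sqrtr.
have s30 : 0 < Num.sqrt 3 :> R by rewrite sqrtr_gt0.
have -> : Num.sqrt (12 * pi * (C * b * D)) = 2 * Num.sqrt 3 * Num.sqrt pi * s.
  rewrite -[RHS]ger0_norm ?mulr_ge0 ?sqrtr_ge0// -sqrtr_sqr; congr Num.sqrt.
  by rewrite !exprMn sp2 s32 -s2; ring.
have -> : 27 * D ^+ 3 * (8 * pi * b ^+ 2 * C ^+ 2) = 216 * (D * (s ^+ 4 * pi)).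
  have -> : s ^+ 4 = (C * b * D) ^+ 2 by rewrite s2; ring.
  ring.
rewrite -[X in s ^+ 4 * X]sp2; set p := Num.sqrt pi; set r := Num.sqrt 3 in s30 s32 *.
have -> : (2 * r * p * s) ^+ 3 = 8 * r ^+ 2 * r * (p * s) ^+ 3 by ring.
rewrite s32; transitivity (24 * r ^+ 2 * (p * s) ^+ 3 / r); first by field; rewrite gt_eqF.
by rewrite s32; move: D0; move: (D) => d d0; field; rewrite !gt_eqF.
Qed.

End Angle.

Opaque ratio b_of.

Lemma powR_three_halves (R : realType) (v : R) : 0 <= v -> v `^ (3 / 2) = Num.sqrt v ^+ 3.
Proof.
move=> v0; have -> : 3 / 2 = 2^-1 * 3%:R :> R by field.
by rewrite powRrM powR12_sqrt// powR_mulrn// sqrtr_ge0.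
Qed.

(** * From lengths to area *)

Section Inequality.
Context {R : realType}.
Variables (beta : R) (phi : klein beta -> R).
Hypothesis cphi : conformal_factor phi.

Let f (z : R * R) : R := phi (klein_proj beta z).
Let sq (y : R) : R := rint 0 (2 * pi) (fun x => f (x, y) ^+ 2).

Let cf : continuous f. Proof. exact: lift_continuous. Qed.
Let cf2 : continuous (fun z => f z ^+ 2). Proof. exact: continuous_pow. Qed.
Let csq : continuous sq.
Proof. exact: (rint_continuous (F := fun z => f z ^+ 2)). Qed.

(** [sigma] carries the lower half of the fundamental domain onto [pi, 2 pi] x [0, beta], so
    [0, 2 pi] x [0, beta] is a fundamental domain as well. *)
Lemma vol_sq : 0 <= beta -> vol phi = rint 0 beta sq.
Proof.
move=> b0; have pi0 := pi_ge0 R.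
pose h (y : R) := rint 0 pi (fun x => f (x, y) ^+ 2).
have ch : continuous h by exact: (rint_continuous (F := fun z => f z ^+ 2)).
have -> : vol phi = rint (- beta) beta h.
  by rewrite /h (@rint_prod_yx _ _ _ _ _ (fun z => f z ^+ 2)).
have chN : continuous (fun y => h (- y)) by apply: (continuous_compose ch); exact: opp_continuous.
have e : rint (- beta) 0 h = rint 0 beta (fun y => h (- y)) by rewrite rint_opp// oppr0.
have bN : - beta <= 0 by rewrite oppr_le0.
rewrite (rint_cat ch bN b0) e -(rintD _ _ chN ch); apply: eq_rint => y _.
have cy : continuous (fun x => f (x, y) ^+ 2) by exact: (continuous_fst (F := fun z => f z ^+ 2)).
have -> : h (- y) = rint pi (2 * pi) (fun x => f (x, y) ^+ 2).
  have -> : 2 * pi = pi + pi :> R by ring.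
  rewrite -[X in rint X](add0r pi) -(rint_shift _ _ _ cy); apply: eq_rint => x _.
  congr (_ ^+ 2); rewrite /f -(klein_proj_deck beta 1 0 (x, - y)) /deck /= expr1z.
  by congr (phi (klein_proj _ _)); congr pair; ring.
have pi2 : pi <= 2 * pi :> R by rewrite ler_peMl// ler1n.
by rewrite addrC -(rint_cat cy pi0 pi2).
Qed.

(** The integral of (f - c)^2 is nonnegative: a linearized Cauchy-Schwarz inequality, whose constant
    is chosen later in proportion to the extremal profile at height y. *)
Let sq_ge c y : 2 * c * ubar phi y - 2 * pi * c ^+ 2 <= sq y.
Proof.
have pi0 : 0 <= 2 * pi :> R by rewrite mulr_ge0// pi_ge0.
have cx : continuous (fun x => f (x, y)) by exact: continuous_fst.
have c1 : continuous (fun x => 2 * c * f (x, y)).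
  by apply: continuous_mul; [exact: continuous_const|exact: cx].
have c2 : continuous (fun _ : R => c ^+ 2) by exact: continuous_const.
have -> : 2 * c * ubar phi y - 2 * pi * c ^+ 2 = rint 0 (2 * pi) (fun x => 2 * c * f (x, y) - c ^+ 2).
  by rewrite (rintB _ _ c1 c2) (rintZ _ _ _ cx) (rint_cst _ pi0) subr0.
apply: le_rint; first exact: continuous_sub.
  exact: continuous_pow cx.
by move=> x _; have := sqr_ge0 (f (x, y) - c); lra.
Qed.

Lemma amgm3 (x y z : R) : 0 <= x -> 0 <= y -> 0 <= z ->
  27 * (x * y * z) <= (x + y + z) ^+ 3.
Proof.
move=> x0 y0 z0; rewrite -subr_ge0.
have -> : (x + y + z) ^+ 3 - 27 * (x * y * z) =
    (x + y + z) * ((x - y) ^+ 2 + (y - z) ^+ 2 + (z - x) ^+ 2) / 2 +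
    3 * (x * (y - z) ^+ 2 + y * (z - x) ^+ 2 + z * (x - y) ^+ 2) by field.
have h (u v t : R) : 0 <= t -> 0 <= t * (u - v) ^+ 2 by move=> t0; rewrite mulr_ge0// sqr_ge0.
apply: addr_ge0; last by apply: mulr_ge0 => //; apply: addr_ge0; [apply: addr_ge0|]; exact: h.
by rewrite divr_ge0// mulr_ge0 ?addr_ge0 ?sqr_ge0 ?addr_ge0.
Qed.

Lemma least_length_ge0 gamma : 0 <= least_length gamma phi.
Proof.
rewrite /least_length; set A := [set L | _].
(* The infimum of the empty set is 0 by convention. *)
have [->|/set0P A0] := eqVneq A set0; first by rewrite inf0.
by apply: lb_le_inf => // _ [c [_ _ _ ->]]; exact: curve_length_ge0.
Qed.

Variable w : R.
Hypothesis w_range : 0 < w < pi / 2.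
Hypothesis betaE : beta = beta_of w.

Let b := b_of w.
Let D := ratio w.
Let Y := y_of w.
Let C := cos w.
Let l := Num.min (l_sigma phi) (l_tsigma phi).
Let A0 := rint 0 Y (fun y => ubar phi y * sech y).
Let A1 := rint 0 Y (fun y => ubar phi (beta + y) * sech y).
Let F := rint Y (beta - Y) (ubar phi).

Let Y0 : 0 < Y. Proof. exact: y_of_gt0. Qed.
Let C0 : 0 < C. Proof. exact: cosw_gt0. Qed.
Let b0 : 0 < b. Proof. exact: b_of_gt0. Qed.
Let D0 : 0 < D. Proof. exact: ratio_gt0. Qed.
Let bw : 0 < b - w. Proof. by rewrite subr_gt0; exact: b_of_gt. Qed.
Let flat_width : beta - Y - Y = 2 * (b - w) / C.
Proof. by rewrite betaE beta_ofE// -/Y -/C -/b; ring. Qed.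
Let flat_gt0 : 0 < beta - Y - Y. Proof. by rewrite flat_width divr_gt0// mulr_gt0. Qed.
Let beta0 : 0 < beta. Proof. have := flat_gt0; have := Y0; lra. Qed.
Let i3 : Y <= beta - Y. Proof. by rewrite -subr_ge0 ltW. Qed.
Let d2 : 2 * b - w != 0. Proof. exact: lt0r_neq0 (two_b_gt w_range). Qed.
Let cu : continuous (ubar phi). Proof. exact: ubar_continuous. Qed.
Let cub : continuous (fun y => ubar phi (beta + y)).
Proof.
by apply: (continuous_compose cu); apply: continuous_add => [|x]; [exact: continuous_const|exact: cvg_id].
Qed.

Let split3 (g : R -> R) : continuous g ->
  rint 0 beta g = rint 0 Y g + rint Y (beta - Y) g + rint 0 Y (fun y => g (beta - y)).
Proof.
move=> cg; have f0 := flat_gt0; have y0 := Y0.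
have i1 : 0 <= beta - Y by lra.
have i2 : beta - Y <= beta by lra.
rewrite (rint_cat cg i1 i2) (rint_cat cg (ltW y0) i3); congr (_ + _).
have cgs : continuous (fun y => g (y + beta)).
  by apply: (continuous_compose cg); apply: continuous_add => [x|]; [exact: cvg_id|exact: continuous_const].
rewrite (@eq_rint _ 0 Y _ (fun y => g (- y + beta))); last by move=> y _; rewrite addrC.
by rewrite (rint_opp _ _ cgs) (rint_shift _ _ _ cg) oppr0 add0r [- Y + beta]addrC.
Qed.

(** The area of the extremal metric. *)
Let V0 := 4 * pi * (sin w + (b - w) * C).

(** The difference of the two sides is bounded below by the integral of the square of phi minus k
    times the extremal factor: [A0 + C * F + A1] is the integral of u against the profile over
    [0, beta]. *)
Let vol_ge k : 2 * k * (A0 + C * F + A1) - k ^+ 2 * V0 <= vol phi.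
Proof.
rewrite (vol_sq (ltW beta0)) (split3 csq).
have cs : continuous (fun y => ubar phi y * sech y).
  by apply: continuous_mul => //; exact: sech_continuous.
have cs1 : continuous (fun y => ubar phi (beta + y) * sech y).
  by apply: continuous_mul => //; exact: sech_continuous.
have cs2 : continuous (fun y : R => sech y ^+ 2) by apply: continuous_pow; exact: sech_continuous.
have It : rint 0 Y (fun y => sech y ^+ 2) = sin w.
  by rewrite (rint_ftc (ltW Y0) cs2 (der_tanh (R := R))) tanh0 subr0 tanh_y_of.
have cc g (r : R) : continuous g -> continuous (fun y : R => r * g y).
  by move=> cg; apply: continuous_mul => //; exact: continuous_const.
have lin (g h v : R -> R) (p q c d : R) : continuous g -> continuous h -> continuous v ->
    (forall y, p * g y - q * h y <= v y) -> p * rint c d g - q * rint c d h <= rint c d v.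
  move=> cg ch cv ghv; have c1 := cc g p cg; have c2 := cc h q ch.
  rewrite -(rintZ _ _ _ cg) -(rintZ _ _ _ ch) -(rintB _ _ c1 c2).
  by apply: le_rint => [||y _]; [exact: continuous_sub|exact: cv|exact: ghv].
have h0 : 2 * k * A0 - 2 * pi * k ^+ 2 * sin w <= rint 0 Y sq.
  rewrite -It; apply: (lin _ _ _ _ _ _ _ cs cs2 csq) => y.
  by apply: le_trans (sq_ge (k * sech y) y); apply: eq_ler; ring.
have csqb : continuous (fun y => sq (beta - y)).
  apply: (continuous_compose csq); apply: continuous_sub => [|x]; first exact: continuous_const.
  exact: cvg_id.
have h1 : 2 * k * A1 - 2 * pi * k ^+ 2 * sin w <= rint 0 Y (fun y => sq (beta - y)).
  rewrite -It; apply: (lin _ _ _ _ _ _ _ cs1 cs2 csqb) => y.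
  apply: le_trans (sq_ge (k * sech y) (beta - y)).
  by rewrite ubar_reflect//; apply: eq_ler; ring.
have hf : 2 * k * C * F - (2 * pi * (k * C) ^+ 2) * ((beta - Y - Y) * 1) <= rint Y (beta - Y) sq.
  have c1 : continuous (fun _ : R => 1 : R) by exact: continuous_const.
  rewrite -(rint_cst 1 i3); apply: (lin _ _ _ _ _ _ _ cu c1 csq) => y.
  by apply: le_trans (sq_ge (k * C) y); apply: eq_ler; ring.
have eV : k ^+ 2 * V0 = 2 * (2 * pi * k ^+ 2 * sin w) + (2 * pi * (k * C) ^+ 2) * ((beta - Y - Y) * 1).
  by rewrite flat_width /V0; field; rewrite gt_eqF.
by apply: le_trans (lerD (lerD h0 hf) h1); apply: eq_ler; rewrite eV; ring.
Qed.

Let calibration : D * (pi * C * l_v phi + 4 * b * C * l + 2 * b * l_h phi) <= A0 + C * F + A1.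
Proof.
have CbD : 0 < C * b * D by apply: mulr_gt0 => //; exact: mulr_gt0.
(* The share [C * D] charged to vertical lines must not exceed the smallest value of the profile,
   [sech Y = C], so that nonnegative weights are left for the other two classes. *)
have B0 : 0 <= C * D <= sech Y.
  rewrite sech_y_of// -/C; apply/andP; split; first exact/ltW/mulr_gt0.
  by rewrite ger_pMr//; exact/ltW/ratio_lt1.
have Y0' := ltW Y0.
have cB (g : R -> R) : continuous g -> continuous (fun y : R => g y * sech y).
  by move=> cg; apply: continuous_mul => //; exact: sech_continuous.
have sub (g : R -> R) : continuous g -> rint 0 Y (fun y => g y * (sech y - C * D)) =
    rint 0 Y (fun y => g y * sech y) - C * D * rint 0 Y g.
  move=> cg; have c1 : continuous (fun y => C * D * g y).
    by apply: continuous_mul; [exact: continuous_const|exact: cg].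
  rewrite -(rintZ _ _ _ cg) -(rintB _ _ (cB g cg) c1).
  by apply: eq_rint => y _; ring.
have e : tanh Y - C * D * gd Y = C * b * D.
  by rewrite tanh_y_of// gd_y_of// sin_ratio.
have l0 : 2 * l * (C * b * D) <= A0 - C * D * rint 0 Y (ubar phi).
  rewrite -(sub _ cu).
  have := l_sigma_weighted cphi 0 Y0' B0; rewrite e mul0r.
  under [X in _ <= X]eq_rint => y _ do rewrite add0r.
  apply: le_trans; apply: ler_wpM2r; first exact: ltW.
  rewrite ler_pM2l//.
  by rewrite -(sigma_deck beta) ge_min lexx.
have l1 : 2 * l * (C * b * D) <= A1 - C * D * rint 0 Y (fun y => ubar phi (beta - y)).
  rewrite (@eq_rint _ 0 Y (fun y => ubar phi (beta - y)) (fun y => ubar phi (beta + y))); last first.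
    by move=> y _; rewrite ubar_reflect.
  rewrite -(sub _ cub).
  have := l_sigma_weighted cphi 1 Y0' B0; rewrite e mul1r.
  apply: le_trans; apply: ler_wpM2r; first exact: ltW.
  rewrite ler_pM2l//.
  by rewrite -(tsigma_deck beta) ge_min lexx orbT.
have lv := l_v_mean beta0 cphi; rewrite (split3 cu) in lv.
have lh : (beta - Y - Y) * l_h phi <= F.
  rewrite -(rint_cst _ i3); apply: le_rint; [exact: continuous_const|exact: cu|].
  by move=> y _; exact: l_h_le.
have lh' : 2 * b * D * l_h phi <= (C - C * D) * F.
  apply: (@le_trans _ _ ((C - C * D) * ((beta - Y - Y) * l_h phi))).
    apply: eq_ler.
    by rewrite flat_width (ratioE w : D = (b - w) / (2 * b - w)); field; rewrite d2 gt_eqF.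
  by rewrite ler_wpM2l// subr_ge0 ger_pMr// ltW// ratio_lt1.
have CD : 0 < C * D by rewrite mulr_gt0.
rewrite -(ler_pM2l CD) in lv.
move: lv lh' l0 l1; rewrite -/F; set U0 := rint 0 Y _; set U1 := rint 0 Y (fun y => ubar phi (beta - y)).
move=> lv lh' l0 l1; lra.
Qed.

Lemma product_le : Num.min (l_sigma phi) (l_tsigma phi) * l_v phi * l_h phi
  <= bound_constant b w * vol phi `^ (3 / 2).
Proof.
have pi0 := pi_gt0 R.
pose P := A0 + C * F + A1.
have vk k : 2 * k * P - k ^+ 2 * V0 <= vol phi by exact: vol_ge.
have cal : D * (pi * C * l_v phi + 4 * b * C * l + 2 * b * l_h phi) <= P by exact: calibration.
have lv0 : 0 <= l_v phi := least_length_ge0 _.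
have lh0 : 0 <= l_h phi := least_length_ge0 _.
have l0 : 0 <= l by rewrite /l le_min !least_length_ge0.
have V0E : V0 = 12 * pi * (C * b * D) 
  by rewrite /V0 (area_ratio w_range : sin w + (b - w) * C = 3 * (C * b * D)); ring.
have CbD : 0 < C * b * D by apply: mulr_gt0 => //; exact: mulr_gt0.
have V0_gt0 : 0 < V0 by rewrite V0E; apply: mulr_gt0 => //; rewrite mulr_gt0.
have [C0' b0' D0' pi0'] : [/\ 0 <= C, 0 <= b, 0 <= D & 0 <= pi :> R] by split; exact: ltW.
have px : 0 <= pi * C * l_v phi by do ?apply: mulr_ge0.
have py : 0 <= 4 * b * C * l by do ?apply: mulr_ge0.
have pz : 0 <= 2 * b * l_h phi by do ?apply: mulr_ge0.
have P0 : 0 <= P.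
  by apply: le_trans cal; apply: mulr_ge0 => //; exact: addr_ge0 (addr_ge0 px py) pz.
have PV : P ^+ 2 <= vol phi * V0.
  (* This [k] maximizes the left side of [vk] and turns the family of linear bounds into the
     Cauchy-Schwarz inequality. *)
  have := vk (P / V0); rewrite -(ler_pM2r V0_gt0); apply: le_trans.
  by apply: eq_ler; field; rewrite gt_eqF.
have v0 : 0 <= vol phi.
  by rewrite -(ler_pM2r V0_gt0) mul0r (le_trans _ PV)// sqr_ge0.
have PV' : P <= Num.sqrt (vol phi) * Num.sqrt V0.
  by rewrite -sqrtrM// -[leLHS]ger0_norm// -sqrtr_sqr ler_wsqrtr.
have amgm : 27 * D ^+ 3 * (8 * pi * b ^+ 2 * C ^+ 2) * (l * l_v phi * l_h phi) <= P ^+ 3.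
  apply: (@le_trans _ _ ((D * (pi * C * l_v phi + 4 * b * C * l + 2 * b * l_h phi)) ^+ 3)); last first.
    by rewrite lerXn2r// nnegrE//; apply: mulr_ge0 => //; exact: addr_ge0 (addr_ge0 px py) pz.
  have := @amgm3 (pi * C * l_v phi) (4 * b * C * l) (2 * b * l_h phi).
  move=> /(_ px py pz).
  have D3 : 0 < D ^+ 3 by rewrite exprn_gt0.
  rewrite [(D * _) ^+ 3]exprMn => h; apply: le_trans (ler_wpM2l (ltW D3) h).
  by apply: eq_ler; ring.
have vE := powR_three_halves v0.
have K0 : 0 < 27 * D ^+ 3 * (8 * pi * b ^+ 2 * C ^+ 2).
  have D3 := exprn_gt0 3 D0; have b2 := exprn_gt0 2 b0; have C2 := exprn_gt0 2 C0.
  by apply: mulr_gt0; [exact: mulr_gt0|exact: mulr_gt0 (mulr_gt0 (mulr_gt0 (ltr0n _ 8) pi0) b2) C2].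
rewrite vE -(ler_pM2l K0); apply: le_trans amgm _.
apply: (@le_trans _ _ ((Num.sqrt (vol phi) * Num.sqrt V0) ^+ 3)).
  by rewrite lerXn2r// nnegrE// mulr_ge0 ?sqrtr_ge0.
rewrite [(_ * _) ^+ 3]exprMn V0E (bound_constant_cube w_range).
by apply: eq_ler; rewrite -/C -/b -/D; ring.
Qed.

End Inequality.

(** * Homotopy lifting *)

Section Lifting.
Context {R : realType}.
Implicit Types (p : R * R).

(** A retraction onto [0, 1]: composing with it makes a map that is continuous only within the
    interval, or the square, continuous everywhere. *)
Definition clamp (x : R) : R := Num.max 0 (Num.min 1 x).

Lemma clamp01 x : 0 <= clamp x <= 1.
Proof. by rewrite /clamp le_max lexx ge_max ler01 ge_min lexx. Qed.

Lemma clampE x : 0 <= x <= 1 -> clamp x = x.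
Proof. by move=> /andP[x0 x1]; rewrite /clamp min_r// max_r. Qed.

Lemma clamp_continuous : continuous clamp.
Proof.
move=> x; apply: continuous_max; first exact: cst_continuous.
by apply: continuous_min; [exact: cst_continuous|exact: cvg_id].
Qed.

Lemma within_comp_continuous (S T U : topologicalType) (K : set T) (H : T -> U)
    (r : S -> T) : {within K, continuous H} -> continuous r ->
  (forall x, K (r x)) -> continuous (H \o r).
Proof.
move=> /subspace_continuousP cH cr Kr x.
apply: (@cvg_comp _ _ _ r H _ (within K (nbhs (r x)))); last exact: cH.
move=> A KA; move: (cr x _ KA) => h.
by apply: (@filterS _ (nbhs x) _ _ _ _ h) => y hy; exact: hy (Kr y).
Qed.

Definition clamp2 p : R * R := (clamp p.1, clamp p.2).

Definition unit_square : set (R * R) := `[0, 1] `*` `[0, 1].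

Lemma clamp2_square p : unit_square (clamp2 p).
Proof. by split; rewrite /= in_itv/= clamp01. Qed.

Lemma clamp2E p : unit_square p -> clamp2 p = p.
Proof.
by case: p => x y [/=]; rewrite !in_itv/= => x01 y01; rewrite /clamp2 /= !clampE.
Qed.

Lemma clamp2_continuous : continuous clamp2.
Proof.
apply: continuous_pair; apply: (continuous_compose clamp_continuous).
  by move=> p; exact: cvg_fst.
by move=> p; exact: cvg_snd.
Qed.

Lemma angle_exists (a b : R) : a ^+ 2 + b ^+ 2 = 1 -> exists t, cos t = a /\ sin t = b.
Proof.
move=> ab; have a1 : -1 <= a <= 1 by have := sqr_ge0 b; nra.
have ca : cos (acos a) = a by rewrite acosK// in_itv.
have sa : sin (acos a) = `|b|.
  by rewrite sin_acos// -sqrtr_sqr -ab; congr Num.sqrt; ring.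
have [b0|b0] := leP 0 b.
  by exists (acos a); rewrite ca sa ger0_norm.
by exists (- acos a); rewrite cosN sinN ca sa ltr0_norm// opprK.
Qed.

(* A lift is obtained by adding up the small angles between consecutive values
   of the circle-valued map along the segment from the corner (0, 0) to p. *)
Lemma circle_lift (A B : R * R -> R) : continuous A -> continuous B ->
  (forall p, unit_square p -> A p ^+ 2 + B p ^+ 2 = 1) ->
  exists2 t : R * R -> R, continuous t &
    forall p, unit_square p -> cos (t p) = A p /\ sin (t p) = B p.
Proof.
move=> cA cB AB.
have cK : compact unit_square by apply: compact_setX; exact: segment_compact.
have half : 0 < 2^-1 :> R by rewrite invr_gt0.
have [d1 d10 dA] := compact_uniform_continuous cK (continuous_subspaceT cA) half.
have [d2 d20 dB] := compact_uniform_continuous cK (continuous_subspaceT cB) half.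
pose d := Num.min d1 d2.
have d0 : 0 < d by rewrite lt_min d10.
pose N := (Num.truncn d^-1).+1.
have N0 : 0 < N%:R :> R by rewrite ltr0n.
have Nd : N%:R^-1 < d by rewrite invf_plt ?posrE//; exact: truncnS_gt.
pose pt (j : nat) p : R * R := (j%:R / N%:R * clamp p.1, j%:R / N%:R * clamp p.2).
have ptK j p : (j <= N)%N -> unit_square (pt j p).
  move=> jN; have h x : 0 <= j%:R / N%:R * clamp x <= 1.
    have /andP[c0 c1] := clamp01 x.
    have j1 : j%:R / N%:R <= 1 :> R by rewrite ler_pdivrMr// mul1r ler_nat.
    have j0 : 0 <= j%:R / N%:R :> R by rewrite divr_ge0.
    by rewrite mulr_ge0//= mulr_ile1.
  by split; rewrite /= in_itv/= h.
have cpt j : continuous (pt j).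
  have c1 (g : R * R -> R) : continuous g -> continuous (fun p => j%:R / N%:R * clamp (g p)).
    move=> cg; apply: continuous_mul; first exact: continuous_const.
    exact: (continuous_compose clamp_continuous cg).
  apply: continuous_pair; apply: c1 => p; [exact: cvg_fst|exact: cvg_snd].
have near_pt j p : ball (pt j p) d (pt j.+1 p).
  have h x : `|j%:R / N%:R * clamp x - j.+1%:R / N%:R * clamp x| < d.
    have /andP[c0 c1] := clamp01 x.
    have -> : j%:R / N%:R * clamp x - j.+1%:R / N%:R * clamp x = - (clamp x / N%:R).
      by rewrite -[j.+1%:R]natr1; field; rewrite gt_eqF.
    have q0 : 0 <= clamp x / N%:R by rewrite divr_ge0// ltW.
      rewrite normrN (ger0_norm q0); apply: le_lt_trans Nd.
    by rewrite ler_pdivrMr// mulVf ?gt_eqF.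
  by split; rewrite -ball_normE /ball_ /=; exact: h.
(* Imaginary and real parts of conj(z_j) z_(j+1), for consecutive values z_j = A + iB. As the steps
   are short, the real part stays positive, so the angle between them is the arcsine of the
   imaginary part. *)
pose Im j p := A (pt j p) * B (pt j.+1 p) - B (pt j p) * A (pt j.+1 p).
pose Re j p := A (pt j p) * A (pt j.+1 p) + B (pt j p) * B (pt j.+1 p).
have cImR j p : (j < N)%N -> Im j p ^+ 2 + Re j p ^+ 2 = 1 /\ 0 < Re j p.
  move=> jN; have K1 := ptK j p (ltnW jN); have K2 := ptK j.+1 p jN.
  have e1 := AB _ K1; have e2 := AB _ K2.
  have nb : ball (pt j p) d1 (pt j.+1 p).
    by apply: le_ball (near_pt j p); rewrite /d ge_min lexx.
  have nb' : ball (pt j p) d2 (pt j.+1 p).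
    by apply: le_ball (near_pt j p); rewrite /d ge_min lexx orbT.
  have := dA _ _ K1 K2 nb; have := dB _ _ K1 K2 nb'.
  rewrite /Im /Re; move: e1 e2.
  set a := A _; set a' := A _; set b := B _; set b' := B _ => e1 e2.
  rewrite !ltr_norml => /andP[h1 h2] /andP[h3 h4]; split.
    transitivity ((a ^+ 2 + b ^+ 2) * (a' ^+ 2 + b' ^+ 2)); first by ring.
    by rewrite e1 e2 mulr1.
  have q1 : (b - b') ^+ 2 < 2^-1 ^+ 2 by move: h1 h2; set x := b - b' => h1 h2; nra.
  have q2 : (a - a') ^+ 2 < 2^-1 ^+ 2 by move: h3 h4; set x := a - a' => h3 h4; nra.
  have -> : a * a' + b * b' =
      ((a ^+ 2 + b ^+ 2) + (a' ^+ 2 + b' ^+ 2) - (a - a') ^+ 2 - (b - b') ^+ 2) / 2 by field.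
  by rewrite e1 e2; lra.
have Im1 j p : (j < N)%N -> -1 < Im j p < 1.
  move=> jN; have [e r] := cImR j p jN.
  by move: (Im j p) (Re j p) e r => x y e r; nra.
have cIm j : continuous (Im j).
  apply: continuous_sub; apply: continuous_mul; exact: (continuous_compose _ (cpt _)).
have [t0 [ct0 st0]] : exists t0, cos t0 = A (0, 0) /\ sin t0 = B (0, 0).
  by apply: angle_exists; apply: AB; split; rewrite /= in_itv/= lexx ler01.
pose th n p := t0 + \sum_(j < n) asin (Im j p).
have cth n : (n <= N)%N -> continuous (th n).
  move=> nN; apply: continuous_add; first exact: continuous_const.
  elim: n nN => [|n IH] nN.
    by under eq_fun do rewrite big_ord0; exact: continuous_const.
  under eq_fun do rewrite big_ord_recr.
  apply: continuous_add; first exact: IH (ltnW nN).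
  move=> p; apply: (@continuous_comp _ _ _ (Im n) asin); first exact: cIm.
  exact: continuous_asin (Im1 n p nN).
have thE n p : (n <= N)%N -> cos (th n p) = A (pt n p) /\ sin (th n p) = B (pt n p).
  elim: n => [|n IH] nN.
    by rewrite /th big_ord0 addr0 /pt !mul0r.
  have [IHc IHs] := IH (ltnW nN); have [e r] := cImR n p nN.
  have -> : th n.+1 p = th n p + asin (Im n p) by rewrite /th big_ord_recr/= addrA.
  have i1 : -1 <= Im n p <= 1 by have /andP[? ?] := Im1 n p nN; rewrite !ltW.
  have sI : sin (asin (Im n p)) = Im n p by rewrite asinK// in_itv.
  have cI : cos (asin (Im n p)) = Re n p.
    rewrite cos_asin// -[RHS]ger0_norm ?ltW// -sqrtr_sqr; congr Num.sqrt.
    by rewrite -e; ring.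
  rewrite cosD sinD IHc IHs sI cI /Im /Re.
  have e1 := AB _ (ptK n p (ltnW nN)).
  set a := A (pt n p) in e1 *; set b := B (pt n p) in e1 *.
  set a' := A _; set b' := B _; split.
    by transitivity ((a ^+ 2 + b ^+ 2) * a'); [ring|rewrite e1 mul1r].
  by transitivity ((a ^+ 2 + b ^+ 2) * b'); [ring|rewrite e1 mul1r].
exists (th N); first exact: cth.
move=> p Kp; have := thE N p (leqnn N).
rewrite /pt divff ?gt_eqF// !mul1r -/(clamp2 p) clamp2E//.
Qed.

Lemma sin_eq0_int (t : R) : sin t = 0 -> exists k : int, t = k%:~R * pi.
Proof.
move=> st; have pi0 := pi_gt0 R.
pose k := Num.floor (t / pi); exists k.
have k1 : k%:~R * pi <= t by rewrite -ler_pdivlMr//; exact: floor_le.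
have k2 : t < k%:~R * pi + pi.
  by rewrite -[X in _ + X]mul1r -mulrDl -ltr_pdivrMr// -intrD1; exact: floorD1_gt.
have sk (m : nat) : sin (m%:R * pi) = 0 :> R.
  elim: m => [|m IH]; first by rewrite mul0r sin0.
  by rewrite -natr1 mulrDl mul1r sinDpi IH oppr0.
have ski : sin (k%:~R * pi) = 0 :> R.
  case: (k) => m; first exact: sk.
  by rewrite NegzE mulrNz mulNr sinN sk oppr0.
have s0 : sin (t - k%:~R * pi) = 0 by rewrite sinB st ski mul0r mulr0 subrr.
apply/eqP; rewrite -subr_eq0; apply/negPn/negP => tk.
have : 0 < sin (t - k%:~R * pi).
  by apply: sin_gt0_pi; rewrite lt_neqAle eq_sym tk subr_ge0 k1 ltrBlDl.
by rewrite s0 ltxx.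
Qed.

Lemma cos_sin_inj (s t : R) : cos s = cos t -> sin s = sin t ->
  exists n : int, s = t + n%:~R * (2 * pi).
Proof.
move=> cst sst.
have e : cos (s - t) = 1 by rewrite cosB cst sst -!expr2 cos2Dsin2.
have : sin ((s - t) / 2) = 0.
  have := cos_mulr2n ((s - t) / 2); rewrite -[_ *+ 2]mulr_natr divfK// e.
  have := cos2Dsin2 ((s - t) / 2); move: (cos _) (sin _) => c' s' e1 e2.
  by apply/eqP; rewrite -sqrf_eq0; apply/eqP; move: e2; rewrite -[_ *+ 2]mulr_natr; lra.
move=> /sin_eq0_int[n en]; exists n.
by rewrite mulrCA -en; field.
Qed.

(** Otherwise the intermediate value theorem would yield a value half a step above the smaller end
    value, which parity excludes. *)
Lemma int_valued_const (f : R -> R) (T : R) : 0 < T -> continuous f ->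
  (forall s, 0 <= s <= 1 -> exists k : int, f s = k%:~R * T) -> f 0 = f 1.
Proof.
move=> T0 cf fk; apply/eqP/negPn/negP => f01.
have [k0 e0] := fk 0 ltac:(rewrite lexx ler01 //).
have [k1 e1] := fk 1 ltac:(rewrite lexx ler01 //).
have k01 : k0 != k1 by apply: contraNneq f01 => k01; rewrite e0 e1 k01.
pose v := (Num.min k0 k1)%:~R * T + T / 2.
have hv : Num.min (f 0) (f 1) <= v <= Num.max (f 0) (f 1).
  rewrite e0 e1 /v.
  have step (a b : int) : a < b -> a%:~R * T + T / 2 <= b%:~R * T.
    move=> ab; have : (a + 1)%:~R <= b%:~R :> R by rewrite ler_int -ltzD1 ltrD2r.
    by rewrite intrD -(ler_pM2r T0); lra.
  have [lt|gt|eq] := ltgtP k0 k1; last by rewrite eq eqxx in k01.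
    have := step _ _ lt; have : k0%:~R * T <= k1%:~R * T :> R by rewrite ler_pM2r// ler_int ltW.
    by move=> le h; rewrite min_l// max_r// h andbT lerDl divr_ge0 ?ltW.
  have := step _ _ gt; have : k1%:~R * T <= k0%:~R * T :> R by rewrite ler_pM2r// ler_int ltW.
  by move=> le h; rewrite min_r// max_l// h andbT lerDl divr_ge0 ?ltW.
have [s] := IVT ler01 (continuous_subspaceT cf) hv.
rewrite in_itv/= => s01; have [k ->] := fk s s01.
rewrite /v => e.
have : (k - Num.min k0 k1)%:~R * 2 = 1 :> R.
  by rewrite intrB; apply: (mulIf (lt0r_neq0 T0)); lra.
have -> : (k - Num.min k0 k1)%:~R * 2 = ((k - Num.min k0 k1) * 2)%:~R :> R by rewrite intrM.
move=> /eqP; rewrite -[1]/(1%:~R) eqr_int => /eqP; lia.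
Qed.

Variable beta : R.
Hypothesis beta_gt0 : 0 < beta.

Lemma klein_descend (g : R * R -> R) : continuous g ->
  (forall k n z, g (deck beta k n z) = g z) ->
  exists2 h : klein beta -> R, continuous h & forall z, h (klein_proj beta z) = g z.
Proof.
move=> cg gd.
have gE z w : klein_proj beta z = klein_proj beta w -> g z = g w.
  by move=> /klein_projP/klein_orbitP[k [n ->]].
pose h (q : klein beta) := g (repr q).
have hE z : h (klein_proj beta z) = g z.
  by apply: gE; rewrite /klein_proj reprK.
exists h => //; apply/quotient_continuous.
rewrite (_ : h \o _ = g)//; apply/funext => z; exact: hE.
Qed.

Lemma cos_deck (k : int) (x : R) : cos (x + k%:~R * pi) = (-1) ^ k * cos x.
Proof.
have nat_case (m : nat) (y : R) : cos (y + m%:R * pi) = (-1) ^+ m * cos y.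
  elim: m => [|m IH]; first by rewrite mul0r addr0 mul1r.
  by rewrite -natr1 mulrDl mul1r addrA cosDpi IH exprS mulN1r mulNr.
case: k => m; first exact: nat_case.
have := nat_case m.+1 (x + (Negz m)%:~R * pi).
rewrite NegzE mulrNz mulNr subrK => ->.
have -> : (-1) ^ (- (m.+1%:Z)) = ((-1) ^+ m.+1)^-1 :> R by rewrite -invr_expz.
by rewrite mulKf// expf_neq0// oppr_eq0 oner_eq0.
Qed.

Lemma sin_deck (k : int) (x : R) : sin (x + k%:~R * pi) = (-1) ^ k * sin x.
Proof.
by have := cos_deck k (x - pi / 2); rewrite -addrA [_ + k%:~R * pi]addrC addrA !cosBpihalf.
Qed.

(* By lifting circle-valued maps, through the embedding of the Klein bottle given by
   cos 2x, sin 2x, cos (pi y / beta), (cos x, sin x) sin (pi y / beta). *)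
Lemma homotopy_lift (H : R * R -> klein beta) :
  {within unit_square, continuous H} ->
  exists X Y : R * R -> R, [/\ continuous X, continuous Y &
    forall p, unit_square p -> klein_proj beta (X p, Y p) = H p].
Proof.
move=> cH; have pi0 := pi_gt0 R.
pose G := H \o clamp2.
have cG : continuous G.
  exact: (within_comp_continuous cH clamp2_continuous clamp2_square).
have f1 : continuous (fun p : R * R => p.1) by move=> q; exact: cvg_fst.
have f2 : continuous (fun p : R * R => p.2) by move=> q; exact: cvg_snd.
pose om := pi / beta.
have om2 (n : int) : om * (n%:~R * (2 * beta)) = n%:~R * 2%:~R * pi.
  by rewrite /om; field; rewrite gt_eqF.
have sgn2 (n : int) : (-1) ^ (n * 2) = 1 :> R.
  by rewrite mulrC -exprz_exp -[(-1) ^ 2]/((-1) ^+ 2) sqrrN expr1n exp1rz.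
have co (n : int) y : cos (om * (y + n%:~R * (2 * beta))) = cos (om * y).
  by rewrite mulrDr om2 -intrM cos_deck sgn2 mul1r.
have so (n : int) y : sin (om * (y + n%:~R * (2 * beta))) = sin (om * y).
  by rewrite mulrDr om2 -intrM sin_deck sgn2 mul1r.
have sg (k : int) y : cos (om * ((-1) ^ k * y)) = cos (om * y) /\
    sin (om * ((-1) ^ k * y)) = (-1) ^ k * sin (om * y).
  have [->|->] := @sign_cases R k; first by rewrite !mul1r.
  by rewrite !mulN1r mulrN cosN sinN.
have d2 (k : int) x : 2 * (x + k%:~R * pi) = 2 * x + (k * 2)%:~R * pi.
  by rewrite intrM; ring.
have ccos (g : R * R -> R) : continuous g -> continuous (fun z => cos (g z)).
  by move=> cg; apply: (continuous_compose (g := cos)) => //; exact: continuous_cos.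
have csin (g : R * R -> R) : continuous g -> continuous (fun z => sin (g z)).
  by move=> cg; apply: (continuous_compose (g := sin)) => //; exact: continuous_sin.
have cm (k : R) (g : R * R -> R) : continuous g -> continuous (fun z => k * g z).
  by move=> cg; apply: continuous_mul => //; exact: continuous_const.
have [h1 ch1 h1E] := @klein_descend (fun z => cos (2 * z.1))
  (ccos _ (cm 2 _ f1)) ltac:(by move=> k n z; rewrite /deck /= d2 cos_deck sgn2 mul1r).
have [h2 ch2 h2E] := @klein_descend (fun z => sin (2 * z.1))
  (csin _ (cm 2 _ f1)) ltac:(by move=> k n z; rewrite /deck /= d2 sin_deck sgn2 mul1r).
have [h3 ch3 h3E] := @klein_descend (fun z => cos (om * z.2))
  (ccos _ (cm om _ f2)) ltac:(by move=> k n z; rewrite /deck /= co (sg k _).1).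
have [h4 ch4 h4E] := @klein_descend (fun z => cos z.1 * sin (om * z.2))
  (continuous_mul (ccos _ f1) (csin _ (cm om _ f2)))
  ltac:(by move=> k n z; rewrite /deck /= so (sg k _).2 cos_deck mulrACA sign_sqr mul1r).
have [h5 ch5 h5E] := @klein_descend (fun z => sin z.1 * sin (om * z.2))
  (continuous_mul (csin _ f1) (csin _ (cm om _ f2)))
  ltac:(by move=> k n z; rewrite /deck /= so (sg k _).2 sin_deck mulrACA sign_sqr mul1r).
have rep (q : klein beta) : exists z, q = klein_proj beta z.
  by exists (repr q); rewrite /klein_proj reprK.
have cc (h : klein beta -> R) : continuous h -> continuous (fun p => h (G p)).
  by move=> ch; exact: continuous_compose.
have [t ct tE] := @circle_lift (fun p => h1 (G p)) (fun p => h2 (G p)) (cc _ ch1) (cc _ ch2)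
  ltac:(by move=> p _; have [z ->] := rep (G p); rewrite h1E h2E cos2Dsin2).
(* [t] lifts twice the first coordinate, so [X] agrees with the first coordinate of any
   representative up to a multiple of pi, which is the shift that deck transformations allow. *)
pose X p := 2^-1 * t p.
have cX : continuous X by exact: cm.
have XE p z : unit_square p -> G p = klein_proj beta z -> exists k : int, X p = z.1 + k%:~R * pi.
  move=> Kp e; have [] := tE p Kp; rewrite e h1E h2E => c' s'.
  have [k tk] := cos_sin_inj c' s'; exists k.
  by rewrite /X tk; field.
(* Rotating the last two coordinates of the embedding back by [X p] recovers the sine of the second
   angle up to the sign (-1)^k, the very sign by which the deck transformation of exponent [k]
   reflects. *)
pose S p := cos (X p) * h4 (G p) + sin (X p) * h5 (G p).
have cS : continuous S.
  apply: continuous_add; apply: continuous_mul; try exact: cc; [exact: ccos|exact: csin].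
have SE p z (k : int) : G p = klein_proj beta z -> X p = z.1 + k%:~R * pi ->
    S p = (-1) ^ k * sin (om * z.2).
  move=> e eX; rewrite /S e h4E h5E eX cos_deck sin_deck.
  transitivity ((-1) ^ k * sin (om * z.2) * (cos z.1 ^+ 2 + sin z.1 ^+ 2)); first by ring.
  by rewrite cos2Dsin2 mulr1.
have [t' ct' tE'] := @circle_lift (fun p => h3 (G p)) S (cc _ ch3) cS
  ltac:(by move=> p Kp; have [z e] := rep (G p); have [k eX] := XE p z Kp e;
    rewrite (SE p z k e eX) e h3E exprMn [((-1) ^ k) ^+ 2]expr2 sign_sqr mul1r cos2Dsin2).
exists X, (fun p => om^-1 * t' p); split => //; first exact: cm.
move=> p Kp; have GH : G p = H p by rewrite /G /= clamp2E.
have [z e] := rep (G p); have [k eX] := XE p z Kp e.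
have [] := tE' p Kp; rewrite (SE p z k e eX) e h3E -(sg k z.2).1 -(sg k z.2).2 => c' s'.
have [n en] := cos_sin_inj c' s'.
rewrite -GH e -(klein_proj_deck beta k n z); congr klein_proj.
have om0 : om != 0 by rewrite /om mulf_neq0 ?invr_neq0 ?gt_eqF.
rewrite /deck eX en; congr pair; apply: (mulfI om0).
by rewrite mulVKf// [RHS]mulrDr om2 mulrA [2 * pi]mulrC; ring.
Qed.

Lemma klein_proj_eq (z w : R * R) : klein_proj beta z = klein_proj beta w ->
  exists k n : int, w.1 = z.1 + k%:~R * pi /\ w.2 = (-1) ^ k * z.2 + n%:~R * (2 * beta).
Proof. by move=> /klein_projP/klein_orbitP[k [n ->]]; exists k, n. Qed.

(** * Displacement of a lift determined by the free homotopy class *)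

Section Endpoints.
Variables (g : R * R -> R * R) (c : R -> R * R).
Hypothesis cc1 : {within `[0, 1], continuous (fun s => (c s).1)}.
Hypothesis cc2 : {within `[0, 1], continuous (fun s => (c s).2)}.
Hypothesis hom : freely_homotopic (klein_proj beta \o c) (deck_loop beta g).

Let X1 s := (c (clamp s)).1.
Let Y1 s := (c (clamp s)).2.
Let cX1 : continuous X1.
Proof.
apply: (within_comp_continuous cc1 clamp_continuous) => s.
by rewrite /= in_itv/= clamp01.
Qed.
Let cY1 : continuous Y1.
Proof.
apply: (within_comp_continuous cc2 clamp_continuous) => s.
by rewrite /= in_itv/= clamp01.
Qed.

Let sq_pt (u s : R) : 0 <= u <= 1 -> 0 <= s <= 1 -> unit_square (u, s).
Proof. by move=> u01 s01; split; rewrite /= in_itv/=. Qed.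

Let i0 : 0 <= (0 : R) <= 1. Proof. by rewrite lexx ler01. Qed.
Let i1 : 0 <= (1 : R) <= 1. Proof. by rewrite lexx ler01. Qed.

Let lift : exists X Y : R * R -> R, [/\ continuous X, continuous Y,
  forall s, 0 <= s <= 1 -> klein_proj beta (c s) = klein_proj beta (X (0, s), Y (0, s)),
  forall s, 0 <= s <= 1 ->
    klein_proj beta (s * (g (0, 0)).1, s * (g (0, 0)).2) = klein_proj beta (X (1, s), Y (1, s))
  & forall u, 0 <= u <= 1 -> klein_proj beta (X (u, 0), Y (u, 0)) = klein_proj beta (X (u, 1), Y (u, 1))].
Proof.
have [H [cH H0 H1 Hu]] := hom; have [X [Y [cX cY XY]]] := homotopy_lift cH.
exists X, Y; split => // [s s01|s s01|u u01].
- rewrite XY; last exact: sq_pt.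
  by rewrite H0// in_itv.
- rewrite XY; last exact: sq_pt.
  rewrite H1 ?in_itv// /deck_loop; congr klein_proj; case: (g (0, 0)) => //.
- rewrite !XY; [|exact: sq_pt..].
  by rewrite Hu// in_itv.
Qed.

(** On the side u = 0 of the square the lifted homotopy differs from [c], and on the side u = 1 from
    the segment, by multiples of pi in the first coordinate; so does its end from its start for each
    u. Being continuous, these three differences are constant. *)
Lemma homotopic_dx : (c 1).1 - (c 0).1 = (g (0, 0)).1.
Proof.
have [X [Y [cX cY l0 l1 lu]]] := lift; have pi0 := pi_gt0 R.
have c_const : X (0, 0) - X1 0 = X (0, 1) - X1 1.
  apply: (@int_valued_const (fun s => X (0, s) - X1 s) _ pi0) => [|s s01].
    by apply: continuous_sub => //; exact: continuous_snd.
  have [k [n [e _]]] := klein_proj_eq (l0 s s01); exists k.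
  by rewrite /X1 clampE//= in e *; rewrite e addrC addKr.
have g_const : X (1, 0) - 0 * (g (0, 0)).1 = X (1, 1) - 1 * (g (0, 0)).1.
  apply: (@int_valued_const (fun s => X (1, s) - s * (g (0, 0)).1) _ pi0) => [|s s01].
    apply: continuous_sub; first exact: continuous_snd.
    by apply: continuous_mul => [s|]; [exact: cvg_id|exact: continuous_const].
  have [k [n [/= e _]]] := klein_proj_eq (l1 s s01); exists k.
  by rewrite e addrC addKr.
have u_const : X (0, 1) - X (0, 0) = X (1, 1) - X (1, 0).
  apply: (@int_valued_const (fun u => X (u, 1) - X (u, 0)) _ pi0) => [|u u01].
    by apply: continuous_sub; exact: continuous_fst.
  have [k [n [/= e _]]] := klein_proj_eq (lu u u01); exists k.
  by rewrite e addrC addKr.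
move: c_const g_const u_const; rewrite /X1 /= !clampE// => h1 h2 h3.
move: h1 h2 h3; rewrite mul0r mul1r; lra.
Qed.

(** A free homotopy class is only a conjugacy class, and conjugation by [sigma] reverses vertical
    translations: hence the absolute values. *)
Lemma homotopic_dy : (g (0, 0)).1 = 0 -> `|(c 1).2 - (c 0).2| = `|(g (0, 0)).2|.
Proof.
move=> g0; have dx := homotopic_dx; rewrite g0 in dx.
have [X [Y [cX cY l0 l1 lu]]] := lift; have pi0 := pi_gt0 R.
have b2 : 0 < 2 * beta by rewrite mulr_gt0.
have same_k (k k' : int) : k%:~R * pi = k'%:~R * pi :> R -> k = k'.
  by move=> /(mulIf (lt0r_neq0 pi0))/eqP; rewrite eqr_int => /eqP.
(* The numbers of half turns are shown to be constant before the second coordinates are compared;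
   only then is the sign (-1)^k fixed and the remaining difference a multiple of [2 * beta]. *)
have [kc [_ [/= ec _]]] := klein_proj_eq (l0 0 i0).
have [kg [_ [/= eg _]]] := klein_proj_eq (l1 0 i0).
have kcE s : 0 <= s <= 1 -> X (0, s) = (c s).1 + kc%:~R * pi.
  move=> s01; pose f t := X (0, clamp (s * t)) - X1 (s * t).
  have st t : 0 <= t <= 1 -> 0 <= s * t <= 1.
    move=> /andP[t0 t1]; have /andP[s0 s1] := s01.
    by rewrite mulr_ge0//= mulr_ile1.
  have cs : continuous (fun t : R => s * t) by exact: mulrl_continuous.
  have : f 0 = f 1.
    apply: (@int_valued_const f _ pi0) => [|t t01].
      apply: continuous_sub.
        apply: (continuous_compose (g := fun s => X (0, s))); first exact: continuous_snd.
        exact: (continuous_compose clamp_continuous).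
      exact: (continuous_compose cX1).
    have [k [n [/= e _]]] := klein_proj_eq (l0 _ (st t t01)); exists k.
    by rewrite /f /X1 clampE ?st// e addrC addKr.
  rewrite /f /X1 mulr0 mulr1 !clampE//= ec /=; lra.
have kgE s : 0 <= s <= 1 -> X (1, s) = kg%:~R * pi.
  move=> s01; pose f t := X (1, s * t).
  have st t : 0 <= t <= 1 -> 0 <= s * t <= 1.
    move=> /andP[t0 t1]; have /andP[s0 s1] := s01.
    by rewrite mulr_ge0//= mulr_ile1.
  have cs : continuous (fun t : R => s * t) by exact: mulrl_continuous.
  have : f 0 = f 1.
    apply: (@int_valued_const f _ pi0) => [|t t01].
      by apply: (continuous_compose (g := fun s => X (1, s))) => //; exact: continuous_snd.
    have [k [n [/= e _]]] := klein_proj_eq (l1 _ (st t t01)); exists k.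
    by rewrite /f e g0 mulr0 add0r.
  by rewrite /f mulr0 mulr1 => <-; rewrite eg /= mul0r add0r.
(* The difference is constant in u, and vanishes at u = 1 by [kgE]; the path in [f] leads from u to
   1. *)
have kuE u : 0 <= u <= 1 -> X (u, 1) = X (u, 0).
  move=> u01; pose f t := X (clamp (u + (1 - u) * t), 1) - X (clamp (u + (1 - u) * t), 0).
  have ut t : 0 <= t <= 1 -> 0 <= u + (1 - u) * t <= 1.
    by move=> /andP[t0 t1]; have /andP[u0 u1] := u01; apply/andP; split; nra.
  have cu : continuous (fun t : R => clamp (u + (1 - u) * t)).
    apply: (continuous_compose clamp_continuous); apply: continuous_add; first exact: continuous_const.
    exact: mulrl_continuous.
  have : f 0 = f 1.
    apply: (@int_valued_const f _ pi0) => [|t t01].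
      by apply: continuous_sub; [apply: (continuous_compose (g := fun u => X (u, 1))) => //|
        apply: (continuous_compose (g := fun u => X (u, 0))) => //]; exact: continuous_fst.
    have [k [n [/= e _]]] := klein_proj_eq (lu _ (ut t t01)); exists k.
    by rewrite /f clampE ?ut// e addrC addKr.
  rewrite /f !mulr0 !mulr1 addr0 subrKC !clampE// (kgE 1 i1) (kgE 0 i0) subrr.
  by move=> /eqP; rewrite subr_eq0 => /eqP.
have c_const : Y (0, 0) - (-1) ^ kc * Y1 0 = Y (0, 1) - (-1) ^ kc * Y1 1.
  apply: (@int_valued_const (fun s => Y (0, s) - (-1) ^ kc * Y1 s) _ b2) => [|s s01].
    apply: continuous_sub; first exact: continuous_snd.
    by apply: continuous_mul => //; exact: continuous_const.
  have [k [n [/= e e']]] := klein_proj_eq (l0 s s01); exists n.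
  have -> : kc = k by apply: same_k; move: e; rewrite kcE//; lra.
  by rewrite /Y1 clampE// e' addrC addKr.
have g_const : Y (1, 0) - (-1) ^ kg * (0 * (g (0, 0)).2) = Y (1, 1) - (-1) ^ kg * (1 * (g (0, 0)).2).
  apply: (@int_valued_const (fun s => Y (1, s) - (-1) ^ kg * (s * (g (0, 0)).2)) _ b2) => [|s s01].
    apply: continuous_sub; first exact: continuous_snd.
    apply: continuous_mul; first exact: continuous_const.
    by apply: continuous_mul => [s|]; [exact: cvg_id|exact: continuous_const].
  have [k [n [/= e e']]] := klein_proj_eq (l1 s s01); exists n.
  have -> : kg = k by apply: same_k; move: e; rewrite kgE// g0 mulr0 add0r.
  by rewrite e' addrC addKr.
have u_const : Y (0, 1) - Y (0, 0) = Y (1, 1) - Y (1, 0).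
  apply: (@int_valued_const (fun u => Y (u, 1) - Y (u, 0)) _ b2) => [|u u01].
    by apply: continuous_sub; exact: continuous_fst.
  have [k [n [/= e e']]] := klein_proj_eq (lu u u01); exists n.
  have k0 : k = 0.
    by apply: same_k; move: e; rewrite kuE// mul0r -[X in X = _]addr0 => /addrI.
  by rewrite e' k0 expr0z mul1r addrC addKr.
move: c_const g_const u_const; rewrite /Y1 /= !clampE// mul0r mul1r mulr0 => h1 h2 h3.
have : (-1) ^ kc * ((c 1).2 - (c 0).2) = (-1) ^ kg * (g (0, 0)).2 by move: h1 h2 h3; lra.
have [->|->] := @sign_cases R kc; have [->|->] := @sign_cases R kg; rewrite ?mul1r ?mulN1r.
- by move->.
- by move->; rewrite normrN.
- by move/(congr1 Num.norm); rewrite normrN.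
- by move/(congr1 Num.norm); rewrite !normrN.
Qed.

End Endpoints.

End Lifting.

(** * Lower bounds for lengths by calibrations *)

Section Pieces.
Context {R : realType}.
Implicit Types (a b c s v : R) (f g h k x y : R -> R).

(** Subdivisions are presented as binary trees, so that cutting and merging them are inductions that
    manipulate no list of break points. *)
Inductive pieces1 x : R -> R -> Prop :=
| piece1 a b h h' : a < b -> C1 h h' -> (forall s, a <= s <= b -> x s = h s) -> pieces1 x a b
| piece1_cat a b c : pieces1 x a b -> pieces1 x b c -> pieces1 x a c.

Inductive pieces2 x y : R -> R -> Prop :=
| piece2 a b h h' k k' : a < b -> C1 h h' -> C1 k k' ->
    (forall s, a <= s <= b -> x s = h s) -> (forall s, a <= s <= b -> y s = k s) ->
    pieces2 x y a b
| piece2_cat a b c : pieces2 x y a b -> pieces2 x y b c -> pieces2 x y a c.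

Lemma pieces1_lt x a b : pieces1 x a b -> a < b.
Proof. by elim=> // {}a {}b c _ ab _ bc; exact: lt_trans bc. Qed.

Lemma pieces1_sub x a b c d : pieces1 x a b -> a <= c -> c < d -> d <= b -> pieces1 x c d.
Proof.
move=> p; elim: p c d => {a b} [a b h h' _ C xh|a m b pa IHa pb IHb] c d ac cd db.
  apply: piece1 cd C _ => s /andP[s1 s2]; apply: xh.
  by rewrite (le_trans ac)// (le_trans s2).
have [dm|md] := leP d m; first exact: IHa.
have [mc|cm] := leP m c; first exact: IHb.
by apply: (@piece1_cat _ _ m); [exact: IHa|apply: IHb => //].
Qed.

Lemma pieces_merge1 x h h' y a b : C1 h h' -> pieces1 y a b ->
  (forall s, a <= s <= b -> x s = h s) -> pieces2 x y a b.
Proof.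
move=> C; elim=> {a b} [a b k k' ab C' yk|a m b pa IHa pb IHb] xh.
  exact: piece2 ab C C' xh yk.
have am := pieces1_lt pa; have mb := pieces1_lt pb.
apply: (@piece2_cat _ _ _ m); [apply: IHa|apply: IHb] => s /andP[s1 s2]; apply: xh.
  by rewrite s1 (le_trans s2)// ltW.
by rewrite s2 (le_trans (ltW am)).
Qed.

(** A common refinement: the second subdivision is restricted to each piece of the first. *)
Lemma pieces_merge x y a b : pieces1 x a b -> pieces1 y a b -> pieces2 x y a b.
Proof.
elim=> {a b} [a b h h' _ C xh|a m b pa IHa pb IHb] q.
  exact: pieces_merge1 C q xh.
apply: (@piece2_cat _ _ _ m).
  apply: IHa; apply: pieces1_sub q _ (pieces1_lt pa) _ => //.
  exact/ltW/(pieces1_lt pb).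
apply: IHb; apply: pieces1_sub q _ (pieces1_lt pb) _ => //.
exact/ltW/(pieces1_lt pa).
Qed.

Lemma continuously_differentiable_C1 h : continuously_differentiable h -> C1 h (derive1 h).
Proof.
move=> [dh ch]; split => // s; rewrite derive1E; exact: derivableP.
Qed.

Lemma piecewise_C1_pieces x : piecewise_C1 x -> pieces1 x 0 1.
Proof.
move=> [_ [s [[p /eqP l] H]]].
suff gen a (t : seq R) : t != [::] -> path <%R a t ->
    (forall i, (i < size t)%N -> exists2 h : R -> R, continuously_differentiable h &
        {in `[nth 0 (a :: t) i, nth 0 t i], x =1 h}) -> pieces1 x a (last a t).
  rewrite -l; apply: gen => //.
  by apply: contra_eq_neq l => ->/=; rewrite eq_sym oner_eq0.
elim: t a => [//|b t IH] a _ /= /andP[ab pt] K.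
have p1 : pieces1 x a b.
  have [h dh xh] := K 0%N isT.
  apply: piece1 ab (continuously_differentiable_C1 dh) _ => u uab.
  by apply: xh; rewrite /= in_itv.
case: t pt K IH => [//|b' t] pt K IH.
apply: piece1_cat p1 _; apply: IH => // i it.
exact: (K i.+1).
Qed.

(** The condition that the gradient of U has norm at most rho, stated along curves so that only
    derivatives in one variable occur. *)
Definition calibrates (U rho : R * R -> R) := forall h h' k k', C1 h h' -> C1 k k' ->
  exists2 V' : R -> R, continuous V' & forall s,
    has_deriv (fun s => U (h s, k s)) s (V' s) /\
    V' s <= rho (h s, k s) * Num.sqrt (h' s ^+ 2 + k' s ^+ 2).

Lemma derive1_piece x h h' a b s : C1 h h' -> (forall s, a <= s <= b -> x s = h s) ->
  a < s < b -> derive1 x s = h' s.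
Proof.
move=> C xh /andP[sa sb]; rewrite derive1E.
rewrite (near_eq_derive (g := h)); first by have [_ d] := C; have [_ ->] := d s.
have : \forall t \near s, t \in `]a, b[ by apply: near_in_itvoo; rewrite in_itv/= sa.
by apply: filterS => t; rewrite in_itv/= => /andP[t1 t2]; apply: xh; rewrite !ltW.
Qed.

Lemma curve_length_calibrated beta (phi : klein beta -> R) (U : R * R -> R)
    (c : R -> R * R) :
  conformal_factor phi -> calibrates U (fun z => phi (klein_proj beta z)) ->
  piecewise_C1_curve c -> U (c 1) - U (c 0) <= curve_length phi c.
Proof.
move=> [cphi _] cal [/piecewise_C1_pieces p1 /piecewise_C1_pieces p2].
have p := pieces_merge p1 p2.
suff gen a b : pieces2 (fun s => (c s).1) (fun s => (c s).2) a b ->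
    integral_ge (fun s => phi (klein_proj beta (c s)) *
     Num.sqrt (derive1 (fun u => (c u).1) s ^+ 2 + derive1 (fun u => (c u).2) s ^+ 2)) a b
     (U (c b) - U (c a)).
  by have [] := gen _ _ p.
elim=> {a b p} [a b h h' k k' ab Ch Ck xh yk|a m b _ IHa _ IHb]; last first.
  have := integral_ge_cat IHa IHb.
  by rewrite (_ : U (c m) - U (c a) + (U (c b) - U (c m)) = U (c b) - U (c a))//; ring.
have cE s : a <= s <= b -> c s = (h s, k s).
  by move=> sab; rewrite [c s]surjective_pairing (xh s sab) (yk s sab).
have [V' cV' HV] := cal _ _ _ _ Ch Ck.
pose g s := phi (klein_proj beta (h s, k s)) * Num.sqrt (h' s ^+ 2 + k' s ^+ 2).
have cg : continuous g.
  apply: continuous_mul.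
    apply: (continuous_compose cphi); apply: (continuous_compose (@klein_proj_continuous R beta)).
    by apply: continuous_pair; [exact: C1_continuous Ch|exact: C1_continuous Ck].
  apply: (continuous_compose (@sqrt_continuous R)).
  by apply: continuous_add; apply: continuous_pow; [exact: Ch.1|exact: Ck.1].
apply: (integral_ge_piece ab cg) => [s sab|].
  rewrite (derive1_piece Ch xh sab) (derive1_piece Ck yk sab) cE//.
  by have /andP[? ?] := sab; rewrite !ltW.
have ab' := ltW ab; rewrite cE ?lexx ?ab'// cE ?lexx ?ab'//.
have d s : has_deriv (fun s => U (h s, k s)) s (V' s) by have [] := HV s.
rewrite -(rint_ftc (ltW ab) cV' d); apply: le_rint => // s _.
by have [] := HV s.
Qed.

End Pieces.

(** * Calibrations for the three kinds of classes *)

Section LengthBelow.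
Context {R : realType}.
Variables (beta : R) (phi : klein beta -> R).
Hypothesis beta_gt0 : 0 < beta.
Hypothesis cphi : conformal_factor phi.

Let rho (z : R * R) : R := phi (klein_proj beta z).

Let rho_gt0 z : 0 < rho z. Proof. exact: cphi.2. Qed.

Lemma least_length_ge k n v :
  (forall c, piecewise_C1_curve c -> klein_proj beta (c 0) = klein_proj beta (c 1) ->
    freely_homotopic (klein_proj beta \o c) (deck_loop beta (deck beta k n)) ->
    v <= curve_length phi c) -> v <= least_length (deck beta k n) phi.
Proof.
move=> H; apply: lb_le_inf; last by move=> _ [c [cp ce ch ->]]; exact: H.
(* A competitor is exhibited because the infimum over an empty set would be 0. *)
pose g := deck beta k n (0, 0).
have C a : C1 (fun s : R => s * a) (fun=> a).
  split; first exact: continuous_const.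
  by move=> s; apply: der_eq; [deriv|rewrite /=; ring].
have c0 : (0 * g.1, 0 * g.2) = (0, 0) :> R * R by rewrite !mul0r.
have c1 : (1 * g.1, 1 * g.2) = g by rewrite !mul1r -surjective_pairing.
exists (curve_length phi (fun s => (s * g.1, s * g.2))), (fun s => (s * g.1, s * g.2)); split => //.
- by split; exact: C1_piecewise (C _).
- by rewrite c0 c1 klein_proj_deck.
- apply: freely_homotopic_deck; last by rewrite c0 c1.
  by apply: continuous_pair; exact: C1_continuous (C _).
Qed.

Lemma calibrates_fun (U : R * R -> R) (Ux Uy : R * R -> R) :
  continuous Ux -> continuous Uy ->
  (forall h h' k k', C1 h h' -> C1 k k' -> forall s,
    has_deriv (fun s => U (h s, k s)) s (Ux (h s, k s) * h' s + Uy (h s, k s) * k' s)) ->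
  (forall z, Ux z ^+ 2 + Uy z ^+ 2 <= rho z ^+ 2) -> calibrates U rho.
Proof.
move=> cx cy dU le h h' k k' Ch Ck.
exists (fun s => Ux (h s, k s) * h' s + Uy (h s, k s) * k' s).
  have cc : continuous (fun s => (h s, k s)).
    by apply: continuous_pair; [exact: C1_continuous Ch|exact: C1_continuous Ck].
  apply: continuous_add; apply: continuous_mul.
  - exact: (continuous_compose cx cc).
  - exact: Ch.1.
  - exact: (continuous_compose cy cc).
  - exact: Ck.1.
move=> s; split; first exact: dU.
move: (le (h s, k s)) (ltW (rho_gt0 (h s, k s))).
set r := rho _; set u := Ux _; set v := Uy _; set p := h' s; set q := k' s => uv r0.
have rs : Num.sqrt (r ^+ 2) = r by rewrite sqrtr_sqr ger0_norm.
rewrite -[X in _ <= X * _]rs -sqrtrM ?sqr_ge0//.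
apply: le_trans (ler_norm _) _; rewrite -sqrtr_sqr; apply: ler_wsqrtr.
apply: (@le_trans _ _ ((u ^+ 2 + v ^+ 2) * (p ^+ 2 + q ^+ 2))).
  by rewrite -subr_ge0; have -> : (u ^+ 2 + v ^+ 2) * (p ^+ 2 + q ^+ 2) - (u * p + v * q) ^+ 2 =
    (u * q - v * p) ^+ 2 by [ring]; exact: sqr_ge0.
by apply: ler_wpM2r => //; rewrite addr_ge0 ?sqr_ge0.
Qed.

Lemma l_h_ge k : 0 <= k -> (forall z, k <= rho z) -> 2 * pi * k <= l_h phi.
Proof.
move=> k0 kr; rewrite /l_h (sigma2_deck beta); apply: least_length_ge => c cp _ ch.
have := @homotopic_dx _ _ beta_gt0 _ _ cp.1.1 ch.
rewrite /deck /= add0r => e.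
have cal : calibrates (fun z => k * z.1) rho.
  apply: (@calibrates_fun _ (fun=> k) (fun=> 0)).
  - exact: continuous_const.
  - exact: continuous_const.
  - move=> h h' q q' [_ dh] _ s; apply: der_eq; first by deriv.
    by rewrite /=; ring.
  - by move=> z; rewrite expr0n addr0 lerXn2r// nnegrE ltW.
apply: le_trans (curve_length_calibrated cphi cal cp).
by rewrite /= -mulrBr e; apply: eq_ler; rewrite mulrC.
Qed.

Lemma l_v_ge (f F : R -> R) v : continuous f -> (forall z, f z.2 = rho z) ->
  (forall y, has_deriv F y (f y)) -> (forall y, F (y + 2 * beta) = F y + v) ->
  v <= l_v phi.
Proof.
move=> cf fr dF Fv; rewrite /l_v (vtrans_deck beta); apply: least_length_ge => c cp _ ch.
have := @homotopic_dy _ _ beta_gt0 _ _ cp.1.1 cp.2.1 ch.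
rewrite /deck /= mul0r addr0 mulr0 add0r mul1r => /(_ erefl).
rewrite [X in _ = X]gtr0_norm ?mulr_gt0// => e.
(* A curve of the class may go up or down, so the primitive [F] is used with either sign. *)
have cal t : t ^+ 2 = 1 -> calibrates (fun z => t * F z.2) rho.
  move=> t2; apply: (@calibrates_fun _ (fun=> 0) (fun z => t * f z.2)).
  - exact: continuous_const.
  - apply: continuous_mul; first exact: continuous_const.
    by apply: (continuous_compose cf) => z; exact: cvg_snd.
  - move=> h h' q q' _ [_ dq] s; apply: der_eq; first by deriv.
    by rewrite /=; ring.
  - by move=> z; rewrite expr0n add0r exprMn t2 mul1r fr.
have [s s2 se] : exists2 t : R, t ^+ 2 = 1 & t * F (c 1).2 - t * F (c 0).2 = v.
  have [d|d] := leP 0 ((c 1).2 - (c 0).2).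
    exists 1; first by rewrite expr1n.
    rewrite ger0_norm// in e.
    by rewrite !mul1r (_ : (c 1).2 = (c 0).2 + 2 * beta) ?Fv; [ring|rewrite -e; ring].
  exists (-1); first by rewrite sqrrN expr1n.
  rewrite ltr0_norm// in e.
  by rewrite !mulN1r (_ : (c 0).2 = (c 1).2 + 2 * beta) ?Fv; [ring|rewrite -e; ring].
by rewrite -se; exact: (curve_length_calibrated cphi (cal s s2) cp).
Qed.

(* Along a curve of the class of a glide reflection with axis y = n beta, the image under
   the Mercator map of axis y = n beta goes from a point of the sphere to its antipode; the
   calibrating functions are asin (d F), where F is a linear form on the sphere and d < 1. *)
Lemma l_glide_ge n : (forall m z, sech (z.2 - m%:~R * beta) <= rho z) ->
  pi <= least_length (deck beta 1 n) phi.
Proof.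
move=> sr; have pi0 := pi_gt0 R; apply: least_length_ge => c cp ce ch.
have := @homotopic_dx _ _ beta_gt0 _ _ cp.1.1 ch.
rewrite /deck /= mul1r add0r => e.
have [k [m [e1 e2]]] := klein_proj_eq ce.
have k1 : k = 1.
  apply/eqP; rewrite -(eqr_int R); apply/eqP; apply: (mulIf (lt0r_neq0 pi0)).
  by rewrite mul1r -[RHS]e e1 addrAC subrr add0r.
rewrite {}k1 expr1z mulN1r mul1r in e1 e2.
(* The curve closes up through the glide reflection of axis y = m beta. The free homotopy class
   fixes that transformation only up to conjugation, so [m] may differ from [n]; the hypothesis
   covers all axes. *)
have {}sr := sr m; move: (m%:~R) e2 sr => M e2 sr.
(* (A, B, T) is the antipode of the image of the starting point on the sphere, and [F] below is the
   inner product with it: it equals -1 at the start of the curve and 1 at its end. *)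
pose A := - (cos (c 0).1 * sech ((c 0).2 - M * beta)).
pose B := - (sin (c 0).1 * sech ((c 0).2 - M * beta)).
pose T := - tanh ((c 0).2 - M * beta).
have st (y : R) : sech y ^+ 2 + tanh y ^+ 2 = 1 by rewrite sech2_tanh2 subrK.
have ABT : A ^+ 2 + B ^+ 2 + T ^+ 2 = 1.
  rewrite -[RHS](st ((c 0).2 - M * beta)) -[X in _ = X + _]mul1r -(cos2Dsin2 (c 0).1).
  by rewrite /A /B /T; ring.
pose F (z : R * R) := A * (cos z.1 * sech (z.2 - M * beta)) +
  B * (sin z.1 * sech (z.2 - M * beta)) + T * tanh (z.2 - M * beta).
pose Fx (z : R * R) := sech (z.2 - M * beta) * (B * cos z.1 - A * sin z.1).
pose Fy (z : R * R) := sech (z.2 - M * beta) *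
  (T * sech (z.2 - M * beta) - tanh (z.2 - M * beta) * (A * cos z.1 + B * sin z.1)).
(* On the unit sphere, the gradient of a linear form F of norm 1 has squared length 1 - F^2; [sech]
   converts it to the plane. *)
have key z : Fx z ^+ 2 + Fy z ^+ 2 = sech (z.2 - M * beta) ^+ 2 * (1 - F z ^+ 2).
  rewrite /Fx /Fy /F; have := cos2Dsin2 z.1; have := st (z.2 - M * beta).
  move: (sech _) (tanh _) (cos _) (sin _) => s t x y s1 x1.
  have -> : 1 = (A ^+ 2 + B ^+ 2) * (x ^+ 2 + y ^+ 2) * (s ^+ 2 + t ^+ 2) + T ^+ 2 * (s ^+ 2 + t ^+ 2).
    by rewrite s1 x1 !mulr1 ABT.
  have e3 : s ^+ 2 = 1 - t ^+ 2 by rewrite -s1; ring.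
  have e4 : x ^+ 2 = 1 - y ^+ 2 by rewrite -x1; ring.
  have -> : (s * (B * x - A * y)) ^+ 2 + (s * (T * s - t * (A * x + B * y))) ^+ 2 =
    s ^+ 2 * ((A ^+ 2 + B ^+ 2) * (x ^+ 2 + y ^+ 2) + T ^+ 2 * s ^+ 2 - 2 * T * s * t * (A * x + B * y)
      - (A * x + B * y) ^+ 2 * (1 - t ^+ 2)) by ring.
  rewrite -e3; apply/eqP; rewrite -subr_eq0; apply/eqP.
  transitivity (s ^+ 2 * ((A ^+ 2 + B ^+ 2) * (x ^+ 2 + y ^+ 2)) * (1 - (s ^+ 2 + t ^+ 2))); first by ring.
  by rewrite s1 subrr mulr0.
have F1 z : F z ^+ 2 <= 1.
  have s0 : 0 < sech (z.2 - M * beta) ^+ 2 by rewrite exprn_gt0// sech_gt0.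
  rewrite -subr_ge0 -(pmulr_rge0 _ s0) -key; apply: addr_ge0; exact: sqr_ge0.
have c2 : continuous (fun z : R * R => z.2 - M * beta).
  by apply: continuous_sub => [z|]; [exact: cvg_snd|exact: continuous_const].
have cs : continuous (fun z : R * R => sech (z.2 - M * beta)).
  exact: (continuous_compose (@sech_continuous R) c2).
have ct : continuous (fun z : R * R => tanh (z.2 - M * beta)).
  exact: (continuous_compose (@tanh_continuous R) c2).
have c1 : continuous (fun z : R * R => z.1) by move=> z; exact: cvg_fst.
have ccos : continuous (fun z : R * R => cos z.1) by exact: (continuous_compose (@continuous_cos R) c1).
have csin : continuous (fun z : R * R => sin z.1) by exact: (continuous_compose (@continuous_sin R) c1).
have cK (a : R) (g : R * R -> R) : continuous g -> continuous (fun z => a * g z).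
  by move=> cg; apply: continuous_mul => //; exact: continuous_const.
have cF : continuous F.
  apply: continuous_add; last exact: cK.
  by apply: continuous_add; apply: cK; exact: continuous_mul.
have cFx : continuous Fx.
  by apply: continuous_mul => //; apply: continuous_sub; exact: cK.
have cFy : continuous Fy.
  apply: continuous_mul => //; apply: continuous_sub; first exact: cK.
  by apply: continuous_mul => //; apply: continuous_add; exact: cK.
have cal d : 0 <= d < 1 -> calibrates (fun z => asin (d * F z)) rho.
  move=> /andP[d0 d1]; have d2 : d ^+ 2 < 1 by rewrite expr_lt1.
  have dF z : (d * F z) ^+ 2 < 1.
    by rewrite exprMn; apply: le_lt_trans d2; rewrite ler_piMr// sqr_ge0.
  have dF1 z : -1 < d * F z < 1 by have := dF z; move: (d * F z) => u u2; apply/andP; split; nra.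
  have q0 z : 0 < 1 - (d * F z) ^+ 2 by rewrite subr_gt0.
  have sq z : Num.sqrt (1 - (d * F z) ^+ 2) != 0 by rewrite gt_eqF// sqrtr_gt0.
  pose S (z : R * R) := (Num.sqrt (1 - (d * F z) ^+ 2))^-1.
  have cS : continuous S.
    apply: continuous_inv => //; apply: (continuous_compose (@sqrt_continuous R)).
    by apply: continuous_sub; [exact: continuous_const|apply: continuous_pow; exact: cK].
  apply: (@calibrates_fun _ (fun z => S z * (d * Fx z)) (fun z => S z * (d * Fy z))).
  - by apply: continuous_mul => //; exact: cK.
  - by apply: continuous_mul => //; exact: cK.
  - move=> h h' q q' [_ dh] [_ dq] s; apply: der_eq.
      apply: der_asin; first exact: dF1.
      apply: der_mul; first exact: der_const.
      have ds : has_deriv (fun s => q s - M * beta) s (q' s).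
        by apply: der_eq; first (by deriv); rewrite /=; ring.
      have d3 := @der_comp _ _ (fun s => q s - M * beta) _ _ _ (der_sech _) ds.
      have d4 := @der_comp _ _ (fun s => q s - M * beta) _ _ _ (der_tanh _) ds.
      apply: der_add; [apply: der_add|]; apply: der_mul; try exact: der_const.
      + by apply: der_mul; [deriv|exact: d3].
      + by apply: der_mul; [deriv|exact: d3].
      + exact: d4.
    by rewrite /= /S /Fx /Fy /=; ring.
  - move=> z; apply: (@le_trans _ _ (sech (z.2 - M * beta) ^+ 2)); last first.
      by rewrite lerXn2r// nnegrE ltW// sech_gt0.
    have -> : (S z * (d * Fx z)) ^+ 2 + (S z * (d * Fy z)) ^+ 2 =
        S z ^+ 2 * d ^+ 2 * (Fx z ^+ 2 + Fy z ^+ 2) by ring.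
    rewrite key /S exprVn sqr_sqrtr; last exact: ltW.
    have -> : (1 - (d * F z) ^+ 2)^-1 * d ^+ 2 * (sech (z.2 - M * beta) ^+ 2 * (1 - F z ^+ 2)) =
      sech (z.2 - M * beta) ^+ 2 * (d ^+ 2 * (1 - F z ^+ 2) / (1 - (d * F z) ^+ 2)) by ring.
    apply: ler_piMr; first exact: sqr_ge0.
    by rewrite (ler_pdivrMr _ _ (q0 z)) mul1r [(d * F z) ^+ 2]exprMn; lra.
have F0 : F (c 0) = -1.
  by rewrite -[in RHS]ABT /F /A /B /T; ring.
have Fe : F (c 1) = 1.
  rewrite -[RHS]ABT /F e1 cosDpi sinDpi.
  have -> : (c 1).2 - M * beta = - ((c 0).2 - M * beta) by rewrite e2; ring.
  by rewrite sechN tanhN /A /B /T; ring.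
rewrite leNgt; apply/negP => Lpi.
have L0 : 0 <= curve_length phi c := curve_length_ge0 c cphi.
(* Half way between half the length and pi / 2. Calibrating with d = sin th bounds the length below
   by 2 th, which exceeds it if it is less than pi. *)
pose th := (curve_length phi c / 2 + pi / 2) / 2.
have th_range : 0 <= th < pi / 2 by rewrite /th; apply/andP; split; lra.
have s1 : 0 <= sin th < 1.
  have /andP[t0 t1] := th_range; apply/andP; split.
    by apply: sin_ge0_pi; rewrite t0/=; lra.
  have ct0 : 0 < cos th by apply: cos_gt0_pihalf; rewrite t1 andbT; lra.
  by have := cos2Dsin2 th; nra.
have := curve_length_calibrated cphi (cal _ s1) cp.
have as1 : asin (sin th) = th by apply: sinK; have /andP[t0 t1] := th_range; rewrite in_itv/= (ltW t1) andbT; lra.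
have as2 : asin (- sin th) = - th.
  by rewrite -sinN; apply: sinK; have /andP[t0 t1] := th_range; rewrite in_itv/= lerN2 (ltW t1)/=; lra.
rewrite F0 Fe mulr1 mulrN1 as1 as2 /th; lra.
Qed.

End LengthBelow.

(** * The extremal metric *)

Section Extremal.
Context {R : realType}.
Variable beta : R.
Hypothesis beta_gt0 : 0 < beta.

(** The floor of y / beta + 1/2 is an integer nearest to y / beta. *)
Definition dist_lattice (y : R) : R := `|y - (Num.floor (y / beta + 1 / 2))%:~R * beta|.

Let lattice_step (m n : int) : m < n -> m%:~R * beta + beta <= n%:~R * beta.
Proof.
move=> mn; have : (m + 1)%:~R <= n%:~R :> R by rewrite ler_int -ltzD1 ltrD2r.
by rewrite intrD -(ler_pM2r beta_gt0) mulrDl mul1r.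
Qed.

Lemma dist_lattice_eq n y : `|y - n%:~R * beta| <= beta / 2 ->
  forall m, `|y - n%:~R * beta| <= `|y - m%:~R * beta|.
Proof.
move=> yn m; have [mn|nm|->//] := ltgtP m n; apply: (le_trans yn).
  apply: le_trans (ler_norm _); have := lattice_step mn; move: yn; rewrite ler_norml => /andP[].
  lra.
rewrite distrC; apply: le_trans (ler_norm _); have := lattice_step nm; move: yn.
rewrite ler_norml => /andP[]; lra.
Qed.

Lemma dist_lattice_le n y : dist_lattice y <= `|y - n%:~R * beta|.
Proof.
apply: dist_lattice_eq; set m := Num.floor _.
have k1 : m%:~R <= y / beta + 1 / 2 by exact: floor_le.
have k2 : y / beta + 1 / 2 < m%:~R + 1 by rewrite -intrD1; exact: floorD1_gt.
have e : (y / beta + 1 / 2) * beta = y + beta / 2 by field; rewrite gt_eqF.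
rewrite -(ler_pM2r beta_gt0) e in k1; rewrite -(ltr_pM2r beta_gt0) e mulrDl mul1r in k2.
by rewrite ler_norml; apply/andP; split; lra.
Qed.

Lemma dist_latticeE n y : `|y - n%:~R * beta| <= beta / 2 ->
  dist_lattice y = `|y - n%:~R * beta|.
Proof.
move=> yn; apply/eqP; rewrite eq_le dist_lattice_le/=; exact: dist_lattice_eq.
Qed.

Lemma dist_lattice_period n y : dist_lattice (y + n%:~R * beta) = dist_lattice y.
Proof.
have h k x : dist_lattice (x + k%:~R * beta) <= dist_lattice x.
  rewrite {2}/dist_lattice; set m := Num.floor _.
  apply: le_trans (dist_lattice_le (m + k) _) _; apply: eq_ler; congr Num.norm.
  by rewrite intrD; ring.
apply/eqP; rewrite eq_le h/= -{1}(_ : y + n%:~R * beta + (- n)%:~R * beta = y) ?h//.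
by rewrite mulrNz; ring.
Qed.

Lemma dist_lattice_opp y : dist_lattice (- y) = dist_lattice y.
Proof.
have h x : dist_lattice (- x) <= dist_lattice x.
  rewrite {2}/dist_lattice; set m := Num.floor _.
  apply: le_trans (dist_lattice_le (- m) _) _; apply: eq_ler.
  by rewrite mulrNz -normrN; congr Num.norm; ring.
by apply/eqP; rewrite eq_le h/= -{1}[y]opprK h.
Qed.

(** A minimum of distances to points is 1-Lipschitz. *)
Lemma dist_lattice_continuous : continuous dist_lattice.
Proof.
have lip x y : dist_lattice x - dist_lattice y <= `|x - y|.
  rewrite {2}/dist_lattice; set m := Num.floor _.
  have := dist_lattice_le m x; have := ler_normD (x - y) (y - m%:~R * beta).
  by rewrite (_ : x - y + (y - m%:~R * beta) = x - m%:~R * beta); [lra|ring].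
move=> x; apply/cvgrPdist_le => e e0; have := nbhsx_ballx x e e0.
apply: filterS => y; rewrite -ball_normE /ball_/= => /ltW; apply: le_trans.
by rewrite ler_norml; have := lip x y; have := lip y x; rewrite [`|y - x|]distrC; lra.
Qed.

Variable w : R.
Hypothesis w_range : 0 < w < pi / 2.
Hypothesis betaE : beta = beta_of w.

Let b := b_of w.
Let D := ratio w.
Let Y := y_of w.
Let C := cos w.

Let Y0 : 0 < Y. Proof. exact: y_of_gt0. Qed.
Let C0 : 0 < C. Proof. exact: cosw_gt0. Qed.
Let b0 : 0 < b. Proof. exact: b_of_gt0. Qed.
Let D0 : 0 < D. Proof. exact: ratio_gt0. Qed.
Let flat_width : beta - Y - Y = 2 * (b - w) / C.
Proof. by rewrite betaE beta_ofE// -/Y -/C -/b; ring. Qed.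
Let flat_gt0 : 0 < beta - Y - Y.
Proof. by rewrite flat_width; apply: divr_gt0 => //; apply: mulr_gt0 => //; rewrite subr_gt0; exact: b_of_gt. Qed.

Definition extremal (y : R) : R := Num.max (sech (dist_lattice y)) (cos w).

Lemma extremal_continuous : continuous extremal.
Proof.
move=> y; apply: (@continuous_max _ _ (fun y => sech (dist_lattice y)) (fun=> cos w)); last exact: cst_continuous.
exact: (continuous_compose (@sech_continuous R) dist_lattice_continuous).
Qed.

Lemma extremal_gt0 y : 0 < extremal y.
Proof. by rewrite lt_max sech_gt0. Qed.

Lemma extremal_ge_cos y : cos w <= extremal y.
Proof. by rewrite le_max lexx orbT. Qed.

Lemma extremal_ge_sech n y : sech (y - n%:~R * beta) <= extremal y.
Proof.
rewrite le_max; apply/orP; left; apply: le_sech.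
by rewrite [X in X <= _]ger0_norm ?normr_ge0//; exact: dist_lattice_le.
Qed.

Lemma extremal_cap n y : `|y - n%:~R * beta| <= y_of w -> extremal y = sech (y - n%:~R * beta).
Proof.
move=> yY; apply/eqP; rewrite eq_le extremal_ge_sech andbT /extremal.
rewrite (@dist_latticeE n); last by apply: le_trans yY _; have := flat_gt0; rewrite /Y; lra.
rewrite ge_max; apply/andP; split; first by apply: le_sech; rewrite normr_id.
by rewrite -(sech_y_of w_range); apply: le_sech; rewrite [X in _ <= X]gtr0_norm.
Qed.

Lemma extremal_flat y : (forall n : int, y_of w <= `|y - n%:~R * beta|) -> extremal y = cos w.
Proof.
move=> yY; apply/eqP; rewrite eq_le extremal_ge_cos andbT ge_max lexx andbT.
rewrite -(sech_y_of w_range); apply: le_sech.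
by rewrite gtr0_norm// ger0_norm ?normr_ge0//; exact: yY.
Qed.

Lemma extremal_period n y : extremal (y + n%:~R * beta) = extremal y.
Proof. by rewrite /extremal dist_lattice_period. Qed.

Lemma extremal_opp y : extremal (- y) = extremal y.
Proof. by rewrite /extremal dist_lattice_opp. Qed.

(** Applied to the identity for the height and to the square for the area. *)
Lemma extremal_integral (G : R -> R) : continuous G ->
  rint 0 beta (fun y => G (extremal y)) =
  2 * rint 0 (y_of w) (fun y => G (sech y)) + (beta - 2 * y_of w) * G (cos w).
Proof.
move=> cG; rewrite -/Y -/C.
have cg : continuous (fun y => G (extremal y)) by exact: (continuous_compose cG extremal_continuous).
have YB : Y <= beta - Y by rewrite -subr_ge0 ltW.
have YB' : beta - Y <= beta by rewrite gerBl ltW.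
have cap : rint 0 Y (fun y => G (extremal y)) = rint 0 Y (fun y => G (sech y)).
  apply: eq_rint => y /andP[y0 yY].
  by rewrite (@extremal_cap 0) mul0r subr0// ger0_norm.
rewrite (rint_cat cg (ltW Y0) (le_trans YB YB')) (rint_cat cg YB YB') cap.
have -> : rint Y (beta - Y) (fun y => G (extremal y)) = (beta - 2 * Y) * G C.
  rewrite (_ : beta - 2 * Y = beta - Y - Y); last by ring.
  rewrite -(rint_cst _ YB); apply: eq_rint => y /andP[y1 y2]; congr G.
  apply: extremal_flat => n; rewrite -/Y.
  have [n0|n1] := leP n 0.
    apply: le_trans (ler_norm _); move: n0; rewrite le_eqVlt => /predU1P[->|n0].
      by rewrite mul0r subr0.
    by have := lattice_step n0; rewrite mul0r; lra.
  rewrite distrC; apply: le_trans (ler_norm _).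
  by have := lattice_step n1; rewrite mul0r add0r; lra.
have -> : rint (beta - Y) beta (fun y => G (extremal y)) = rint 0 Y (fun y => G (extremal y)).
  transitivity (rint (- Y) 0 (fun y => G (extremal y))).
    rewrite -[X in rint _ X _]add0r [beta - Y]addrC -(rint_shift _ _ _ cg).
    by apply: eq_rint => y _; rewrite -[X in y + X]mul1r (extremal_period 1).
  rewrite -[X in rint _ X _]oppr0 -(rint_opp _ _ cg).
  by apply: eq_rint => y _; rewrite extremal_opp.
by rewrite cap; ring.
Qed.

Lemma extremal_height : rint 0 beta extremal = 2 * b_of w.
Proof.
rewrite (@extremal_integral id) => [|x]; last exact: cvg_id.
rewrite (rint_ftc (ltW Y0) (@sech_continuous R) (@der_gd R)) gd0 gd_y_of// subr0.
rewrite (_ : beta - 2 * y_of w = 2 * (b - w) / C); last by rewrite -flat_width -/Y; ring.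
by rewrite -/C -/b divfK ?gt_eqF//; ring.
Qed.

Lemma extremal_area : rint 0 beta (fun y => extremal y ^+ 2) = 6 * (cos w * b_of w * ratio w).
Proof.
have c2 : continuous (fun y : R => sech y ^+ 2) by apply: continuous_pow; exact: sech_continuous.
rewrite (@extremal_integral (fun x => x ^+ 2)); last exact: exprn_continuous.
rewrite (rint_ftc (ltW Y0) c2 (@der_tanh R)) tanh0 tanh_y_of// subr0.
rewrite (_ : beta - 2 * y_of w = 2 * (b - w) / C); last by rewrite -flat_width -/Y; ring.
transitivity (2 * (sin w + (b - w) * C)).
  by rewrite -/C; field; rewrite gt_eqF.
by rewrite (area_ratio w_range : sin w + (b - w) * C = 3 * (C * b * D)) -/C -/b -/D; ring.
Qed.

Lemma extremal_metric : exists2 phi : klein beta -> R, conformal_factor phi &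
  forall z, phi (klein_proj beta z) = extremal z.2.
Proof.
have [|k n z|phi cphi phiE] := @klein_descend _ beta (fun z => extremal z.2).
- by apply: (continuous_compose extremal_continuous) => z; exact: cvg_snd.
- rewrite /deck /= (_ : n%:~R * (2 * beta) = (n + n)%:~R * beta); last by rewrite intrD; ring.
  by rewrite extremal_period; have [->|->] := @sign_cases R k; rewrite ?mulN1r ?mul1r ?extremal_opp.
exists phi => //; split => // p.
by rewrite (_ : p = klein_proj beta (repr p)) ?phiE ?extremal_gt0// /klein_proj reprK.
Qed.

Section Equality.
Variable phi : klein beta -> R.
Hypothesis cphi : conformal_factor phi.
Hypothesis phiE : forall z, phi (klein_proj beta z) = extremal z.2.

Let pi0 : 0 < pi :> R. Proof. exact: pi_gt0. Qed.

Let extremal_axis n : extremal (n%:~R * beta) = 1.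
Proof.
rewrite (@extremal_cap n) subrr; first by rewrite /sech cosh0 invr1.
by rewrite normr0 ltW.
Qed.

(** The upper bound is attained by the axis, where the profile is 1: half of the equator of a
    spherical cap. *)
Lemma extremal_glide (n : int) : least_length (deck beta 1 n) phi = pi.
Proof.
apply/eqP; rewrite eq_le; apply/andP; split; last first.
  by apply: l_glide_ge => // m z; rewrite phiE; exact: extremal_ge_sech.
have C1x : C1 (fun s : R => s * pi) (fun=> pi).
  split; first exact: continuous_const.
  by move=> s; apply: der_eq; [deriv|rewrite /=; ring].
have C1y : C1 (fun _ : R => n%:~R * beta) (fun=> 0).
  split; first exact: continuous_const.
  by move=> s; apply: der_const.
apply: le_trans (least_length_le (k := 1) (n := n) cphi C1x C1y _) _.
  by rewrite /deck /= expr1z; congr pair; ring.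
apply: eq_ler; transitivity (rint 0 1 (fun=> pi : R)); last by rewrite rint_cst ?ler01// subr0 mul1r.
apply: eq_rint => s _; rewrite phiE /= extremal_axis mul1r expr0n addr0.
by rewrite sqrtr_sqr gtr0_norm.
Qed.

Lemma extremal_l_v : 4 * b_of w <= l_v phi.
Proof.
have [F dF] := rint_prim extremal_continuous.
apply: (@l_v_ge _ _ _ beta_gt0 cphi extremal F) => // [|y]; first exact: extremal_continuous.
have ce := extremal_continuous; have b2 : 0 <= 2 * beta by rewrite mulr_ge0// ltW.
have per y' : extremal (y' + beta) = extremal y'.
  by rewrite -[X in y' + X]mul1r (extremal_period 1).
have le_y : y <= y + 2 * beta by rewrite lerDl.
have := rint_ftc le_y ce dF.
rewrite (rint_periodic _ ce b2) => [|x]; last first.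
  by rewrite (_ : x + 2 * beta = x + beta + beta) ?per//; ring.
have be : beta <= beta + beta by rewrite lerDl ltW.
rewrite (_ : 2 * beta = beta + beta); last by ring.
rewrite (rint_cat ce (ltW beta_gt0) be) (rint_periodic _ ce (ltW beta_gt0) per) extremal_height.
lra.
Qed.

Lemma extremal_l_h : 2 * pi * cos w <= l_h phi.
Proof.
by apply: l_h_ge => // [|z]; [exact: ltW|rewrite phiE; exact: extremal_ge_cos].
Qed.

Lemma extremal_vol : vol phi = 12 * pi * (cos w * b_of w * ratio w).
Proof.
rewrite vol_sq//; last exact: ltW.
have c2 : continuous (fun y => extremal y ^+ 2) by apply: continuous_pow; exact: extremal_continuous.
transitivity (rint 0 beta (fun y => 2 * pi * extremal y ^+ 2)).
  apply: eq_rint => y _; have p2 : 0 <= 2 * pi :> R by rewrite mulr_ge0// ltW.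
  transitivity (rint 0 (2 * pi) (fun=> extremal y ^+ 2)).
    by apply: eq_rint => x _; rewrite phiE.
  by rewrite rint_cst// subr0.
by rewrite rintZ// extremal_area; ring.
Qed.

(** Lower bounds for [l_v] and [l_h] suffice, since [product_le] supplies the opposite
    inequality. *)
Lemma extremal_equality : l_sigma phi = l_tsigma phi /\
  l_sigma phi * l_v phi * l_h phi = bound_constant (b_of w) w * vol phi `^ (3 / 2).
Proof.
have s1 : l_sigma phi = pi by rewrite /l_sigma (sigma_deck beta) extremal_glide.
have s2 : l_tsigma phi = pi by rewrite /l_tsigma tsigma_deck extremal_glide.
split; first by rewrite s1 s2.
apply/eqP; rewrite eq_le; apply/andP; split.
  have := product_le cphi w_range betaE.
  by rewrite s1 s2 minxx.
apply: (@le_trans _ _ (pi * (4 * b) * (2 * pi * C))); last first.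
  have h0 : 0 <= 2 * pi * C by apply: mulr_ge0; [apply: mulr_ge0 => //|]; exact: ltW.
  have v0 : 0 <= 4 * b by apply: mulr_ge0 => //; exact: ltW.
  rewrite s1; apply: ler_pM => //; last exact: extremal_l_h.
    by apply: mulr_ge0 => //; exact: ltW.
  by rewrite ler_pM2l//; exact: extremal_l_v.
have CbD : 0 < C * b * D by apply: mulr_gt0 => //; exact: mulr_gt0.
have V0 : 0 <= 12 * pi * (C * b * D).
  by apply: mulr_ge0; [apply: mulr_ge0 => //|]; exact: ltW.
rewrite extremal_vol powR_three_halves// -/C -/b -/D.
have K0 : 0 < 27 * D ^+ 3 * (8 * pi * b ^+ 2 * C ^+ 2).
  have D3 := exprn_gt0 3 D0; have b2 := exprn_gt0 2 b0; have C2 := exprn_gt0 2 C0.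
  by apply: mulr_gt0; [exact: mulr_gt0|exact: mulr_gt0 (mulr_gt0 (mulr_gt0 (ltr0n _ 8) pi0) b2) C2].
have V2 : Num.sqrt (12 * pi * (C * b * D)) ^+ 2 = 12 * pi * (C * b * D) by rewrite sqr_sqrtr.
have E : Num.sqrt (12 * pi * (C * b * D)) ^+ 3 =
  27 * D ^+ 3 * (8 * pi * b ^+ 2 * C ^+ 2) * bound_constant b w := bound_constant_cube w_range.
rewrite -(ler_pM2l K0) [leLHS]mulrA -E; apply: eq_ler.
transitivity ((Num.sqrt (12 * pi * (C * b * D)) ^+ 2) ^+ 3); first by ring.
by rewrite V2; ring.
Qed.

End Equality.

End Extremal.

(** * Local isometries of the extremal metric to the sphere and the plane *)

Section FlatSpherical.
Context {R : realType}.
Implicit Types (f g : R * R -> R) (z : R * R).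

Lemma is_derive_dx f z l : has_deriv (fun x => f (x, z.2)) z.1 l ->
  is_derive z ((1, 0) : R * R) f l.
Proof.
have E : (fun h : R => h^-1 *: ((f \o shift z) (h *: ((1, 0) : R * R)) - f z)) =
    (fun h : R => h^-1 *: (((fun x => f (x, z.2)) \o shift z.1) (h *: (1 : R)) - f (z.1, z.2))).
  apply/funext => h /=; rewrite -surjective_pairing; congr (_ *: (f _ - _)).
  by case: z => x y; rewrite /shift /=; congr pair; rewrite /= scaler0 add0r.
move=> [d e]; split; first by rewrite /derivable E; exact: d.
by rewrite /derive E; exact: e.
Qed.

Lemma is_derive_dy f z l : has_deriv (fun y => f (z.1, y)) z.2 l ->
  is_derive z ((0, 1) : R * R) f l.
Proof.
have E : (fun h : R => h^-1 *: ((f \o shift z) (h *: ((0, 1) : R * R)) - f z)) =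
    (fun h : R => h^-1 *: (((fun y => f (z.1, y)) \o shift z.2) (h *: (1 : R)) - f (z.1, z.2))).
  apply/funext => h /=; rewrite -surjective_pairing; congr (_ *: (f _ - _)).
  by case: z => x y; rewrite /shift /=; congr pair; rewrite /= scaler0 add0r.
move=> [d e]; split; first by rewrite /derivable E; exact: d.
by rewrite /derive E; exact: e.
Qed.

(* Closed under both partial derivatives, hence made of smooth functions. *)
Inductive elementary (a : R) : (R * R -> R) -> Prop :=
| elementary_const r : elementary a (fun=> r)
| elementary_x : elementary a (fun z => z.1)
| elementary_y : elementary a (fun z => z.2)
| elementary_cos : elementary a (fun z => cos z.1)
| elementary_sin : elementary a (fun z => sin z.1)
| elementary_sech : elementary a (fun z => sech (z.2 - a))
| elementary_tanh : elementary a (fun z => tanh (z.2 - a))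
| elementary_add f g : elementary a f -> elementary a g -> elementary a (fun z => f z + g z)
| elementary_mul f g : elementary a f -> elementary a g -> elementary a (fun z => f z * g z).

Lemma der_sech_shift (a y : R) : has_deriv (fun y => sech (y - a)) y (- (sech (y - a) * tanh (y - a))).
Proof.
have d : has_deriv (fun y => y - a) y 1 by apply: der_eq; [deriv|rewrite /=; ring].
by apply: der_eq; [exact: (@der_comp _ _ (fun y => y - a) _ _ _ (der_sech _) d)|rewrite mulr1].
Qed.

Lemma der_tanh_shift (a y : R) : has_deriv (fun y => tanh (y - a)) y (sech (y - a) ^+ 2).
Proof.
have d : has_deriv (fun y => y - a) y 1 by apply: der_eq; [deriv|rewrite /=; ring].
by apply: der_eq; [exact: (@der_comp _ _ (fun y => y - a) _ _ _ (der_tanh _) d)|rewrite mulr1].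
Qed.

Lemma elementary_continuous a f : elementary a f -> continuous f.
Proof.
have c1 : continuous (fun z : R * R => z.1) by move=> z; exact: cvg_fst.
have c2 : continuous (fun z : R * R => z.2) by move=> z; exact: cvg_snd.
have ca : continuous (fun z : R * R => z.2 - a).
  by apply: continuous_sub => //; exact: continuous_const.
elim=> {f} [r||||||| f g _ cf _ cg|f g _ cf _ cg] //.
- exact: continuous_const.
- exact: (continuous_compose (@continuous_cos R) c1).
- exact: (continuous_compose (@continuous_sin R) c1).
- exact: (continuous_compose (@sech_continuous R) ca).
- exact: (continuous_compose (@tanh_continuous R) ca).
- exact: continuous_add.
- exact: continuous_mul.
Qed.

Lemma elementary_dx a f : elementary a f -> exists2 fx, elementary a fx &
  forall z, has_deriv (fun x => f (x, z.2)) z.1 (fx z).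
Proof.
elim=> {f} [r||||||| f g ef [fx efx dfx] eg [gx egx dgx]|f g ef [fx efx dfx] eg [gx egx dgx]].
- exists (fun=> 0); [exact: elementary_const|move=> z /=; exact: der_const].
- exists (fun=> 1); [exact: elementary_const|move=> z; exact: der_id].
- exists (fun=> 0); [exact: elementary_const|move=> z /=; exact: der_const].
- exists (fun z => -1 * sin z.1).
    by apply: elementary_mul; [exact: elementary_const|exact: elementary_sin].
  by move=> z; apply: der_eq; [exact: der_cos (der_id _)|rewrite /=; ring].
- exists (fun z => cos z.1); first exact: elementary_cos.
  by move=> z; apply: der_eq; [exact: der_sin (der_id _)|rewrite /=; ring].
- exists (fun=> 0); [exact: elementary_const|move=> z /=; exact: der_const].
- exists (fun=> 0); [exact: elementary_const|move=> z /=; exact: der_const].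
- exists (fun z => fx z + gx z); first exact: elementary_add.
  by move=> z; exact: der_add (dfx z) (dgx z).
- exists (fun z => f z * gx z + g z * fx z).
    by apply: elementary_add; exact: elementary_mul.
  by move=> [x y]; exact: der_mul (dfx _) (dgx _).
Qed.

Lemma elementary_dy a f : elementary a f -> exists2 fy, elementary a fy &
  forall z, has_deriv (fun y => f (z.1, y)) z.2 (fy z).
Proof.
elim=> {f} [r||||||| f g ef [fx efx dfx] eg [gx egx dgx]|f g ef [fx efx dfx] eg [gx egx dgx]].
- exists (fun=> 0); [exact: elementary_const|move=> z /=; exact: der_const].
- exists (fun=> 0); [exact: elementary_const|move=> z /=; exact: der_const].
- exists (fun=> 1); [exact: elementary_const|move=> z; exact: der_id].
- exists (fun=> 0); [exact: elementary_const|move=> z /=; exact: der_const].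
- exists (fun=> 0); [exact: elementary_const|move=> z /=; exact: der_const].
- exists (fun z => -1 * (sech (z.2 - a) * tanh (z.2 - a))).
    apply: elementary_mul; first exact: elementary_const.
    by apply: elementary_mul; [exact: elementary_sech|exact: elementary_tanh].
  by move=> z; rewrite mulN1r; exact: der_sech_shift.
- exists (fun z => sech (z.2 - a) * sech (z.2 - a)).
    by apply: elementary_mul; exact: elementary_sech.
  by move=> z; rewrite -expr2; exact: der_tanh_shift.
- exists (fun z => fx z + gx z); first exact: elementary_add.
  by move=> z; exact: der_add (dfx z) (dgx z).
- exists (fun z => f z * gx z + g z * fx z).
    by apply: elementary_add; exact: elementary_mul.
  by move=> [x y]; exact: der_mul (dfx _) (dgx _).
Qed.

Lemma dxE f z l : has_deriv (fun x => f (x, z.2)) z.1 l -> dx f z = l.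
Proof. by move=> /is_derive_dx[_ e]. Qed.

Lemma dyE f z l : has_deriv (fun y => f (z.1, y)) z.2 l -> dy f z = l.
Proof. by move=> /is_derive_dy[_ e]. Qed.

Lemma elementary_smooth a f U : elementary a f -> smooth_on U f.
Proof.
move=> ef k; elim: k f ef => [|k IH] f ef; split => //.
- by move=> z _; exact: elementary_continuous ef z.
- by move=> z _; exact: elementary_continuous ef z.
have [fx efx dfx] := elementary_dx ef; have [fy efy dfy] := elementary_dy ef.
split.
- by move=> z _; have [] := is_derive_dx (dfx z).
- by move=> z _; have [] := is_derive_dy (dfy z).
- by rewrite (_ : dx f = fx); [exact: IH|apply/funext => z; exact: dxE].
- by rewrite (_ : dy f = fy); [exact: IH|apply/funext => z; exact: dyE].
Qed.

Lemma flat_isometric U (rho : R * R -> R) (k : R) : (forall z, U z -> rho z = k) ->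
  isometric_on U rho (fun i : 'I_2 => nth (fun=> 0) [:: fun z => k * z.1; fun z => k * z.2] i).
Proof.
move=> rk; split => [i|z Uz].
  have [i0|i1] : (i = 0 :> nat)%N \/ (i = 1 :> nat)%N by case: i => [[|[|]]] //=; auto.
    rewrite i0 /=; apply: (@elementary_smooth 0); apply: elementary_mul; first exact: elementary_const.
    exact: elementary_x.
  rewrite i1 /=; apply: (@elementary_smooth 0); apply: elementary_mul; first exact: elementary_const.
  exact: elementary_y.
rewrite !big_ord_recl !big_ord0 /= rk//.
have -> : dx (fun z => k * z.1) z = k by apply: dxE; rewrite /=; apply: der_eq; [deriv|rewrite /=; ring].
have -> : dx (fun z => k * z.2) z = 0 by apply: dxE; rewrite /=; apply: der_eq; [deriv|rewrite /=; ring].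
have -> : dy (fun z => k * z.1) z = 0 by apply: dyE; rewrite /=; apply: der_eq; [deriv|rewrite /=; ring].
have -> : dy (fun z => k * z.2) z = k by apply: dyE; rewrite /=; apply: der_eq; [deriv|rewrite /=; ring].
by split; ring.
Qed.

(** The inverse of the Mercator map of the unit sphere, with the equator on the line y = a. *)
Definition mercator (a : R) (i : 'I_3) : R * R -> R :=
  nth (fun=> 0) [:: fun z => cos z.1 * sech (z.2 - a); fun z => sin z.1 * sech (z.2 - a);
                    fun z => tanh (z.2 - a)] i.

Lemma mercator_sphere a z : \sum_(i < 3) mercator a i z ^+ 2 = 1.
Proof.
rewrite !big_ord_recl big_ord0 /= addr0 /mercator /=.
have := sech2_tanh2 (z.2 - a); have := cos2Dsin2 z.1.
move: (sech _) (tanh _) (cos _) (sin _) => s t x y e1 e2.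
have -> : (x * s) ^+ 2 + ((y * s) ^+ 2 + t ^+ 2) = (x ^+ 2 + y ^+ 2) * s ^+ 2 + t ^+ 2 by ring.
by rewrite e1 e2 mul1r subrK.
Qed.

Lemma mercator_isometric a U (rho : R * R -> R) : (forall z, U z -> rho z = sech (z.2 - a)) ->
  isometric_on U rho (mercator a).
Proof.
move=> rk; split => [i|z Uz].
  apply: (@elementary_smooth a); rewrite /mercator; case: i => [[|[|[|//]]]] /= _.
  - by apply: elementary_mul; [exact: elementary_cos|exact: elementary_sech].
  - by apply: elementary_mul; [exact: elementary_sin|exact: elementary_sech].
  - exact: elementary_tanh.
rewrite !big_ord_recl !big_ord0 /= rk// /mercator /=.
have ds := der_sech_shift a z.2; have dt := der_tanh_shift a z.2.
have -> : dx (fun z => cos z.1 * sech (z.2 - a)) z = - sin z.1 * sech (z.2 - a).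
  by apply: dxE; rewrite /=; apply: der_eq; [deriv|rewrite /=; ring].
have -> : dx (fun z => sin z.1 * sech (z.2 - a)) z = cos z.1 * sech (z.2 - a).
  by apply: dxE; rewrite /=; apply: der_eq; [deriv|rewrite /=; ring].
have -> : dx (fun z => tanh (z.2 - a)) z = 0 by apply: dxE => /=; exact: der_const.
have -> : dy (fun z => cos z.1 * sech (z.2 - a)) z = cos z.1 * - (sech (z.2 - a) * tanh (z.2 - a)).
  by apply: dyE; rewrite /=; apply: der_eq; [apply: der_mul; [exact: der_const|exact: ds]|rewrite /=; ring].
have -> : dy (fun z => sin z.1 * sech (z.2 - a)) z = sin z.1 * - (sech (z.2 - a) * tanh (z.2 - a)).
  by apply: dyE; rewrite /=; apply: der_eq; [apply: der_mul; [exact: der_const|exact: ds]|rewrite /=; ring].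
have -> : dy (fun z => tanh (z.2 - a)) z = sech (z.2 - a) ^+ 2 by exact: dyE.
have := sech2_tanh2 (z.2 - a); have := cos2Dsin2 z.1.
move: (sech _) (tanh _) (cos _) (sin _) => s t x y e1 e2.
have e3 : t ^+ 2 = 1 - s ^+ 2 by rewrite e2; ring.
split; last by ring.
  by rewrite addr0 expr0n addr0 -[RHS]mul1r -e1; ring.
transitivity ((x ^+ 2 + y ^+ 2) * s ^+ 2 * t ^+ 2 + s ^+ 4); first by ring.
by rewrite e1 e3; ring.
Qed.

Variables (beta w : R) (phi : klein beta -> R).
Hypothesis beta_gt0 : 0 < beta.
Hypothesis w_range : 0 < w < pi / 2.
Hypothesis betaE : beta = beta_of w.
Hypothesis phiE : forall z, phi (klein_proj beta z) = extremal beta w z.2.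

Let Y := y_of w.
Let Y0 : 0 < Y. Proof. exact: y_of_gt0. Qed.
Let Yb : Y < beta / 2.
Proof.
have : 0 < 2 * (b_of w - w) / cos w.
  apply: divr_gt0; last exact: cosw_gt0.
  by apply: mulr_gt0 => //; rewrite subr_gt0; exact: b_of_gt.
by have := beta_ofE w_range; rewrite -betaE -/Y; lra.
Qed.

(** Closed horizontal curves bounding the caps. Two are enough: translations by [2 * beta] leave
    only the parity of the axis, and [sigma] exchanges the two edges of one cap. *)
Let edge (i : 'I_2) (s : R) : R * R := (s * (2 * pi), (i : nat)%:R * beta + Y).

Let off z := forall (i : 'I_2) s, s \in `[0, 1] -> klein_proj beta z <> klein_proj beta (edge i s).

Let edge_dist (n : int) : dist_lattice beta (n%:~R * beta + Y) = Y.
Proof.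
rewrite (dist_latticeE beta_gt0 (n := n)) addrC addKr ?gtr0_norm//; exact: ltW.
Qed.

Let shift_into_period (x : R) (p : int) : exists j : int, 0 <= x + (2 * j + p)%:~R * pi <= 2 * pi.
Proof.
have p2 : 0 < 2 * pi :> R by rewrite mulr_gt0// pi_gt0.
pose u := x + p%:~R * pi; pose m := Num.floor (u / (2 * pi)); exists (- m).
have k1 : m%:~R * (2 * pi) <= u by rewrite -ler_pdivlMr//; exact: floor_le.
have k2 : u < m%:~R * (2 * pi) + 2 * pi.
  by rewrite -[X in _ + X]mul1r -mulrDl -ltr_pdivrMr// -intrD1; exact: floorD1_gt.
have -> : x + (2 * - m + p)%:~R * pi = u - m%:~R * (2 * pi).
  by rewrite /u intrD mulrN mulrNz intrM; ring.
by apply/andP; split; lra.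
Qed.

(** If the distance is [Y], then y or -y has the form n beta + Y; the parity of n selects the curve,
    and an even number of further half turns, which does not reflect y again, brings x into
    [0, 2 pi]. *)
Let offP z : off z <-> dist_lattice beta z.2 <> Y.
Proof.
split; last first.
  move=> zY i s _ /klein_proj_eq[k [n [_ e]]]; apply: zY.
  have := edge_dist (i : nat)%:Z; rewrite /edge /= in e; rewrite e.
  rewrite (_ : n%:~R * (2 * beta) = (n + n)%:~R * beta); last by rewrite intrD; ring.
  rewrite dist_lattice_period//.
  by have [->|->] := @sign_cases R k; rewrite ?mulN1r ?mul1r ?dist_lattice_opp.
move=> zoff; rewrite /dist_lattice; set n := Num.floor _ => zY.
have parity (m : int) : exists (i : 'I_2) (h : int), m = 2 * h + (i : nat)%:Z.
  exists (inord `|(m %% 2)%Z|%N), (m %/ 2)%Z.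
  have m2 : 0 <= (m %% 2)%Z < 2 by rewrite modz_ge0//= ltz_pmod.
  by rewrite inordK; lia.
have conclude (m k : int) : (-1) ^ k * z.2 = m%:~R * beta + Y ->
    (forall j : int, (-1) ^ (2 * j + k) = (-1) ^ k :> R) -> False.
  move=> e sgn; have [i [h mE]] := parity m; have [j /andP[x0 x1]] := shift_into_period z.1 k.
  have p2 : 0 < 2 * pi :> R by rewrite mulr_gt0// pi_gt0.
  apply: (zoff i ((z.1 + (2 * j + k)%:~R * pi) / (2 * pi))).
    by rewrite in_itv/=; apply/andP; split; [apply: divr_ge0 => //; exact: ltW|rewrite ler_pdivrMr// mul1r].
  rewrite -(klein_proj_deck beta (2 * j + k) (- h) z); congr klein_proj.
  rewrite /deck /edge sgn e divfK ?gt_eqF//; congr pair.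
  by rewrite mE intrD intrM mulrNz; ring.
have sgn (j k : int) : (-1) ^ (2 * j + k) = (-1) ^ k :> R.
  rewrite expfzDr ?oppr_eq0 ?oner_eq0// -exprz_exp -[(-1) ^ 2]/((-1) ^+ 2) sqrrN expr1n exp1rz.
  by rewrite mul1r.
have [d|d] := leP 0 (z.2 - n%:~R * beta).
  apply: (conclude n 0) => [|j]; last exact: sgn.
  by rewrite expr0z mul1r -zY ger0_norm// addrC subrK.
apply: (conclude (- n) 1) => [|j]; last exact: sgn.
by rewrite expr1z mulN1r -zY ltr0_norm// mulrNz; ring.
Qed.

Let spherical_cap z : dist_lattice beta z.2 < Y ->
  locally_spherical (fun z => 1 * phi (klein_proj beta z)) z.
Proof.
rewrite {1}/dist_lattice; set n := Num.floor _ => zY.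
exists [set z | `|z.2 - n%:~R * beta| < Y]; split => //.
  have c : continuous (fun z : R * R => `|z.2 - n%:~R * beta|).
    apply: (continuous_compose (@norm_continuous _ R)).
    by apply: continuous_sub => [z'|]; [exact: cvg_snd|exact: continuous_const].
  by move/continuousP : c => /(_ [set y | y < Y]); apply; exact: open_lt.
exists (mercator (n%:~R * beta)); split; last by move=> z' _; exact: mercator_sphere.
apply: mercator_isometric => z' /= /ltW z'Y.
by rewrite mul1r phiE; exact: (extremal_cap beta_gt0 w_range betaE).
Qed.

Let flat_strip z : Y < dist_lattice beta z.2 ->
  locally_flat (fun z => 1 * phi (klein_proj beta z)) z.
Proof.
move=> zY; exists [set z | Y < dist_lattice beta z.2]; split => //.
  have c : continuous (fun z : R * R => dist_lattice beta z.2).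
    by apply: (continuous_compose (dist_lattice_continuous beta_gt0)) => z'; exact: cvg_snd.
  by move/continuousP : c => /(_ [set y | Y < y]); apply; exact: open_gt.
eexists; apply: (@flat_isometric _ _ (cos w)) => z' /= z'Y.
rewrite mul1r phiE; apply: extremal_flat => // n.
exact: ltW (lt_le_trans z'Y (dist_lattice_le beta_gt0 n _)).
Qed.

Lemma extremal_flat_spherical : flat_spherical phi.
Proof.
exists 1, 2%N, edge => /=.
have d0 : dist_lattice beta 0 = 0.
  by rewrite (dist_latticeE beta_gt0 (n := 0)) mul0r subr0 normr0// divr_ge0// ltW.
have d1 : dist_lattice beta (beta / 2) = beta / 2.
  have b2 : 0 <= beta / 2 by rewrite divr_ge0// ltW.
  by rewrite (dist_latticeE beta_gt0 (n := 0)) mul0r subr0 ger0_norm.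
split => //.
- move=> i; split.
    apply: (@C1_piecewise _ _ (fun=> 2 * pi)); split; first exact: continuous_const.
    by move=> s; apply: der_eq (der_mul (der_id s) (der_const (2 * pi) s)) _; rewrite /= mulr0 mulr1 add0r.
  apply: (@C1_piecewise _ _ (fun=> 0)); split; first exact: continuous_const.
  by move=> s; exact: der_const.
- move=> z /offP zY; have [lt|gt|//] := ltgtP (dist_lattice beta z.2) Y.
    by left; exact: spherical_cap.
  by right; exact: flat_strip.
- exists (0, 0); last by apply: spherical_cap; rewrite /= d0.
  by apply/offP; rewrite /= d0 => e; move: Y0; rewrite -e ltxx.
- exists (0, beta / 2); last by apply: flat_strip; rewrite /= d1.
  by apply/offP; rewrite /= d1 => e; move: Yb; rewrite -e ltxx.
Qed.

End FlatSpherical.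

(** * The equation defining the angle w *)

Section Width.
Context {R : realType}.
Implicit Types w x : R.

(** Both [y_of w] and [b_of w - w] are nondecreasing, and strictness comes from the factor 1 / cos
    w. *)
Lemma beta_of_lt w w' : 0 < w -> w < w' -> w' < pi / 2 -> beta_of w < beta_of w'.
Proof.
move=> w0 ww' w'pi; have pi0 := pi_gt0 R.
have r : 0 < w < pi / 2 by rewrite w0 (lt_trans ww').
have r' : 0 < w' < pi / 2 by rewrite w'pi (lt_trans w0).
have [c0 c0'] := (cosw_gt0 r, cosw_gt0 r').
have cc : cos w' < cos w.
  by rewrite ltr_cos// in_itv/=; apply/andP; split; lra.
have yy : y_of w <= y_of w'.
  rewrite leNgt; apply/negP => y'y; move: cc; rewrite ltNge -(sech_y_of r) -(sech_y_of r') => /negP; apply.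
  by apply: le_sech; rewrite !gtr0_norm ?ltW//; exact: y_of_gt0.
have tw := tanw_ge r; have tt : w' - w <= tan w' - tan w.
  by apply: tan_expands; [rewrite ltW//= (lt_trans ww')|rewrite ltW// (lt_trans w0)|exact: ltW].
have bb : b_of w - w <= b_of w' - w'.
  have E (v : R) : b_of v - v = tan v - v + Num.sqrt (tan v ^+ 2 - v * tan v + v ^+ 2).
    by rewrite b_ofE addrAC.
  rewrite !E; apply: lerD; first by lra.
  (* With t = tan w, the radicand t^2 - w t + w^2 grows because t >= w and t increases at least as
     fast as w. *)
  apply: ler_wsqrtr; move: tt tw; move: (tan w) (tan w') => t t' tt tw.
  nra.
have b0 : 0 < b_of w - w by rewrite subr_gt0; exact: b_of_gt.
rewrite !beta_ofE//; apply: ler_ltD; first by rewrite ler_pM2l.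
rewrite ltr_pdivlMr//; apply: (@lt_le_trans _ _ (2 * (b_of w - w))); last by rewrite ler_pM2l.
rewrite mulrAC ltr_pdivrMr// ltr_pM2l//; exact: mulr_gt0.
Qed.

Lemma beta_of_continuous x : 0 <= x < pi / 2 -> {for x, continuous (@beta_of R)}.
Proof.
move=> /andP[x0 x1]; have pi0 := pi_gt0 R.
have cx : 0 < cos x by apply: cos_gt0_pihalf; rewrite x1 andbT; lra.
have u_range : 0 < pi / 4 + x / 2 < pi / 2 by apply/andP; split; lra.
have cu : 0 < cos (pi / 4 + x / 2).
  by apply: cos_gt0_pihalf; have /andP[? ->] := u_range; rewrite andbT; lra.
have su : 0 < sin (pi / 4 + x / 2) by exact: sin_gt0_pihalf.
have ci : {for x, continuous (fun w : R => w)} by exact: cvg_id.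
have cc (k : R) : {for x, continuous (fun _ : R => k)} by exact: cst_continuous.
have ct : {for x, continuous tan} by apply: continuous_tan; rewrite gt_eqF.
have clin : {for x, continuous (fun w : R => pi / 4 + w / 2)}.
  by apply: (continuousD (cc _)); apply: (continuousM ci (cc _)).
have ctu : {for x, continuous (fun w : R => tan (pi / 4 + w / 2))}.
  apply: (@continuous_comp _ _ _ (fun w : R => pi / 4 + w / 2) tan) => //.
  by apply: continuous_tan; rewrite gt_eqF.
have cln : {for x, continuous (fun w : R => ln (tan (pi / 4 + w / 2)))}.
  apply: (@continuous_comp _ _ _ (fun w : R => tan (pi / 4 + w / 2)) (@ln R)) => //.
  by apply: continuous_ln; rewrite divr_gt0.
have cs : {for x, continuous (fun w : R => Num.sqrt (tan w ^+ 2 - w * tan w + w ^+ 2))}.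
  apply: (@continuous_comp _ _ _ (fun w : R => tan w ^+ 2 - w * tan w + w ^+ 2) Num.sqrt); last exact: sqrt_continuous.
  have c1 := continuousM ct ct; have c2 := continuousM ci ct; have c3 := continuousM ci ci.
  exact: (continuousD (continuousB c1 c2) c3).
have civ : {for x, continuous (fun w : R => (cos w)^-1)}.
  by apply: continuousV; [rewrite gt_eqF|exact: continuous_cos].
have c4 := continuousM (cc 2) cln; have c5 := continuousM (cc 2) civ.
have c6 := continuousD (continuousB ct ci) cs.
exact: (continuousD c4 (continuousM c5 c6)).
Qed.

Lemma beta_of0 : beta_of (0 : R) = 0.
Proof.
rewrite /beta_of mul0r addr0 tan_piquarter ln1 tan0.
have -> : 0 ^+ 2 - 0 * 0 + 0 ^+ 2 = 0 :> R by ring.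
by rewrite sqrtr0; ring.
Qed.

Lemma beta_of_exists beta : 0 < beta -> exists2 w : R, 0 < w < pi / 2 & beta = beta_of w.
Proof.
move=> b0; have pi0 := pi_gt0 R.
(* An upper end for the intermediate value theorem: [beta_of v] is at least 2 (tan v - v), and v <
   pi / 2. *)
pose v : R := atan (beta + pi).
have v1 : v < pi / 2 by exact: atan_ltpi2.
have v0 : 0 < v by rewrite -atan0; apply: lt_atan; rewrite addr_gt0.
have r : 0 < v < pi / 2 by rewrite v0.
have cv := cosw_gt0 r.
have tv : tan v = beta + pi by rewrite /v atanK.
have big : beta <= beta_of v.
  have y0 := y_of_gt0 r; have h : tan v - v <= b_of v - v by rewrite lerB// b_ofE lerDl sqrtr_ge0.
  rewrite beta_ofE//.
  have : 2 * (tan v - v) <= 2 * (b_of v - v) / cos v.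
    have h0 : 0 <= b_of v - v by rewrite subr_ge0 ltW//; exact: b_of_gt.
    rewrite ler_pdivlMr//; apply: (@le_trans _ _ (2 * (b_of v - v) * 1)).
      by rewrite mulr1 -mulrA ler_pM2l//; apply: le_trans h; rewrite ler_piMr ?cos_le1// tv; lra.
    by rewrite mulr1 lexx.
  by rewrite tv; lra.
have [||w] := @IVT _ (@beta_of R) 0 v beta (ltW v0).
- apply: continuous_in_subspaceT => x; rewrite inE/= in_itv/= => /andP[x0 x1].
  by apply: beta_of_continuous; rewrite x0 (le_lt_trans x1).
- by rewrite beta_of0 ge_min (ltW b0)/= le_max big orbT.
rewrite in_itv/= => /andP[w0 wv] e; exists w => //.
rewrite (le_lt_trans wv v1) andbT lt_neqAle w0 andbT.
by apply: contraTneq b0 => w00; rewrite -e -w00 beta_of0 ltxx.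
Qed.

Lemma beta_of_unique beta : 0 < beta ->
  exists! w : R, 0 < w < pi / 2 /\ beta = beta_of w.
Proof.
move=> b0; have [w r e] := beta_of_exists b0; exists w; split => // w' [r' e'].
have /andP[w0 w1] := r; have /andP[w0' w1'] := r'.
have [lt|gt|//] := ltgtP w w'.
  by have := beta_of_lt w0 lt w1'; rewrite -e -e' ltxx.
by have := beta_of_lt w0' gt w1; rewrite -e -e' ltxx.
Qed.

End Width.

Theorem theorem1p5 (R : realType) (beta : R) (beta_gt0 : 0 < beta) :
  (exists! w : R, 0 < w < pi / 2 /\ beta = beta_of w) /\
  (forall w b : R, 0 < w < pi / 2 -> beta = beta_of w -> b = b_of w ->
     (forall phi : klein beta -> R, conformal_factor phi ->
        Num.min (l_sigma phi) (l_tsigma phi) * l_v phi * l_h phi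
          <= bound_constant b w * vol phi `^ (3 / 2)) /\
     (exists phi : klein beta -> R,
        [/\ conformal_factor phi, flat_spherical phi,
            l_sigma phi = l_tsigma phi
          & l_sigma phi * l_v phi * l_h phi
              = bound_constant b w * vol phi `^ (3 / 2)])).
Proof.
split; first exact: beta_of_unique.
move=> w _ w_range betaE ->; split => [phi cphi|]; first exact: product_le.
have [phi cphi phiE] := extremal_metric beta_gt0 w.
have [e1 e2] := extremal_equality beta_gt0 w_range betaE cphi phiE.
exists phi; split => //.
exact: extremal_flat_spherical phiE.
Qed.
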